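(* Let $n,k\ge 1$ be integers and let $V=\mathbb{R}^{n,1}$. The relative Lie algebra cohomology $H^\ell=H^\ell(\mathfrak{so}(n,1),\mathrm{SO}(n);\mathcal{P}(V^k))$ is as follows (equalities are isomorphisms of complex vector spaces; the symbol $\mathcal{R}_k\varphi_k$ denotes the space of classes $[f\varphi_k]$, $f\in\mathcal{R}_k$, the map $f\mapsto[f\varphi_k]$ being injective). (1) If $k<n$, then $$H^\ell=\begin{cases}\mathcal{R}_k\varphi_k & \text{if } \ell=k,\\ \big(\mathcal{S}_k/(c_1,\dots,c_k)\big)\,\varphi_{0,k}\,\mathrm{vol} & \text{if } \ell=n,\\ 0&\text{otherwise.}\end{cases}$$ (2) If $k=n$, then $$H^\ell=\begin{cases}\mathcal{R}_k\varphi_k\oplus \big(\mathcal{S}_k/(c_1,\dots,c_k)\big)\,\varphi_{0,k}\,\mathrm{vol} & \text{if } \ell=n,\\ 0&\text{otherwise.}\end{cases}$$ (3) If $k>n$, then $$H^\ell=\begin{cases}\big(\mathcal{P}_k/(q_1,\dots,q_n)\big)^{\mathrm{SO}(n)}\,\varphi_{0,k}\,\mathrm{vol} & \text{if } \ell=n,\\ 0&\text{otherwise.}\end{cases}$$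
   Context: $V=\mathbb{R}^{n,1}$ has an orthogonal basis $e_1,\dots,e_{n+1}$ with $(e_i,e_i)=1$ for $i\le n$ and $(e_{n+1},e_{n+1})=-1$; $V_+=\mathrm{span}(e_1,\dots,e_n)$. A point of $V^k$ is $\mathbf{v}=(v_1,\dots,v_k)$, and the $j$-th vector $v_j$ has coordinates $(x_{1j},\dots,x_{nj},t_j)$. The Gaussian is $\varphi_{0,k}(\mathbf{v})=\prod_{i=1}^k\exp(-\tfrac12(x_{1i}^2+\cdots+x_{ni}^2+t_i^2))$, and $\mathcal{P}(V^k)$ is the space of functions $p\,\varphi_{0,k}$ with $p$ a complex-valued polynomial on $V^k$. $\mathrm{SO}(n)\subset \mathrm{SO}_0(n,1)$ is the subgroup fixing $e_{n+1}$; it acts on functions by $(g f)(\mathbf v)=f(g^{-1}\mathbf v)$. Write $\mathfrak{so}(n,1)=\mathfrak{so}(n)\oplus\mathfrak{p}_0$, $\mathfrak p=\mathfrak p_0\otimes\mathbb C$. Identify $\bigwedge^2V$ with $\mathfrak{so}(n,1)$ by $(u\wedge v)(w)=(u,w)v-(v,w)u$; then $e_{i,n+1}=-e_i\wedge e_{n+1}$, $1\le i\le n$, is a basis of $\mathfrak p_0$, with dual basis $\omega_1,\dots,\omega_n$ of $\mathfrak{p}_0^*$, and $\mathrm{vol}=\omega_1\wedge\cdots\wedge\omega_n$. The cohomology is that of the complex $C^\ell=(\bigwedge^\ell\mathfrak p^*\otimes\mathcal P(V^k))^{\mathrm{SO}(n)}$ with $$d=\sum_{j=1}^k\sum_{\alpha=1}^n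 A(\omega_\alpha)\otimes\Big(x_{\alpha j}\frac{\partial}{\partial t_j}+t_j\frac{\partial}{\partial x_{\alpha j}}\Big),$$ where $A(\omega_\alpha)$ is left exterior multiplication by $\omega_\alpha$. $\mathcal{P}_k$ is the ring of complex-valued polynomials on $V^k$. $\mathcal{R}_k$ is the algebra of $\mathrm{O}(n)$-invariant complex polynomials on $V_+^k$, generated by $r_{ij}=\sum_{\alpha=1}^n x_{\alpha i}x_{\alpha j}$, $1\le i,j\le k$. $\mathcal{S}_k\supset\mathcal R_k$ is the algebra of $\mathrm{O}(n)$-invariant complex polynomials on $V^k$, generated by the $r_{ij}$ and $t_1,\dots,t_k$. Also $$c_j=\sum_{i=1}^k r_{ij}t_i\ (1\le j\le k),\qquad q_\alpha=\sum_{i=1}^k x_{\alpha i}t_i\ (1\le\alpha\le n).$$ The notations $(c_1,\dots,c_k)$ and $(q_1,\dots,q_n)$ mean the ideals they generate in $\mathcal S_k$ and $\mathcal P_k$ respectively. The Kudla–Millson cocycle $\varphi_k\in C^k$ is, up to a nonzero scalar, $$\varphi_k=\varphi_{0,k}\,\eta_1\wedge\cdots\wedge\eta_k,\qquad \eta_j=\sum_{\alpha=1}^n x_{\alpha j}\,\omega_\alpha.$$ *)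

(* Defs.v *)
From HB Require Import structures.
From mathcomp Require Import all_boot all_order all_algebra.
From mathcomp Require Import generic_quotient ring_quotient.
From mathcomp Require Import boolp classical_sets functions.
From mathcomp Require Import reals topology normedtype sequences derive exp.
From mathcomp Require Import complex.
From mathcomp Require Import -(notations) mpoly.

Set Implicit Arguments.
Unset Strict Implicit.
Unset Printing Implicit Defensive.

Import numFieldNormedType.Exports.
Import Order.TTheory GRing.Theory Num.Theory.

Local Open Scope ring_scope.
Local Open Scope complex_scope.
Local Open Scope quotient_scope.

Section Subspace.
Variables (K : pzRingType) (U : lmodType K).

Record subspace (S : submodClosed U) :=
  Subspace { subspace_val : U; _ : subspace_val \in S }.

HB.instance Definition _ (S : submodClosed U) :=
  [isSub for @subspace_val S].
HB.instance Definition _ (S : submodClosed U) :=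
  [Choice of subspace S by <:].
HB.instance Definition _ (S : submodClosed U) :=
  [SubChoice_isSubLmodule of subspace S by <:].

Lemma subspace_val_linear (S : submodClosed U) : linear (@subspace_val S).
Proof. exact: (linearP (\val : subspace S -> U)). Qed.

End Subspace.

Section Quotient.
Variables (K : pzRingType) (U : lmodType K).

(* B again: [submodClosed] does not inherit from the [zmodClosed] that
   [Quotient.quot] expects. *)
Definition modulus (B : submodClosed U) : {pred U} := fun x => x \in B.

HB.instance Definition _ (B : submodClosed U) :=
  GRing.isSubmodClosed.Build K U (modulus B) (submodClosedP B).

Definition quotient_space (B : submodClosed U) : Type :=
  Quotient.quot (modulus B).

HB.instance Definition _ (B : submodClosed U) :=
  GRing.Zmodule.on (quotient_space B).

Definition qproj (B : submodClosed U) (x : U) : quotient_space B :=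
  \pi_(Quotient.quot (modulus B)) x.

Definition qrepr (B : submodClosed U) (x : quotient_space B) : U :=
  repr (x : Quotient.quot (modulus B)).

Definition qscale (B : submodClosed U) (a : K) (x : quotient_space B) :
  quotient_space B := qproj B (a *: qrepr x).

Section Theory.
Variable B : submodClosed U.
Local Notation Q := (quotient_space B).

Lemma qreprK : cancel (@qrepr B) (@qproj B).
Proof. exact: reprK. Qed.

Lemma qprojE x y : (qproj B x = qproj B y) <-> (x - y \in B).
Proof.
rewrite -[_ \in B]/(x - y \in modulus B) Quotient.idealrBE.
by split=> /eqP.
Qed.

Lemma qprojD : {morph qproj B : x y / x + y}.
Proof. by move=> x y; rewrite /qproj !piE. Qed.

Lemma qscaleE a x : qscale a (qproj B x) = qproj B (a *: x).
Proof. by apply/qprojE; rewrite -scalerBr rpredZ//; apply/qprojE/qreprK. Qed.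

Lemma qscaleA a b (x : Q) : qscale a (qscale b x) = qscale (a * b) x.
Proof. by rewrite -[x]qreprK !qscaleE scalerA. Qed.

Lemma qscale1 : left_id 1 (@qscale B).
Proof. by move=> x; rewrite -[x]qreprK qscaleE scale1r. Qed.

Lemma qscaleDr : right_distributive (@qscale B) +%R.
Proof.
move=> a x y; rewrite -[x]qreprK -[y]qreprK -qprojD !qscaleE -qprojD.
by rewrite scalerDr.
Qed.

Lemma qscaleDl (x : Q) : {morph (@qscale B)^~ x : a b / a + b}.
Proof. by move=> a b; rewrite -[x]qreprK !qscaleE -qprojD scalerDl. Qed.

End Theory.

HB.instance Definition _ (B : submodClosed U) :=
  GRing.Zmodule_isLmodule.Build K (quotient_space B)
    (@qscaleA B) (@qscale1 B) (@qscaleDr B) (@qscaleDl B).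

Lemma qproj_is_linear (B : submodClosed U) : linear (qproj B).
Proof. by move=> a x y; rewrite qprojD -qscaleE. Qed.

HB.instance Definition _ (B : submodClosed U) :=
  GRing.isLinear.Build K U (quotient_space B) *:%R (qproj B)
    (@qproj_is_linear B).

End Quotient.
Arguments qproj {K U} B x.

Section Subquotient.
Variables (K : pzRingType) (U : lmodType K).

(* B need not be contained in S: only B :&: S matters. *)
Definition relative (S B : submodClosed U) : {pred subspace S} :=
  fun x => val x \in B.
Arguments relative : clear implicits.

Lemma relativeE (S B : submodClosed U) (x : subspace S) :
  (x \in relative S B) = (val x \in B).
Proof. by []. Qed.

Fact relative_submod (S B : submodClosed U) :
  GRing.submod_closed (relative S B).
Proof.
split=> [|a x y]; rewrite !relativeE ?raddf0 ?rpred0// => xB yB.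
by rewrite linearP rpredD ?rpredZ.
Qed.

HB.instance Definition _ (S B : submodClosed U) :=
  GRing.isSubmodClosed.Build K (subspace S) (relative S B)
    (relative_submod S B).

Definition subquotient (S B : submodClosed U) := quotient_space (relative S B).

HB.instance Definition _ (S B : submodClosed U) :=
  GRing.Lmodule.on (subquotient S B).

(* h is the class modulo B of the vector x, which has to lie in S *)
Definition is_class (S B : submodClosed U) (h : subquotient S B) (x : U) :=
  exists2 z : subspace S, val z = x & h = qproj (relative S B) z.

End Subquotient.
Arguments relative {K U} S B.

(** The exterior algebra of C^n, with basis the omega_I, I a subset of
    {0, .., n-1}, where omega_I is the wedge product of the omega_i for i in I
    in increasing order *)

Section Exterior.
Variables (C : comNzRingType) (n : nat).

Definition ext : Type := {ffun {set 'I_n} -> C^o}.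
HB.instance Definition _ := GRing.Lmodule.on ext.

Definition ext_basis (I : {set 'I_n}) : ext := [ffun J => (J == I)%:R].

Definition inversions (I J : {set 'I_n}) : nat :=
  #|[set p : 'I_n * 'I_n | [&& p.1 \in I, p.2 \in J & (p.2 < p.1)%N]]|.

Definition wedge (a b : ext) : ext :=
  [ffun J : {set 'I_n} => \sum_(I : {set 'I_n} | I \subset J)
     (-1) ^+ inversions I (J :\: I) * (a I * b (J :\: I))].

Definition ext1 : ext := ext_basis finset.set0.
Definition omega (i : 'I_n) : ext := ext_basis (finset.set1 i).
Definition vol : ext := \big[wedge/ext1]_(i < n) omega i.

(* The algebra endomorphism with omega_i |-> \sum_j g_ji omega_j. *)
Definition ext_map (g : 'M[C]_n) (a : ext) : ext :=
  \sum_(I : {set 'I_n})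
    a I *: \big[wedge/ext1]_(i < n | i \in I) \sum_(j < n) g j i *: omega j.

Lemma wedge_linearr (a : ext) : linear (wedge a).
Proof.
move=> c x y; apply/ffunP => J; rewrite !ffunE.
rewrite scaler_sumr -big_split; apply: eq_bigr => I _ /=.
by rewrite !ffunE !mulrDr -!scalerAr !scalerA (mulrC c).
Qed.

Lemma wedge_linear2 (w : ext) (x t a : C) (X Y X' Y' : ext) :
  wedge w (x *: (a *: X + Y) + t *: (a *: X' + Y')) =
  a *: wedge w (x *: X + t *: X') + wedge w (x *: Y + t *: Y').
Proof.
rewrite -wedge_linearr; congr wedge.
by rewrite !scalerDr !scalerA ![_ * a]mulrC addrACA.
Qed.

Lemma ext_map_linear (g : 'M[C]_n) : linear (ext_map g).
Proof.
move=> c x y; rewrite /ext_map scaler_sumr -big_split; apply: eq_bigr => I _ /=.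
by rewrite !ffunE scalerDl scalerA.
Qed.

Lemma ext_map0 (g : 'M[C]_n) : ext_map g 0 = 0.
Proof. by rewrite /ext_map big1// => I _; rewrite ffunE scale0r. Qed.

End Exterior.
Arguments ext_basis C {n} I.
Arguments ext1 {C n}.
Arguments omega {C n} i.
Arguments vol {C n}.

Definition orthogonal_mx (R : pzRingType) n (g : 'M[R]_n) := g *m g^T = 1%:M.
Definition special_orthogonal_mx (R : comPzRingType) n (g : 'M[R]_n) :=
  orthogonal_mx g /\ \det g = 1.

Section Functions.
Variables (R : realType).

Local Notation fct m k := ('M[R]_(m, k) -> R[i]^o).

Definition left_translate m k (T : Type) (g : 'M[R]_m) (f : 'M[R]_(m, k) -> T) :
  'M[R]_(m, k) -> T := fun v => f (invmx g *m v).

Definition polyfun m k : {pred fct m k} := fun f =>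
  `[< exists p : mpoly (m * k) R[i],
      forall v, f v = meval (fun i => (mxvec v 0 i)%:C) p >].

Definition partial m k (i : 'I_m) (j : 'I_k) (f : fct m k) : fct m k := fun v =>
  'D_(delta_mx i j) (fun w => complex.Re (f w)) v
  +i* 'D_(delta_mx i j) (fun w => complex.Im (f w)) v.

End Functions.
Arguments polyfun : clear implicits.

(** V = R^{n,1}: a point v of V^k is the (n + 1) x k matrix of its coordinates,
    with x-part [usubmx v] and t-part [dsubmx v] *)

Section KudlaMillson.
Variables (R : realType) (n k : nat).

Local Notation C := R[i].
Local Notation Vk := 'M[R]_(n + 1, k).
Local Notation Vplusk := 'M[R]_(n, k).

Definition xcoord (a : 'I_n) (j : 'I_k) : Vk -> C^o := fun v =>
  (usubmx v a j)%:C.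
Definition tcoord (j : 'I_k) : Vk -> C^o := fun v => (dsubmx v 0 j)%:C.

Definition partial_x (a : 'I_n) (j : 'I_k) := @partial R (n + 1) k (lshift 1 a) j.
Definition partial_t (j : 'I_k) := @partial R (n + 1) k (rshift n 0) j.

Definition gaussian : Vk -> C^o := fun v =>
  (\prod_(j < k)
     expR (- (2^-1 * (\sum_(a < n) usubmx v a j ^+ 2 + dsubmx v 0 j ^+ 2))))%:C.

Definition embed (g : 'M[R]_n) : 'M[R]_(n + 1) := block_mx g 0 0 1%:M.

Definition translate (g : 'M[R]_n) (f : Vk -> C^o) : Vk -> C^o :=
  left_translate (embed g) f.

Definition poly_gaussian : {pred (Vk -> C^o)} := fun f =>
  `[< exists2 p, p \in polyfun R (n + 1) k & f = p * gaussian >].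

Definition Rpoly : {pred (Vplusk -> C^o)} := fun f =>
  `[< f \in polyfun R n k /\
      forall g : 'M[R]_n, orthogonal_mx g -> left_translate g f = f >].

Definition Ppoly : {pred (Vk -> C^o)} := polyfun R (n + 1) k.

Definition Spoly : {pred (Vk -> C^o)} := fun f =>
  `[< f \in Ppoly /\
      forall g : 'M[R]_n, orthogonal_mx g -> translate g f = f >].

Definition rpoly (i j : 'I_k) : Vk -> C^o :=
  \sum_(a < n) xcoord a i * xcoord a j.
Definition cpoly (j : 'I_k) : Vk -> C^o := \sum_(i < k) rpoly i j * tcoord i.
Definition qpoly (a : 'I_n) : Vk -> C^o := \sum_(i < k) xcoord a i * tcoord i.

Definition cideal : {pred (Vk -> C^o)} := fun f =>
  `[< exists2 s : 'I_k -> Vk -> C^o, (forall j, s j \in Spoly) &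
        f = \sum_(j < k) s j * cpoly j >].
Definition qideal : {pred (Vk -> C^o)} := fun f =>
  `[< exists2 p : 'I_n -> Vk -> C^o, (forall a, p a \in Ppoly) &
        f = \sum_(a < n) p a * qpoly a >].

(** Differential forms: functions on V^k with values in the exterior algebra
    of p^*.

    Conjugation by g in SO(n) maps u /\ v to (g u) /\ (g v) and g fixes e_{n+1},
    so that g . e_{i,n+1} = \sum_j g_ji e_{j,n+1}; since g is orthogonal, the
    contragredient action is g . omega_i = \sum_j g_ji omega_j. *)

Definition form : Type := Vk -> ext C n.
HB.instance Definition _ := GRing.Lmodule.on form.

Definition coef (I : {set 'I_n}) (psi : form) : Vk -> C^o := fun v => psi v I.

Definition form_act (g : 'M[R]_n) (psi : form) : form := fun v =>
  ext_map (map_mx (real_complex R) g) (left_translate (embed g) psi v).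

Definition form_mul (f : Vk -> C^o) (psi : form) : form := fun v =>
  (f v : C) *: psi v.

Definition form_map (D : (Vk -> C^o) -> (Vk -> C^o)) (psi : form) : form :=
  fun v => [ffun I => D (coef I psi) v].

Definition dform (psi : form) : form := \sum_(j < k) \sum_(a < n)
  (fun v => wedge (omega a)
     (form_mul (xcoord a j) (form_map (partial_t j) psi) v
      + form_mul (tcoord j) (form_map (partial_x a j) psi) v)).

Definition cochain (l : nat) : {pred form} := fun psi =>
  `[< [/\ forall I, coef I psi \in poly_gaussian,
          forall I : {set 'I_n}, #|I| != l -> coef I psi = 0
        & forall g : 'M[R]_n, special_orthogonal_mx g ->
            form_act g psi = psi] >].

Definition cocycle (l : nat) : {pred form} := fun psi =>
  `[< psi \in cochain l /\ dform psi = 0 >].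

Definition coboundary (l : nat) : {pred form} := fun psi =>
  if l is l'.+1 then `[< exists2 chi, chi \in cochain l' & psi = dform chi >]
  else psi == 0.

Definition eta (j : 'I_k) (v : Vk) : ext C n :=
  \sum_(a < n) (xcoord a j v : C) *: omega a.

Definition phi_KM : form :=
  form_mul gaussian (fun v => \big[@wedge C n/ext1]_(j < k) eta j v).

Definition pullback (f : Vplusk -> C^o) : Vk -> C^o := fun v => f (usubmx v).

Definition volume_form (f : Vk -> C^o) : form :=
  form_mul (f * gaussian) (fun=> vol).

End KudlaMillson.

Section Polyfun.
Variables (R : realType) (m k : nat).
Local Notation F := ('M[R]_(m, k) -> R[i]^o).

Lemma polyfun_cst (c : R[i]) : (fun=> c) \in polyfun R m k.
Proof. by apply/asboolP; exists (mpolyC _ c) => v; rewrite mevalC. Qed.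

Lemma polyfun_coord i j : (fun v : 'M_(m, k) => (v i j)%:C) \in polyfun R m k.
Proof.
apply/asboolP; exists (mpolyX _ (mnm1 (mxvec_index i j))) => v.
by rewrite mevalXU mxvecE.
Qed.

Lemma polyfunD (f g : F) :
  f \in polyfun R m k -> g \in polyfun R m k -> f + g \in polyfun R m k.
Proof.
move=> /asboolP[p fp] /asboolP[q gq]; apply/asboolP; exists (p + q) => v.
by rewrite mevalD -fp -gq.
Qed.

Lemma polyfunM (f g : F) :
  f \in polyfun R m k -> g \in polyfun R m k -> f * g \in polyfun R m k.
Proof.
move=> /asboolP[p fp] /asboolP[q gq]; apply/asboolP; exists (p * q) => v.
by rewrite mevalM -fp -gq.
Qed.

Lemma polyfun_submod : GRing.submod_closed (polyfun R m k).
Proof.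
split=> [|a f g fP gP]; first exact: polyfun_cst.
rewrite (_ : a *: f = (fun=> a) * f) ?polyfunD ?polyfunM ?polyfun_cst//.
Qed.

Lemma polyfun_ind (P : F -> Prop) :
  (forall c, P (fun=> c)) -> (forall i j, P (fun v => (v i j)%:C)) ->
  (forall f g, P f -> P g -> P (f + g)) ->
  (forall f g, P f -> P g -> P (f * g)) ->
  forall f, f \in polyfun R m k -> P f.
Proof.
move=> Pc Px PD PM f /asboolP[p fp].
have -> : f = \sum_(mm <- msupp p) (fun=> mcoeff mm p) *
   \prod_i (fun v : 'M_(m, k) => ((mxvec v 0 i)%:C : R[i]^o))
       ^+ fun_of_multinom mm i.
  apply/funext => v; rewrite fp mevalE fct_sumE; apply: eq_bigr => mm _.
  rewrite [RHS]/GRing.mul/= ; congr (_ * _).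
  elim/big_rec2: _ => // i x y _ ->; rewrite [RHS]/GRing.mul/=; congr (_ * _).
  by elim: (fun_of_multinom mm i) => // e; rewrite !exprS => ->.
elim/big_rec: _ => [|mm f' _ Pf']; first exact: Pc.
apply: (PD) => //; apply: (PM) => //; elim/big_rec: _ => [|i f'' _ Pf''].
  exact: Pc.
apply: (PM) => //; have Pi : P (fun v : 'M_(m, k) => (mxvec v 0 i)%:C).
  case/mxvec_indexP: i => i j.
  rewrite (_ : (fun v => _) = fun v : 'M_(m, k) => (v i j)%:C)//.
  by apply/funext => v; rewrite mxvecE.
elim: (fun_of_multinom mm i) => [|e]; first exact: Pc.
by rewrite exprS => ?; apply: (PM).
Qed.

End Polyfun.

HB.instance Definition _ (R : realType) (m k : nat) :=
  GRing.isSubmodClosed.Build R[i] ('M[R]_(m, k) -> R[i]^o) (polyfun R m k)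
    (@polyfun_submod R m k).

Lemma left_translate_polyfun (R : realType) (m k : nat) (g : 'M[R]_m) f :
  f \in polyfun R m k -> left_translate g f \in polyfun R m k.
Proof.
move: f; apply: polyfun_ind => [c|i j|f h fP hP|f h fP hP].
- exact: polyfun_cst.
- rewrite (_ : left_translate _ _ = \sum_l (invmx g i l)%:C *:
     (fun v : 'M_(m, k) => ((v l j)%:C : R[i]^o))).
    by apply: rpred_sum => l _; apply/rpredZ/polyfun_coord.
  apply/funext => v; rewrite /left_translate mxE fct_sumE rmorph_sum.
  by apply: eq_bigr => l _ /=; rewrite rmorphM.
- exact: polyfunD.
- exact: polyfunM.
Qed.

Section Differentiability.
Variables (R : realType) (m k : nat).
Local Notation F := ('M[R]_(m, k) -> R[i]^o).

Definition cdifferentiable (f : F) := forall v,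
  differentiable (fun w => complex.Re (f w)) v /\
  differentiable (fun w => complex.Im (f w)) v.

Lemma cdifferentiableD (f g : F) :
  cdifferentiable f -> cdifferentiable g -> cdifferentiable (f + g).
Proof.
move=> fd gd v; have [[fr fi] [gr gi]] := (fd v, gd v); split.
- rewrite (_ : (fun _ => _) =
    (fun w => complex.Re (f w)) \+ (fun w => complex.Re (g w))).
    exact: differentiableD.
  by apply/funext => w /=; rewrite raddfD.
- rewrite (_ : (fun _ => _) =
    (fun w => complex.Im (f w)) \+ (fun w => complex.Im (g w))).
    exact: differentiableD.
  by apply/funext => w /=; rewrite raddfD.
Qed.

Let Re_add (x y : R[i]) :
  complex.Re (x + y) = complex.Re x + complex.Re y.
Proof. by case: x y => [a b] [c d]. Qed.

Let Im_add (x y : R[i]) :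
  complex.Im (x + y) = complex.Im x + complex.Im y.
Proof. by case: x y => [a b] [c d]. Qed.

Let Re_mul (x y : R[i]) : complex.Re (x * y) =
  complex.Re x * complex.Re y - complex.Im x * complex.Im y.
Proof. by case: x y => [a b] [c d]. Qed.

Let Im_mul (x y : R[i]) : complex.Im (x * y) =
  complex.Re x * complex.Im y + complex.Im x * complex.Re y.
Proof. by case: x y => [a b] [c d]. Qed.

Lemma cdifferentiableM (f g : F) :
  cdifferentiable f -> cdifferentiable g -> cdifferentiable (f * g).
Proof.
move=> fd gd v; have [[fr fi] [gr gi]] := (fd v, gd v); split.
- rewrite (_ : (fun _ => _) =
    (fun w => complex.Re (f w)) * (fun w => complex.Re (g w))
    - (fun w => complex.Im (f w)) * (fun w => complex.Im (g w))).
    by apply: differentiableB; apply: differentiableM.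
  by apply/funext => w; exact: Re_mul.
- rewrite (_ : (fun _ => _) =
    (fun w => complex.Re (f w)) * (fun w => complex.Im (g w))
    + (fun w => complex.Im (f w)) * (fun w => complex.Re (g w))).
    by apply: differentiableD; apply: differentiableM.
  by apply/funext => w; exact: Im_mul.
Qed.

Lemma cdifferentiable_real (f : 'M[R]_(m, k) -> R) :
  (forall v, differentiable f v) -> cdifferentiable (fun v => (f v)%:C).
Proof. by move=> fd v; split=> //=; apply: differentiable_cst. Qed.

Lemma polyfun_differentiable f : f \in polyfun R m k -> cdifferentiable f.
Proof.
move: f; apply: polyfun_ind => [c v|i j|f g|f g].
- by split; apply: differentiable_cst.
- by apply: cdifferentiable_real => v; apply: differentiable_coord.
- exact: cdifferentiableD.
- exact: cdifferentiableM.
Qed.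

Lemma partial_linear (i : 'I_m) (j : 'I_k) (a : R[i]) (f g : F) :
  cdifferentiable f -> cdifferentiable g ->
  partial i j (a *: f + g) = a *: partial i j f + partial i j g.
Proof.
move=> fd gd; apply/funext => v; have [[fr fi] [gr gi]] := (fd v, gd v).
case: a => a b; rewrite /partial.
rewrite (_ : (fun w => complex.Re (((a +i* b) *: f + g) w)) =
  (a \*: (fun w => complex.Re (f w))) - (b \*: (fun w => complex.Im (f w)))
   + (fun w => complex.Re (g w))); last first.
  apply/funext => w.
  exact: etrans (Re_add _ _) (congr1 (fun z => z + _) (Re_mul (a +i* b) _)).
rewrite (_ : (fun w => complex.Im (((a +i* b) *: f + g) w)) =
  (a \*: (fun w => complex.Im (f w))) + (b \*: (fun w => complex.Re (f w)))
   + (fun w => complex.Im (g w))); last first.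
  apply/funext => w.
  exact: etrans (Im_add _ _) (congr1 (fun z => z + _) (Im_mul (a +i* b) _)).
have dr := diff_derivable fr. have di := diff_derivable fi.
have er := diff_derivable gr. have ei := diff_derivable gi.
have dZ c (h : 'M[R]_(m, k) -> R) := @derivableZ R _ _ h c v (delta_mx i j).
rewrite (deriveD (derivableB (dZ _ _ (dr _)) (dZ _ _ (di _))) (er _)).
rewrite (deriveB (dZ _ _ (dr _)) (dZ _ _ (di _))).
rewrite (deriveD (derivableD (dZ _ _ (di _)) (dZ _ _ (dr _))) (ei _)).
rewrite (deriveD (dZ _ _ (di _)) (dZ _ _ (dr _))).
rewrite !(deriveZ _ (dr _)) !(deriveZ _ (di _)).
by [].
Qed.

End Differentiability.

Section Closure.
Variables (R : realType) (n k : nat).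
Local Notation C := R[i].
Local Notation F := ('M[R]_(n + 1, k) -> C^o).
Local Notation poly_gaussian := (@poly_gaussian R n k).

Lemma gaussian_differentiable : cdifferentiable (@gaussian R n k).
Proof.
apply: cdifferentiable_real => v.
have dX i j : differentiable (fun w : 'M[R]_(n + 1, k) => w i j ^+ 2) v.
  rewrite -[X in differentiable X _]exprfctE.
  exact/differentiableX/differentiable_coord.
pose E j (w : 'M[R]_(n + 1, k)) : R :=
  - (2^-1 * (\sum_(a < n) w (lshift 1 a) j ^+ 2 + w (rshift n 0) j ^+ 2)).
have dE j : differentiable (E j) v.
  have dS : differentiable
      (fun w : 'M[R]_(n + 1, k) => \sum_(a < n) w (lshift 1 a) j ^+ 2) v.
    rewrite [X in differentiable X _](_ : _ =
      \sum_(a < n) (fun w : 'M[R]_(n + 1, k) => w (lshift 1 a) j ^+ 2)).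
      by apply: differentiable_sum => a; exact: dX.
    by apply/funext => w; rewrite fct_sumE.
  apply/differentiableN/differentiableZ.
  exact: differentiableD dS (dX (rshift n 0) j).
have dexp j : differentiable (fun w => expR (E j w)) v.
  apply: (differentiable_comp (dE j)).
  exact/derivable1_diffP/derivable_expR.
have -> : (fun w : 'M[R]_(n + 1, k) => \prod_(j < k)
    expR (- (2^-1 * (\sum_(a < n) usubmx w a j ^+ 2 + dsubmx w 0 j ^+ 2)))) =
    \prod_(j < k) (fun w => expR (E j w)).
  apply/funext => w; rewrite fct_prodE; apply: eq_bigr => j _.
  rewrite mxE (eq_bigr (fun a => w (lshift 1 a) j ^+ 2)) => [|a _].
    by [].
  by rewrite mxE.
elim/big_rec: _ => [|j h _ hd]; first exact: (differentiable_cst (1 : R) v).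
exact: differentiableM (dexp j) hd.
Qed.

Lemma poly_gaussian_differentiable f : f \in poly_gaussian -> cdifferentiable f.
Proof.
move=> /asboolP[p pP ->].
exact: cdifferentiableM (polyfun_differentiable pP) gaussian_differentiable.
Qed.

Let fct_scalerAl a (f h : F) : a *: (f * h) = (a *: f) * h.
Proof. by apply/funext => v; exact: (mulrA (a : C)). Qed.

Lemma poly_gaussian_submod : GRing.submod_closed poly_gaussian.
Proof.
split=> [|a f g /asboolP[p pP ->] /asboolP[q qP ->]]; apply/asboolP.
  by exists 0; rewrite ?rpred0 ?mul0r.
by exists (a *: p + q); rewrite ?rpredD ?rpredZ// mulrDl -fct_scalerAl.
Qed.

HB.instance Definition _ :=
  GRing.isSubmodClosed.Build C F poly_gaussian poly_gaussian_submod.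

Lemma left_translate_linear m (V : lmodType C) (g : 'M[R]_m) a
    (f h : 'M[R]_(m, k) -> V) :
  left_translate g (a *: f + h) = a *: left_translate g f + left_translate g h.
Proof. by []. Qed.

Lemma Rpoly_submod : GRing.submod_closed (@Rpoly R n k).
Proof.
split=> [|a f h /asboolP[fP fI] /asboolP[hP hI]]; apply/asboolP; split.
- exact: rpred0.
- by [].
- by rewrite rpredD ?rpredZ.
- by move=> g gO; rewrite left_translate_linear fI ?hI.
Qed.

HB.instance Definition _ := GRing.isSubmodClosed.Build C
  ('M[R]_(n, k) -> C^o) (@Rpoly R n k) Rpoly_submod.

HB.instance Definition _ := GRing.isSubmodClosed.Build C F
  (@Ppoly R n k) (@polyfun_submod R (n + 1) k).

Lemma Spoly_submod : GRing.submod_closed (@Spoly R n k).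
Proof.
split=> [|a f h /asboolP[fP fI] /asboolP[hP hI]]; apply/asboolP; split.
- exact: rpred0.
- by [].
- by rewrite rpredD ?rpredZ.
- move=> g gO; rewrite /translate left_translate_linear.
  by rewrite [X in _ *: X]fI ?[X in _ + X]hI.
Qed.

HB.instance Definition _ := GRing.isSubmodClosed.Build C F
  (@Spoly R n k) Spoly_submod.

Lemma cideal_submod : GRing.submod_closed (@cideal R n k).
Proof.
split=> [|a f h /asboolP[s sP ->] /asboolP[t tP ->]]; apply/asboolP.
  exists (fun=> 0) => [j|]; first exact: rpred0.
  by rewrite big1// => j _; rewrite mul0r.
exists (fun j => a *: s j + t j) => [j|]; first by rewrite rpredD ?rpredZ.
rewrite scaler_sumr -big_split; apply: eq_bigr => j _.
by rewrite mulrDl -fct_scalerAl.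
Qed.

HB.instance Definition _ := GRing.isSubmodClosed.Build C F
  (@cideal R n k) cideal_submod.

Lemma qideal_submod : GRing.submod_closed (@qideal R n k).
Proof.
split=> [|a f h /asboolP[s sP ->] /asboolP[t tP ->]]; apply/asboolP.
  exists (fun=> 0) => [j|]; first exact: rpred0.
  by rewrite big1// => j _; rewrite mul0r.
exists (fun j => a *: s j + t j) => [j|]; first by rewrite rpredD ?rpredZ.
rewrite scaler_sumr -big_split; apply: eq_bigr => j _.
by rewrite mulrDl -fct_scalerAl.
Qed.

HB.instance Definition _ := GRing.isSubmodClosed.Build C F
  (@qideal R n k) qideal_submod.

Local Notation form := (form R n k).

Lemma coefP I a (psi chi : form) :
  coef I (a *: psi + chi) = a *: coef I psi + coef I chi.
Proof. by apply/funext => v; rewrite /coef !fctE !ffunE. Qed.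

Lemma cochain_submod l : GRing.submod_closed (@cochain R n k l).
Proof.
split=> [|a psi chi /asboolP[psiS psil psiI] /asboolP[chiS chil chiI]].
  apply/asboolP; split=> [I|I _|g _].
  - rewrite (_ : coef I 0 = 0) ?rpred0//.
    by apply/funext => v; rewrite /coef ffunE.
  - by apply/funext => v; rewrite /coef ffunE.
  - by apply/funext => v; exact: ext_map0.
apply/asboolP; split=> [I|I Il|g gSO].
- by rewrite coefP rpredD ?rpredZ.
- by rewrite coefP psil// chil// scaler0 addr0.
- apply/funext => v; rewrite /form_act left_translate_linear.
  rewrite [LHS]ext_map_linear -[in RHS](psiI _ gSO) -[in RHS](chiI _ gSO).
  by [].
Qed.

HB.instance Definition _ l := GRing.isSubmodClosed.Build C form
  (@cochain R n k l) (cochain_submod l).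

Lemma form_map_linear (D : F -> F) l a (psi chi : form) :
  (forall f h, f \in poly_gaussian -> h \in poly_gaussian ->
     D (a *: f + h) = a *: D f + D h) ->
  psi \in cochain l -> chi \in cochain l ->
  form_map D (a *: psi + chi) = a *: form_map D psi + form_map D chi.
Proof.
move=> DP /asboolP[psiS _ _] /asboolP[chiS _ _].
apply/funext => v; apply/ffunP => I; rewrite !fctE !ffunE coefP DP//.
Qed.

Lemma dform_linear l a (psi chi : form) :
  psi \in cochain l -> chi \in cochain l ->
  dform (a *: psi + chi) = a *: dform psi + dform chi.
Proof.
move=> psiC chiC; pose D := form_map_linear _ psiC chiC.
have Dx b j := D (partial_x b j) a (fun f h fS hS => partial_linear _ _ _
  (poly_gaussian_differentiable fS) (poly_gaussian_differentiable hS)).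
have Dt j := D (partial_t j) a (fun f h fS hS => partial_linear _ _ _
  (poly_gaussian_differentiable fS) (poly_gaussian_differentiable hS)).
rewrite /dform scaler_sumr -big_split; apply: eq_bigr => j _.
rewrite scaler_sumr -big_split; apply: eq_bigr => b _.
apply/funext => v; apply: etrans (wedge_linear2 _ _ _ _ _ _ _ _).
exact: (congr2 (fun A B : form =>
  wedge (omega b) (form_mul (xcoord b j) A v + form_mul (tcoord j) B v))
  (Dt j) (Dx b j)).
Qed.

Lemma dform0 : dform (0 : form) = 0.
Proof.
have := dform_linear (l := 0) (-1) (rpred0 _) (rpred0 _).
by rewrite scaler0 addr0 scaleN1r addNr.
Qed.

Lemma cocycle_submod l : GRing.submod_closed (@cocycle R n k l).
Proof.
split=> [|a psi chi /asboolP[psiC dpsi] /asboolP[chiC dchi]]; apply/asboolP.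
  by split; rewrite ?rpred0 ?dform0.
split; first by rewrite rpredD ?rpredZ.
by rewrite (dform_linear a psiC chiC) dpsi dchi scaler0 addr0.
Qed.

HB.instance Definition _ l := GRing.isSubmodClosed.Build C form
  (@cocycle R n k l) (cocycle_submod l).

Lemma coboundary_submod l : GRing.submod_closed (@coboundary R n k l).
Proof.
case: l => [|l]; split.
- exact: eqxx.
- by move=> a psi chi /eqP-> /eqP->; rewrite scaler0 addr0; exact: eqxx.
- by apply/asboolP; exists 0; rewrite ?rpred0 ?dform0.
- move=> a _ _ /asboolP[psi psiC ->] /asboolP[chi chiC ->]; apply/asboolP.
  exists (a *: psi + chi); first by rewrite rpredD ?rpredZ.
  by rewrite (dform_linear a psiC chiC).
Qed.

HB.instance Definition _ l := GRing.isSubmodClosed.Build C form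
  (@coboundary R n k l) (coboundary_submod l).

End Closure.

Section QuotientAction.
Variables (R : realType) (n k : nat).
Local Notation C := R[i].
Local Notation F := ('M[R]_(n + 1, k) -> C^o).
Local Notation Ppoly := (@Ppoly R n k).
Local Notation qideal := (@qideal R n k).

Definition poly_quotient := subquotient Ppoly qideal.
HB.instance Definition _ := GRing.Lmodule.on poly_quotient.

Definition poly_act (g : 'M[R]_n) (p : subspace Ppoly) : subspace Ppoly :=
  Subspace (left_translate_polyfun (embed g) (valP p)).

Definition quotient_act (g : 'M[R]_n) (x : poly_quotient) : poly_quotient :=
  qproj (relative Ppoly qideal) (poly_act g (qrepr x)).

Definition SO_invariant : {pred poly_quotient} := fun x =>
  `[< forall g : 'M[R]_n, special_orthogonal_mx g -> quotient_act g x = x >].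

Lemma poly_act_linear g : linear (poly_act g).
Proof.
move=> a p q; apply: val_inj.
apply: etrans (esym (subspace_val_linear a (poly_act g p) (poly_act g q))).
exact: (congr1 (left_translate (embed g)) (subspace_val_linear a p q)).
Qed.

Lemma usubmx_embed (h : 'M[R]_n) (v : 'M[R]_(n + 1, k)) :
  usubmx (embed h *m v) = h *m usubmx v.
Proof.
by rewrite -{1}[v]vsubmxK mul_block_col !mul0mx addr0 col_mxKu.
Qed.

Lemma dsubmx_embed (h : 'M[R]_n) (v : 'M[R]_(n + 1, k)) :
  dsubmx (embed h *m v) = dsubmx v.
Proof.
by rewrite -{1}[v]vsubmxK mul_block_col !mul0mx add0r mul1mx col_mxKd.
Qed.

Lemma orthogonal_unitmx (g : 'M[R]_n) : orthogonal_mx g -> g \in unitmx.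
Proof. by move=> /mulmx1_unit[]. Qed.

Lemma invmx_embed (g : 'M[R]_n) :
  orthogonal_mx g -> invmx (embed g) = embed (invmx g).
Proof.
move=> /orthogonal_unitmx gU; have E : embed g *m embed (invmx g) = 1%:M.
  rewrite mulmx_block !mulmx0 !mul0mx !addr0 add0r mulmxV//.
  by rewrite mulmx1 -scalar_mx_block.
have [eU _] := mulmx1_unit E.
by rewrite -[invmx _]mulmx1 -E mulKmx.
Qed.

Lemma translate_qpoly (g : 'M[R]_n) (a : 'I_n) : orthogonal_mx g ->
  translate g (@qpoly R n k a) =
  \sum_(b < n) (fun=> (invmx g a b)%:C) * @qpoly R n k b.
Proof.
move=> gO; apply/funext => v; rewrite fct_sumE.
rewrite /translate /left_translate (invmx_embed gO) /qpoly fct_sumE.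
transitivity (\sum_(i < k) \sum_(b < n)
    (invmx g a b)%:C * (xcoord b i v * tcoord i v)).
  apply: eq_bigr => i _; rewrite -[LHS]/(xcoord _ _ _ * tcoord _ _).
  rewrite /tcoord dsubmx_embed /xcoord usubmx_embed mxE rmorph_sum mulr_suml.
  by apply: eq_bigr => b _; rewrite rmorphM mulrA.
rewrite exchange_big; apply: eq_bigr => b _ /=.
rewrite -mulr_sumr -[RHS]/((invmx g a b)%:C * _); congr (_ * _).
by rewrite fct_sumE.
Qed.

Lemma translate_qideal (g : 'M[R]_n) f : orthogonal_mx g ->
  f \in qideal -> translate g f \in qideal.
Proof.
move=> gO /asboolP[p pP ->]; apply/asboolP.
exists (fun b => \sum_(a < n) translate g (p a) * (fun=> (invmx g a b)%:C)).
  move=> b; apply: rpred_sum => a _.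
  exact: polyfunM (left_translate_polyfun _ (pP a)) (polyfun_cst _ _ _).
transitivity (\sum_(a < n) translate g (p a) * translate g (@qpoly R n k a)).
  by apply/funext => v; rewrite /translate /left_translate !fct_sumE.
under eq_bigr do rewrite translate_qpoly// mulr_sumr.
rewrite exchange_big; apply: eq_bigr => b _ /=.
by rewrite mulr_suml; apply: eq_bigr => a _; rewrite mulrA.
Qed.

Lemma quotient_actE (g : 'M[R]_n) (p : subspace Ppoly) : orthogonal_mx g ->
  quotient_act g (qproj (relative Ppoly qideal) p) =
  qproj (relative Ppoly qideal) (poly_act g p).
Proof.
move=> gO; apply/qprojE; rewrite relativeE.
apply: (translate_qideal (f := val (qrepr _) - val p) gO).
by rewrite -raddfB -relativeE; apply/qprojE/qreprK.
Qed.

Lemma quotient_act_linear (g : 'M[R]_n) :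
  orthogonal_mx g -> linear (quotient_act g).
Proof.
move=> gO a x y; rewrite -[x]qreprK -[y]qreprK -linearP.
by rewrite !quotient_actE// poly_act_linear linearP.
Qed.

Lemma SO_invariant_submod : GRing.submod_closed SO_invariant.
Proof.
split=> [|a x y /asboolP xI /asboolP yI]; apply/asboolP => g gSO;
  have [gO _] := gSO.
  have := quotient_act_linear gO (-1) 0 0.
  by rewrite !scaleN1r !addNr.
by rewrite quotient_act_linear// xI// yI.
Qed.

HB.instance Definition _ := GRing.isSubmodClosed.Build C poly_quotient
  SO_invariant SO_invariant_submod.

End QuotientAction.

Definition cohomology (R : realType) (n k l : nat) :=
  subquotient (@cocycle R n k l) (@coboundary R n k l).
HB.instance Definition _ (R : realType) (n k l : nat) :=
  GRing.Lmodule.on (cohomology R n k l).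

(* Main.v *)
(* Write a cochain as p phi_0 with p a polynomial form; the differential becomes
   d' = sum_j (eta_j d/dt_j + t_j eps_j) - 2 T, where eta_j and q are the forms
   sum_a x_aj omega_a and sum_a q_a omega_a, eps_j = sum_a omega_a d/dx_aj, and
   T = sum_j t_j eta_j is exterior multiplication by q.  Only T raises the
   polynomial degree, so the cohomology is governed by the Koszul complex of q.

   Everything follows from positivity of the Fischer inner product, for which
   multiplication by a variable is adjoint to the partial derivative and exterior
   multiplication to contraction.
   - An invariant form u of degree l < n with T u = T^* u = 0 has d u / d t_j = 0
     and eta_j u = 0, because <(T T^* + T^* T) u, u> is a sum of squares.
     Invariance under so(n) then gives (l - k) omega_b u = sum_i x_bi eps_i u,
     hence u = 0 unless l = k < n.  Descending on the polynomial degree, the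
     cohomology in degree l < n is the space of these u.
   - In degree n the classes are represented exactly once by the kernel of T^*.
     For forms h vol this kernel is a complement of (q) when h ranges over P_k,
     and of (c) when k <= n and h ranges over S_k.
   - For k <= n the invariant forms killed by the Laplacians d_i . d_j, the
     adjoints of eta_j and of its contraction analogue iota_j, and the d/dt_j have
     constant coefficients; therefore all invariant forms are combinations, with
     coefficients in S_k, of products of eta_j and of products of iota_j applied
     to vol. *)

From HB Require Import structures.
Require Import Defs.
From mathcomp Require Import all_boot all_order all_algebra.
From mathcomp Require Import generic_quotient ring_quotient.
From mathcomp Require Import boolp functions.
From mathcomp Require Import reals topology normedtype sequences derive realfun exp.
From mathcomp Require Import complex.
From mathcomp Require Import -(notations) mpoly.
From mathcomp Require Import ring lra.
Set Implicit Arguments.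
Unset Strict Implicit.
Unset Printing Implicit Defensive.
Import Order.TTheory GRing.Theory Num.Theory.
Local Open Scope ring_scope.

(** * Exterior algebra *)

(** The factor 2 in d' comes from the Gaussian: x (d/dt - t) + t (d/dx - x) contains -2 x t. The
    operator d' is not homogeneous, but T raises the polynomial degree by 2 while the rest [ddt]
    preserves it. Hence T kills the highest component of a closed form, and T chi = 1/2 ddt chi -
    1/2 d' chi trades a multiple of T for an exact form and a term of lower degree, which is what
    makes the descent work. The space of polynomials is not complete. Projections exist because an
    operator composed with its adjoint respects a bound on the degree, so each of them takes place
    in finite dimension. Infinitesimal invariance already enters in d' d' = 0. It is derived from
    rational paths of real rotations, and the algebra is done for an abstract set [O] of orthogonal
    matrices whose invariants have this property. An element of determinant -1 separates words in
    eta_j, which it fixes, from words in iota_j applied to vol, whose sign it changes. Each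
    isomorphism is read off a linear relation between elements that share a harmonic
    representative. *)

(* Locked: unification would otherwise compare finite functions pointwise. *)
HB.lock Definition ext_mul (P : comNzRingType) n (j : 'I_n) (psi : ext P n) :
  ext P n := wedge (omega j) psi.

HB.lock Definition contract (P : comNzRingType) n (j : 'I_n) (psi : ext P n) :
  ext P n := [ffun J : {set 'I_n} =>
    if j \in J then 0
    else (-1) ^+ #|[set i in J | (i < j)%N]| * psi (j |: J)].

Section Exterior.
Variables (P : comNzRingType) (n : nat).
Local Notation K := (ext P n).
Implicit Types (i j : 'I_n) (J : {set 'I_n}) (psi : K).

(** The exponent of the sign that arises when omega_j is moved to its place in the increasing
    product omega_J. *)
Definition below J j : nat := #|[set i in J | (i < j)%N]|.

Lemma ext_mul_wedge j psi : ext_mul j psi = wedge (omega j) psi.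
Proof. by rewrite unlock. Qed.

(** In the sum defining [wedge] only the subset {j} contributes, and its inversions with J minus j
    are the elements of J below j. *)
Lemma ext_mulE j psi J : ext_mul j psi J =
  if j \in J then (-1) ^+ below J j * psi (J :\ j) else 0.
Proof.
rewrite ext_mul_wedge /wedge ffunE; case: ifP => jJ; last first.
  rewrite big1// => I IJ; rewrite /omega /ext_basis ffunE.
  case: eqP => [Ij|_]; last by rewrite mul0r mulr0.
  by move: IJ; rewrite Ij sub1set jJ.
rewrite (bigD1 [set j]) ?sub1set//= big1 ?addr0 => [|I /andP[IJ /negPf Ij]].
  rewrite /omega /ext_basis ffunE eqxx mul1r; congr (_ ^+ _ * _).
  rewrite /inversions /below.
  rewrite -(card_imset _ (_ : injective (fun i => (j, i)))); last first.
    by move=> a b [].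
  apply: eq_card => -[a b]. rewrite !inE.
  apply/idP/imsetP => [/and3P[/eqP aj /andP[bj bJ] ba]|[c]].
    exists b; last by move: aj => /= ->.
    by rewrite inE; apply/andP; split=> //; move: aj ba => /= ->.
  rewrite inE => /andP[cJ cj] [-> ->].
  by rewrite eqxx cJ cj andbT -val_eqE /= ltn_eqF.
by rewrite /omega /ext_basis ffunE Ij mul0r mulr0.
Qed.

Lemma contractE j psi J : contract j psi J =
  if j \in J then 0 else (-1) ^+ below J j * psi (j |: J).
Proof. by rewrite unlock ffunE. Qed.

Fact ext_mul_linear j : linear (@ext_mul P n j).
Proof. by move=> c x y; rewrite !ext_mul_wedge wedge_linearr. Qed.
HB.instance Definition _ j :=
  GRing.isLinear.Build P K K *:%R (@ext_mul P n j) (ext_mul_linear j).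

Fact contract_linear j : linear (@contract P n j).
Proof.
have E c (x y : K) J : (c *: x + y) J = c * x J + y J by rewrite !ffunE.
move=> a x y; apply/ffunP => J; rewrite E !contractE E; case: ifP => _.
  by rewrite mulr0 addr0.
by rewrite mulrDr mulrCA.
Qed.
HB.instance Definition _ j :=
  GRing.isLinear.Build P K K *:%R (@contract P n j) (contract_linear j).

Lemma below_setD1 J i j : i \in J -> (i < j)%N ->
  below J j = (below (J :\ i) j).+1.
Proof.
move=> iJ ij; rewrite /below (cardsD1 i) !inE iJ ij add1n; congr _.+1.
by apply: eq_card => l; rewrite !inE; case: (l == i).
Qed.

Lemma below_setD1_ge J i j : (j <= i)%N -> below (J :\ i) j = below J j.
Proof.
move=> ji; apply: eq_card => l; rewrite !inE.
by have [->|] := eqVneq l i; rewrite ?(ltnNge i) ?ji ?andbF.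
Qed.

Lemma below_setU1 J i j : i \notin J -> (i < j)%N ->
  below (i |: J) j = (below J j).+1.
Proof. by move=> iJ ij; rewrite (@below_setD1 _ i) ?setU11// setU1K. Qed.

Lemma below_setU1_ge J i j : (j <= i)%N -> below (i |: J) j = below J j.
Proof.
move=> ji; apply: eq_card => l; rewrite !inE.
by have [->|] := eqVneq l i; rewrite ?(ltnNge i) ?ji ?andbF.
Qed.

Lemma ext_mul_sq j psi : ext_mul j (ext_mul j psi) = 0.
Proof.
apply/ffunP => J; rewrite !ext_mulE setD11 mulr0 ffunE.
by case: ifP.
Qed.

Lemma ext_mul_anti i j psi :
  ext_mul i (ext_mul j psi) = - ext_mul j (ext_mul i psi).
Proof.
have [->|nij] := eqVneq i j; first by rewrite ext_mul_sq oppr0.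
wlog ij : i j nij / (i < j)%N => [H|].
  case: (ltnP i j) => [|ji]; first exact: H.
  apply/eqP; rewrite -eqr_oppLR; apply/eqP/esym/H; rewrite 1?eq_sym//.
  by rewrite ltn_neqAle ji andbT eq_sym.
(* For i < j, deleting i lowers the count below j by one, while deleting j does not change the count
   below i; this single unit is the sign. *)
apply/ffunP => J; rewrite [in RHS]ffunE !ext_mulE !inE (negPf nij).
rewrite (eq_sym j) (negPf nij) /=.
case iJ: (i \in J); case jJ: (j \in J) => /=; rewrite ?mulr0 ?oppr0//.
rewrite (below_setD1_ge J (ltnW ij)) [below J j](below_setD1 iJ ij) exprS.
have -> : J :\ i :\ j = J :\ j :\ i by apply/setP => l; rewrite !inE andbCA.
by rewrite !mulN1r !mulNr opprK mulrCA.
Qed.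

Lemma contract_sq j psi : contract j (contract j psi) = 0.
Proof.
apply/ffunP => J; rewrite !contractE setU11 mulr0 ffunE.
by case: ifP.
Qed.

Lemma contract_anti i j psi :
  contract i (contract j psi) = - contract j (contract i psi).
Proof.
have [->|nij] := eqVneq i j; first by rewrite contract_sq oppr0.
wlog ij : i j nij / (i < j)%N => [H|].
  case: (ltnP i j) => [|ji]; first exact: H.
  apply/eqP; rewrite -eqr_oppLR; apply/eqP/esym/H; rewrite 1?eq_sym//.
  by rewrite ltn_neqAle ji andbT eq_sym.
apply/ffunP => J; rewrite [in RHS]ffunE !contractE !inE (negPf nij).
rewrite (eq_sym j) (negPf nij) /=.
case iJ: (i \in J); case jJ: (j \in J) => /=; rewrite ?mulr0 ?oppr0//.
rewrite (below_setU1_ge J (ltnW ij)) (below_setU1 (negbT iJ) ij) exprS.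
have -> : j |: (i |: J) = i |: (j |: J) by rewrite setUCA.
by rewrite mulN1r mulNr mulrN mulrCA.
Qed.

(** The Clifford relation; the later anticommutators, with rotated frames and with the Gram matrix,
    follow from it by linearity. *)
Lemma contract_mul i j psi : contract i (ext_mul j psi) =
  (i == j)%:R *: psi - ext_mul j (contract i psi).
Proof.
have E a (x y : K) J : (a *: x - y) J = a * x J - y J by rewrite !ffunE.
apply/ffunP => J; rewrite E !(ext_mulE, contractE) !inE.
have [->|nij] := eqVneq i j.
  rewrite /= mul1r; case jJ: (j \in J); rewrite /= ?mulr0 ?subr0.
    by rewrite (below_setD1_ge J (leqnn j)) setD1K// mulrA -exprD -signr_odd oddD addbb expr0 mul1r subrr.
  rewrite (below_setU1_ge J (leqnn j)) mulrA -exprD -signr_odd oddD addbb expr0 mul1r.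
  by rewrite setU1K ?jJ.
rewrite mul0r add0r /=.
case iJ: (i \in J); case jJ: (j \in J) => /=; rewrite ?mulr0 ?oppr0//.
have -> : (i |: J) :\ j = i |: (J :\ j).
  by apply/setP => l; rewrite !inE; have [->|] := eqVneq l i; rewrite ?nij.
rewrite -mulrN mulrA mulrN mulrA -mulNr -!exprD; congr (_ * _).
have /orP[ij|ij] : (i < j)%N || (j < i)%N by rewrite -neq_ltn.
  rewrite (below_setU1 (negbT iJ) ij) (below_setD1_ge J (ltnW ij)).
  by rewrite addnS exprS mulN1r addnC.
rewrite (below_setU1_ge J (ltnW ij)) (below_setD1 jJ ij).
by rewrite addSn exprS mulN1r addnC.
Qed.

End Exterior.

(** * Products of anticommuting operators *)

Section Word.
Variables (P : comNzRingType) (V : lmodType P) (m : nat).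
Implicit Types (op : 'I_m -> V -> V) (e : V) (i j : 'I_m) (J : {set 'I_m}).
Implicit Types (s : seq 'I_m).

(** A product of operators as a fold over an explicit list s, so that statements about all J can be
    proved by induction on s. The operator listed first is applied last. *)
Definition word_on s op e J : V :=
  foldr (fun i v => if i \in J then op i v else v) e s.

Definition word op e J := word_on (index_enum 'I_m) op e J.

(** The exponent of the sign for moving [op j] past the factors of the word that are listed before
    j. *)
Definition parity s j J := count (mem J) (take (index j s) s).

Definition anticommuting op := (forall i j v, op i (op j v) = - op j (op i v))
  /\ (forall i v, op i (op i v) = 0).

Lemma word_on_notin s op e J j : j \notin s ->
  word_on s op e (j |: J) = word_on s op e J.
Proof.
elim: s => //= i s IH; rewrite inE negb_or => /andP[ji js].
by rewrite !inE eq_sym (negPf ji) IH.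
Qed.

Lemma mul_word_on (op : 'I_m -> {linear V -> V}) e s J j :
  anticommuting op -> uniq s -> j \in s ->
  op j (word_on s op e J) = if j \in J then 0 else
    (-1) ^+ parity s j J *: word_on s op e (j |: J).
Proof.
move=> [anti sq]; elim: s => //= i s IH /andP[nis us]; rewrite inE.
have [-> _|nji /= js] := eqVneq j i.
  rewrite setU11 /parity /= eqxx /= scale1r; case: ifP => iJ.
    by rewrite sq.
  by rewrite word_on_notin.
have iJ : (i \in j |: J) = (i \in J) by rewrite !inE eq_sym (negPf nji).
rewrite iJ /parity /= (eq_sym i) (negPf nji) /= -/(parity s j J).
case: (boolP (i \in J)) => iinJ; last by rewrite IH.
rewrite anti IH//; case: ifP => _; first by rewrite linear0 oppr0.
by rewrite linearZ /= add1n exprS mulN1r scaleNr.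
Qed.

Lemma mul_word (op : 'I_m -> {linear V -> V}) e J j : anticommuting op ->
  op j (word op e J) = if j \in J then 0 else
    (-1) ^+ parity (index_enum 'I_m) j J *: word op e (j |: J).
Proof. by move=> a; rewrite mul_word_on// ?index_enum_uniq ?mem_index_enum. Qed.

Lemma word_eq op op' e J : (forall i v, op i v = op' i v) ->
  word op e J = word op' e J.
Proof. by move=> E; rewrite /word; elim: index_enum => //= i s ->; rewrite E. Qed.

Lemma word0 op e : word op e set0 = e.
Proof.
by rewrite /word; elim: index_enum => //= i s ->; rewrite inE.
Qed.

End Word.

Section RotOp.
Variables (P : comNzRingType) (V : lmodType P) (n m : nat) (g : 'M[P]_(n, m)).

(** Used with two kinds of matrices: an orthogonal g, where it describes the action on forms, and
    the matrix of the coordinates x_aj, where it yields eta_j and its contraction analogue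
    iota_j. *)
Definition rot_op (op : 'I_n -> V -> V) (i : 'I_m) (psi : V) : V :=
  \sum_j g j i *: op j psi.

Fact rot_op_linear (op : 'I_n -> {linear V -> V}) i : linear (rot_op op i).
Proof.
move=> a x y; rewrite /rot_op scaler_sumr -big_split; apply: eq_bigr => j _ /=.
by rewrite linearP scalerDr !scalerA mulrC.
Qed.

Lemma rot_op_anticommuting (op : 'I_n -> {linear V -> V}) :
  anticommuting op -> anticommuting (rot_op op).
Proof.
move=> [anti sq]; split=> [i j v|i v]; rewrite /rot_op.
  under eq_bigr do rewrite linear_sum scaler_sumr.
  under [in RHS]eq_bigr do rewrite linear_sum scaler_sumr.
  rewrite exchange_big -sumrN; apply: eq_bigr => a _ /=.
  rewrite -sumrN; apply: eq_bigr => b _.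
  by rewrite !linearZ /= anti !scalerN !scalerA mulrC.
pose f a b : V := g a i *: op a (g b i *: op b v).
have fA a b : f a b = - f b a.
  by rewrite /f !linearZ /= anti !scalerN !scalerA mulrC.
have fD a : f a a = 0 by rewrite /f linearZ /= sq !scaler0.
transitivity (\sum_a \sum_b f a b).
  by apply: eq_bigr => a _; rewrite linear_sum scaler_sumr.
(* Antisymmetry alone does not force the sum to vanish where 2 is not invertible: the diagonal is
   zero by itself, and the terms with a < b cancel those with b < a. *)
pose lt (a b : 'I_n) := (a < b)%N.
have -> : \sum_a \sum_b f a b =
   \sum_a \sum_(b | lt a b) f a b + \sum_a \sum_(b | lt b a) f a b.
  rewrite -big_split; apply: eq_bigr => a _ /=.
  rewrite (bigID (lt a)) /=; congr (_ + _).
  rewrite (bigD1 a) /= ?fD ?add0r /lt ?ltnn//; apply: eq_bigl => b.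
  by rewrite -leqNgt ltn_neqAle andbC.
rewrite [X in _ + X](exchange_big_dep predT)//= -big_split big1// => a _ /=.
by rewrite -big_split big1// => b _ /=; rewrite [X in _ + X]fA subrr.
Qed.

End RotOp.

Section ExtWord.
Variables (P : comNzRingType) (n : nat).
Local Notation K := (ext P n).
Implicit Types (i j : 'I_n) (I J : {set 'I_n}) (psi : K).

Lemma ext_mul_anticommuting : anticommuting (@ext_mul P n).
Proof. by split; [exact: ext_mul_anti|exact: ext_mul_sq]. Qed.

Lemma wedge_sum (m : nat) (c : 'I_m -> P) (w : 'I_m -> K) psi :
  wedge (\sum_j c j *: w j) psi = \sum_j c j *: wedge (w j) psi.
Proof.
apply/ffunP => J; rewrite ffunE sum_ffunE.
under [RHS]eq_bigr do rewrite !ffunE scaler_sumr.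
rewrite exchange_big /=; apply: eq_bigr => I IJ.
rewrite sum_ffunE mulr_suml mulr_sumr; apply: eq_bigr => j _.
by rewrite ffunE -!scalerAl -scalerAr.
Qed.

Lemma big_wedgeE (m : nat) (F : 'I_m -> K) e (J : {set 'I_m}) :
  \big[@wedge P n/e]_(i < m | i \in J) F i = word (fun l => wedge (F l)) e J.
Proof. by rewrite unlock. Qed.

Lemma ext_expand psi : psi = \sum_I psi I *: ext_basis P I.
Proof.
apply/ffunP => J; rewrite sum_ffunE (bigD1 J)//= big1 ?addr0 => [|I IJ].
  by rewrite !ffunE eqxx [RHS]mulr1.
by rewrite !ffunE eq_sym (negPf IJ) [LHS]mulr0.
Qed.

Lemma index_enum_ord_sorted : sorted (fun i j => (i < j)%N) (index_enum 'I_n).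
Proof.
by have := iota_ltn_sorted 0 n; rewrite -val_enum_ord sorted_map enumT.
Qed.

(** Along the increasing enumeration each factor has a smaller index than those listed after it, so
    it is put in front of them without a sign. *)
Lemma ext_basis_word I : ext_basis P I = word (@ext_mul P n) ext1 I.
Proof.
suff H s : sorted (fun i j => (i < j)%N) s ->
    word_on s (@ext_mul P n) ext1 I = ext_basis P [set i in I | i \in s].
  rewrite /word H ?index_enum_ord_sorted//; congr ext_basis.
  by apply/setP => i; rewrite inE mem_index_enum andbT.
elim: s => [_|i s IH].
  by congr ext_basis; apply/setP => i; rewrite !inE andbF.
rewrite /= path_sortedE => [/andP[/allP si ss]|a b c]; last exact: ltn_trans.
rewrite IH//; case: ifP => iI; last first.
  congr ext_basis; apply/setP => j; rewrite !inE.
  by have [->|] := eqVneq j i; rewrite ?iI.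
have is' : i \notin s by apply/negP => /si; rewrite ltnn.
apply/ffunP => J; rewrite ext_mulE !ffunE.
have -> : [set j in I | j \in i :: s] = i |: [set j in I | j \in s].
  by apply/setP => j; rewrite !inE; have [->|] := eqVneq j i; rewrite ?iI.
case: (boolP (i \in J)) => iJ; last first.
  by case: eqP => // JE; rewrite JE setU11 in iJ.
have -> : (J == i |: [set j in I | j \in s]) =
          (J :\ i == [set j in I | j \in s]).
  apply/eqP/eqP => [->|<-]; last by rewrite setD1K.
  by rewrite setU1K// inE (negPf is') andbF.
case: eqP => [JE|_]; last by rewrite mulr0.
rewrite -(below_setD1_ge J (leqnn i)) JE /below (_ : #|_| = 0)%N ?mul1r//.
apply/eqP; rewrite cards_eq0; apply/eqP/setP => j; rewrite !inE.
apply/negP => /andP[/andP[_ /si ij]]; by rewrite ltnNge ltnW.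
Qed.

Lemma ext_mul_basis j I : ext_mul j (ext_basis P I) = if j \in I then 0 else
  (-1) ^+ parity (index_enum 'I_n) j I *: ext_basis P (j |: I).
Proof. by rewrite !ext_basis_word (mul_word _ _ _ ext_mul_anticommuting). Qed.

Section ExtRot.
Variables (m : nat) (g : 'M[P]_(n, m)).

Definition rot_mul := rot_op g (@ext_mul P n).
Definition rot_contract := rot_op g (@contract P n).

HB.instance Definition _ (i : 'I_m) := GRing.isLinear.Build P K K *:%R (rot_mul i)
  (rot_op_linear g (fun j => @ext_mul P n j : {linear K -> K}) i).
HB.instance Definition _ (i : 'I_m) := GRing.isLinear.Build P K K *:%R (rot_contract i)
  (rot_op_linear g (fun j => @contract P n j : {linear K -> K}) i).

Lemma rot_mul_anticommuting : anticommuting rot_mul.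
Proof.
apply: (rot_op_anticommuting g (op := fun j => @ext_mul P n j : {linear K -> K})).
exact: ext_mul_anticommuting.
Qed.

End ExtRot.

Section ExtMap.
Variable g : 'M[P]_n.

Lemma ext_map_word I : ext_map g (ext_basis P I) =
  word (rot_mul g) ext1 I.
Proof.
rewrite /ext_map (bigD1 I)//= big1 ?addr0 => [|J JI]; last first.
  by rewrite ffunE (negPf JI) scale0r.
rewrite ffunE eqxx scale1r big_wedgeE; apply: word_eq => i v.
rewrite wedge_sum; apply: eq_bigr => j _; rewrite ext_mul_wedge//.
Qed.

End ExtMap.
End ExtWord.

Lemma ext_linear_eq (P : comNzRingType) n (V : lmodType P)
    (f h : {linear ext P n -> V}) :
  (forall I, f (ext_basis P I) = h (ext_basis P I)) -> f =1 h.
Proof.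
move=> E psi; rewrite [psi]ext_expand !linear_sum /=.
by apply: eq_bigr => I _; rewrite !linearZ /= E.
Qed.

(** The relation is bilinear in the two frames, so the Kronecker symbol becomes the matrix of their
    inner products; this is the identity when both frames are the same orthogonal matrix. *)
Lemma rot_contract_mul (P : comNzRingType) n m m' (g : 'M[P]_(n, m))
    (h : 'M[P]_(n, m')) i j (psi : ext P n) :
  rot_contract g j (rot_mul h i psi) =
  (g^T *m h) j i *: psi - rot_mul h i (rot_contract g j psi).
Proof.
have -> : rot_contract g j (rot_mul h i psi) =
    \sum_l \sum_m (g l j * h m i) *: contract l (ext_mul m psi).
  apply: eq_bigr => l _; rewrite linear_sum scaler_sumr.
  by apply: eq_bigr => a _; rewrite linearZ scalerA.
have -> : rot_mul h i (rot_contract g j psi) =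
    \sum_l \sum_m (g l j * h m i) *: ext_mul m (contract l psi).
  rewrite exchange_big; apply: eq_bigr => l _; rewrite linear_sum scaler_sumr.
  by apply: eq_bigr => a _; rewrite linearZ scalerA mulrC.
have -> : (g^T *m h) j i *: psi =
    \sum_l \sum_m (g l j * h m i) *: ((l == m)%:R *: psi).
  rewrite mxE scaler_suml; apply: eq_bigr => l _.
  rewrite (bigD1 l)//= big1 ?addr0 ?eqxx => [|a al].
    by rewrite scale1r mxE.
  by rewrite eq_sym (negPf al) scale0r scaler0.
rewrite -sumrB; apply: eq_bigr => l _; rewrite -sumrB; apply: eq_bigr => a _.
by rewrite -scalerBr contract_mul.
Qed.

Section ExtMap.
Variables (P : comNzRingType) (n : nat).
Local Notation K := (ext P n).
Implicit Types (i j : 'I_n) (I J : {set 'I_n}) (psi : K).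
Variable g : 'M[P]_n.

HB.instance Definition _ :=
  GRing.isLinear.Build P K K *:%R (ext_map g) (ext_map_linear g).

Lemma ext_map_mul j psi :
  ext_map g (ext_mul j psi) = rot_mul g j (ext_map g psi).
Proof.
apply: (@ext_linear_eq _ _ _ (ext_map g \o @ext_mul P n j)
  (rot_mul g j \o ext_map g)) => I /=.
rewrite ext_mul_basis ext_map_word.
rewrite (mul_word _ _ _ (rot_mul_anticommuting g)).
by case: ifP => _; rewrite ?linear0// linearZ /= ext_map_word.
Qed.

Lemma ext_map1 : ext_map g ext1 = ext1.
Proof. by rewrite ext_map_word word0. Qed.

Lemma ext_basis_ind (Q : K -> Prop) :
  Q ext1 -> (forall j psi, Q psi -> Q (ext_mul j psi)) ->
  forall I, Q (ext_basis P I).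
Proof.
move=> Q1 QM I; rewrite ext_basis_word /word.
by elim: index_enum => //= i s Qs; case: ifP => // _; apply: QM.
Qed.

Lemma contract1 j : contract j (ext1 : K) = 0.
Proof.
apply/ffunP => J; rewrite contractE [RHS]ffunE; case: ifP => // _.
rewrite !ffunE (_ : _ == _ = false) ?mulr0//.
by apply/negbTE/set0Pn; exists j; rewrite setU11.
Qed.

(** A contraction is determined by its vanishing on 1 and its relation with exterior multiplication,
    so an induction over words suffices; orthogonality makes the rotated pair satisfy the same
    relation. *)
Lemma ext_map_contract j psi : g^T *m g = 1%:M ->
  ext_map g (contract j psi) = rot_contract g j (ext_map g psi).
Proof.
move=> gO; apply: (@ext_linear_eq _ _ _ (ext_map g \o @contract P n j)
  (rot_contract g j \o ext_map g)) => I /=.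
move: I; apply: (@ext_basis_ind (fun v =>
  ext_map g (contract j v) = rot_contract g j (ext_map g v))) => [|i v IH].
  rewrite contract1 linear0 ext_map1 /rot_contract /rot_op big1// => l _.
  by rewrite contract1 scaler0.
rewrite contract_mul linearB linearZ /= !ext_map_mul IH.
by rewrite rot_contract_mul gO mxE.
Qed.

End ExtMap.

Lemma volE (P : comNzRingType) n : vol = ext_basis P [set: 'I_n].
Proof.
rewrite ext_basis_word -(word_eq _ _ (fun i v => esym (ext_mul_wedge i v))).
by rewrite -big_wedgeE /vol; apply: eq_bigl => i; rewrite inE.
Qed.

(** * Form degree and the number operator *)

Section Degree.
Variables (P : comNzRingType) (n : nat).
Local Notation K := (ext P n).
Implicit Types (i j : 'I_n) (J : {set 'I_n}) (psi : K) (l : nat).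

Definition hdeg l psi := forall J, #|J| <> l -> psi J = 0.

(* [hdegp l] means degree [l - 1], so that [hdegp 0] only contains [0]. *)
Definition hdegp l psi := forall J, (#|J|).+1 <> l -> psi J = 0.

Lemma hdegpS l psi : hdegp l.+1 psi <-> hdeg l psi.
Proof. by split=> H J Jl; apply: H => E; apply: Jl; [case: E|rewrite E]. Qed.

Lemma hdeg_sum l (I : Type) (r : seq I) (Q : pred I) (F : I -> K) :
  (forall a, Q a -> hdeg l (F a)) -> hdeg l (\sum_(a <- r | Q a) F a).
Proof.
by move=> H J Jl; rewrite sum_ffunE big1// => a Qa; apply: H.
Qed.

Lemma hdegp_sum l (I : Type) (r : seq I) (Q : pred I) (F : I -> K) :
  (forall a, Q a -> hdegp l (F a)) -> hdegp l (\sum_(a <- r | Q a) F a).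
Proof.
by move=> H J Jl; rewrite sum_ffunE big1// => a Qa; apply: H.
Qed.

Lemma hdegZ l c psi : hdeg l psi -> hdeg l (c *: psi).
Proof. by move=> H J Jl; rewrite ffunE H// [LHS]mulr0. Qed.

Lemma hdegpZ l c psi : hdegp l psi -> hdegp l (c *: psi).
Proof. by move=> H J Jl; rewrite ffunE H// [LHS]mulr0. Qed.

Lemma hdegD l psi chi : hdeg l psi -> hdeg l chi -> hdeg l (psi + chi).
Proof. by move=> H H' J Jl; rewrite ffunE H// H'// addr0. Qed.

Lemma hdegB l psi chi : hdeg l psi -> hdeg l chi -> hdeg l (psi - chi).
Proof. by move=> H H' J Jl; rewrite !ffunE H// H'// subr0. Qed.

Lemma hdegpD l psi chi : hdegp l psi -> hdegp l chi -> hdegp l (psi + chi).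
Proof. by move=> H H' J Jl; rewrite ffunE H// H'// addr0. Qed.

Lemma hdegpB l psi chi : hdegp l psi -> hdegp l chi -> hdegp l (psi - chi).
Proof. by move=> H H' J Jl; rewrite !ffunE H// H'// subr0. Qed.

Lemma hdegp_mul l j psi : hdegp l psi -> hdeg l (ext_mul j psi).
Proof.
move=> H J Jl; rewrite ext_mulE; case: ifP => // jJ; rewrite H ?mulr0//.
by rewrite (cardsD1 j) jJ add1n in Jl.
Qed.

Lemma hdegp_contract l j psi : hdeg l psi -> hdegp l (contract j psi).
Proof.
move=> H J Jl; rewrite contractE; case: ifP => // jJ; rewrite H ?mulr0//.
by rewrite cardsU1 jJ add1n.
Qed.

Lemma hdeg_basis (I : {set 'I_n}) : hdeg #|I| (ext_basis P I).
Proof. by move=> J; rewrite ffunE; case: eqP => // ->. Qed.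

Lemma hdeg1 : hdeg 0 (ext1 : K).
Proof. by rewrite -(cards0 'I_n); apply: hdeg_basis. Qed.

Lemma hdeg_vol : hdeg n (vol : K).
Proof. by rewrite volE -[X in hdeg X](card_ord n) -cardsT; apply: hdeg_basis. Qed.

Lemma hdegp_rot_mul m (g : 'M[P]_(n, m)) (a : 'I_m) l psi :
  hdegp l psi -> hdeg l (rot_mul g a psi).
Proof. by move=> H; apply: hdeg_sum => j _; apply/hdegZ/hdegp_mul. Qed.

Lemma hdeg_rot_mul m (g : 'M[P]_(n, m)) (a : 'I_m) l psi :
  hdeg l psi -> hdeg l.+1 (rot_mul g a psi).
Proof. by move=> /hdegpS /hdegp_rot_mul. Qed.

Lemma hdeg_word m d (op : 'I_m -> K -> K) e (J : {set 'I_m}) :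
  (forall a l psi, hdeg l psi -> hdeg l.+1 (op a psi)) -> hdeg d e ->
  hdeg (#|J| + d) (word op e J).
Proof.
move=> opH eH; rewrite (_ : #|J| = count (mem J) (index_enum 'I_m)); last first.
  by rewrite cardE /index_enum /enum_mem size_filter.
rewrite /word; elim: index_enum => //= a s IH.
by case: ifP => _; rewrite ?add0n// add1n; apply: opH.
Qed.

(** Each term is the projection onto the basis elements omega_J with i in J, so omega_J is counted
    once for each element of J. *)
Lemma sum_mul_contract l psi : hdeg l psi ->
  \sum_i ext_mul i (contract i psi) = l%:R *: psi.
Proof.
move=> H; apply/ffunP => J; rewrite sum_ffunE ffunE.
have E i : ext_mul i (contract i psi) J = (i \in J)%:R * psi J.
  rewrite ext_mulE contractE setD11; case: ifP => iJ; last by rewrite mul0r.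
  rewrite (below_setD1_ge J (leqnn i)) mulrA -exprD -signr_odd oddD addbb.
  by rewrite expr0 !mul1r setD1K.
under eq_bigr do rewrite E.
rewrite -mulr_suml -natr_sum -[RHS]/(l%:R * psi J).
have [<-|/eqP Jl] := eqVneq #|J| l; last by rewrite H// !mulr0.
by rewrite -sum1_card [in RHS]big_mkcond; congr (_%:R * _); apply: eq_bigr => i _; case: ifP.
Qed.

Lemma sum_contract_mul l psi : hdeg l psi ->
  \sum_i contract i (ext_mul i psi) = (n%:R - l%:R) *: psi.
Proof.
move=> H; under eq_bigr do rewrite contract_mul eqxx scale1r.
rewrite sumrB (sum_mul_contract H) sumr_const card_ord scalerBl.
by rewrite !scaler_nat.

Qed.

End Degree.

(** * The volume form and determinants *)

Section Volume.
Variable P : comNzRingType.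

(** Sets omega_i to zero and renumbers the other generators: the counterpart for forms of deleting
    row i in a Laplace expansion. *)
Definition ext_restrict n (i : 'I_n.+1) (psi : ext P n.+1) : ext P n :=
  [ffun J : {set 'I_n} => psi (lift i @: J)].

Lemma ext_restrict_linear n (i : 'I_n.+1) : linear (ext_restrict i).
Proof. by move=> a x y; apply/ffunP => J; rewrite !ffunE. Qed.

HB.instance Definition _ n (i : 'I_n.+1) := GRing.isLinear.Build P
  (ext P n.+1) (ext P n) *:%R (ext_restrict i) (@ext_restrict_linear n i).

Lemma notin_lift n (i : 'I_n.+1) (J : {set 'I_n}) : i \notin lift i @: J.
Proof. by apply/imsetP => -[j _ /eqP]; rewrite (negPf (neq_lift i j)). Qed.

Lemma ext_restrict_mul n (i : 'I_n.+1) psi :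
  ext_restrict i (ext_mul i psi) = 0.
Proof.
by apply/ffunP => J; rewrite ffunE ext_mulE (negPf (notin_lift i J)) ffunE.
Qed.

Lemma ext_restrict_mul_lift n (i : 'I_n.+1) j psi :
  ext_restrict i (ext_mul (lift i j) psi) = ext_mul j (ext_restrict i psi).
Proof.
apply/ffunP => J; rewrite ffunE !ext_mulE ffunE mem_imset; last exact: lift_inj.
case: ifP => jJ//; congr (_ ^+ _ * psi _).
  rewrite /below -(card_imset _ (@lift_inj _ i)); apply: eq_card => l.
  rewrite inE; apply/andP/imsetP => [[/imsetP[l' lJ ->]]|[l']].
    by move=> H; exists l' => //; rewrite inE lJ; move: H; rewrite /= ltnNge leq_bump2 -ltnNge.
  rewrite inE => /andP[lJ lj] ->; split; first exact: imset_f.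
  by rewrite /= ltnNge leq_bump2 -ltnNge.
apply/setP => l; rewrite !inE; apply/andP/imsetP => [[lj /imsetP[l' lJ E]]|[l']].
  exists l' => //; rewrite !inE lJ andbT; apply: contra lj => /eqP <-.
  by rewrite E.
rewrite !inE => /andP[l'j lJ] ->; split; last exact: imset_f.
by apply: contra l'j => /eqP/lift_inj->.
Qed.

Lemma ext_restrict1 n (i : 'I_n.+1) : ext_restrict i ext1 = ext1.
Proof.
apply/ffunP => J; rewrite !ffunE; congr (_%:R).
by rewrite -(imset0 (lift i)) (inj_eq (imset_inj (@lift_inj _ i))).
Qed.

Lemma ext_restrict_rot n (g : 'M[P]_n.+1) i l psi :
  ext_restrict i (rot_mul g (lift ord0 l) psi) =
  rot_mul (row' i (col' ord0 g)) l (ext_restrict i psi).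
Proof.
rewrite /rot_mul /rot_op linear_sum (bigD1_ord i)//= linearZ /=.
rewrite ext_restrict_mul scaler0 add0r; apply: eq_bigr => j _.
by rewrite linearZ /= ext_restrict_mul_lift !mxE.
Qed.

Lemma below_setT n (j : 'I_n) : below setT j = j.
Proof.
rewrite /below -sum1dep_card -[RHS]card_ord -sum1_card.
rewrite [RHS](big_ord_widen n (fun=> 1%N)) 1?ltnW//.
by apply: eq_bigl => i; rewrite inE.
Qed.

(** Laplace expansion along the first column: the outermost operator contributes omega_j with
    coefficient g_j0 and sign (-1)^j, and what remains is the same word for the minor without row j
    and column 0. *)
Lemma word_setT_det n (g : 'M[P]_n) : word (rot_mul g) ext1 setT setT = \det g.
Proof.
elim: n g => [g|n IH g].
  rewrite det_mx00 /word (size0nil (_ : size (index_enum _) = 0)%N) /=.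
    rewrite ffunE (_ : _ == _) //; apply/eqP/setP => -[]//.
  by rewrite /index_enum -enumT -cardT card_ord.
rewrite /word /index_enum -enumT enum_ordSl /= in_setT.
set v := word_on _ _ _ _; rewrite (expand_det_col g ord0) /rot_mul /rot_op sum_ffunE.
apply: eq_bigr => j _; rewrite ffunE ext_mulE in_setT below_setT.
rewrite /cofactor addn0 -IH; congr (_ * (_ * _)).
have -> : setT :\ j = lift j @: [set: 'I_n].
  apply/setP => l; rewrite !inE andbT; apply/idP/imsetP => [lj|[l' _ ->]].
    by case: (unliftP j l) lj => [l' ->|->]; [exists l'|rewrite eqxx].
  by rewrite eq_sym neq_lift.
transitivity (ext_restrict j v setT); first by rewrite ffunE.
congr (fun_of_fin _ _); rewrite /v /word /index_enum -enumT.
elim: (enum 'I_n) => [|l s IHs] /=; first exact: ext_restrict1.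
by rewrite !in_setT ext_restrict_rot IHs.
Qed.

Lemma ext_mul_vol n (j : 'I_n) : ext_mul j vol = 0 :> ext P n.
Proof. by rewrite volE ext_mul_basis in_setT. Qed.

Lemma ext_map_vol n (g : 'M[P]_n) : ext_map g vol = \det g *: vol.
Proof.
rewrite volE ext_map_word -word_setT_det; apply/ffunP => J.
rewrite !ffunE; case: eqP => [->|JT]; first by rewrite [RHS]mulr1.
rewrite [RHS]mulr0; apply: (hdeg_word (op := rot_mul g) (d := 0)).
- by move=> i d psi; exact: hdeg_rot_mul.
- exact: hdeg1.
by rewrite addn0 => E; apply: JT; apply/eqP; rewrite eqEcard subsetT -E/=.
Qed.

End Volume.

(** * Polynomial forms *)

(* The scaling is locked because unification would otherwise compare two
   different multiples of a form coefficientwise. *)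
HB.lock Definition form_scale (C : comNzRingType) N n (p : mpoly N C)
  (psi : ext (mpoly N C) n) : ext (mpoly N C) n := p *: psi.

Section PolyFormModule.
Variables (C : comNzRingType) (N n : nat).
Local Notation P := (mpoly N C).

Definition polyform : Type := ext P n.
HB.instance Definition _ := GRing.Zmodule.on polyform.

Fact form_scaleA (p q : P) (psi : polyform) :
  form_scale p (form_scale q psi) = form_scale (p * q) psi.
Proof. by rewrite !unlock scalerA. Qed.

Fact form_scale1 : left_id 1 (@form_scale C N n).
Proof. by move=> psi; rewrite !unlock scale1r. Qed.

Fact form_scaleDr : right_distributive (@form_scale C N n) (@GRing.add polyform).
Proof. by move=> p psi chi; rewrite !unlock; exact: scalerDr. Qed.

Fact form_scaleDl (psi : polyform) :
  {morph (@form_scale C N n)^~ psi : p q / p + q >-> @GRing.add polyform p q}.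
Proof. by move=> p q; rewrite /= !unlock; exact: scalerDl. Qed.

HB.instance Definition _ := GRing.Zmodule_isLmodule.Build P polyform
  (@form_scaleA) (@form_scale1) (@form_scaleDr) (@form_scaleDl).

Lemma polyformZE (p : P) (psi : polyform) I : (p *: psi) I = p * psi I.
Proof. by rewrite /GRing.scale /= unlock ffunE. Qed.

Lemma polyformZ (p : P) (psi : polyform) : p *: psi = p *: (psi : ext P n).
Proof. by rewrite /GRing.scale /= unlock. Qed.

End PolyFormModule.

HB.lock Definition pderiv (C : comNzRingType) N n (v : 'I_N)
  (psi : polyform C N n) : polyform C N n := [ffun I => mderiv v (psi I)].
HB.lock Definition fmul (C : comNzRingType) N n (a : 'I_n)
  (psi : polyform C N n) : polyform C N n := ext_mul a (psi : ext _ n).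
HB.lock Definition fcontract (C : comNzRingType) N n (a : 'I_n)
  (psi : polyform C N n) : polyform C N n := contract a (psi : ext _ n).

Section PolyForms.
Variables (C : comNzRingType) (N n : nat).
Local Notation P := (mpoly N C).
Local Notation K := (polyform C N n).
Implicit Types (v w : 'I_N) (a b : 'I_n) (psi chi : K) (p q : P).

Lemma pderivE v psi I : pderiv v psi I = mderiv v (psi I).
Proof. by rewrite unlock ffunE. Qed.

Fact pderiv_is_zmod_morphism v : zmod_morphism (@pderiv C N n v).
Proof. by move=> x y; apply/ffunP => I; rewrite !(pderivE, ffunE) mderivB. Qed.
HB.instance Definition _ v :=
  GRing.isZmodMorphism.Build K K (@pderiv C N n v) (pderiv_is_zmod_morphism v).

Lemma fmulE a psi J : fmul a psi J =
  if a \in J then (-1) ^+ below J a * psi (J :\ a) else 0.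
Proof. by rewrite fmul.unlock ext_mulE. Qed.

Lemma fcontractE a psi J : fcontract a psi J =
  if a \in J then 0 else (-1) ^+ below J a * psi (a |: J).
Proof. by rewrite fcontract.unlock contractE. Qed.

Fact fmul_linear a : linear (@fmul C N n a).
Proof.
by move=> c x y; rewrite fmul.unlock !polyformZ; exact: linearP.
Qed.
HB.instance Definition _ a :=
  GRing.isLinear.Build P K K *:%R (@fmul C N n a) (fmul_linear a).

Fact fcontract_linear a : linear (@fcontract C N n a).
Proof.
by move=> c x y; rewrite fcontract.unlock !polyformZ; exact: linearP.
Qed.
HB.instance Definition _ a :=
  GRing.isLinear.Build P K K *:%R (@fcontract C N n a) (fcontract_linear a).

Lemma fmulD a : {morph @fmul C N n a : x y / x + y}.
Proof. exact: raddfD. Qed.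

Lemma fmulB a : {morph @fmul C N n a : x y / x - y}.
Proof. exact: raddfB. Qed.

Lemma fmulN a : {morph @fmul C N n a : x / - x}.
Proof. exact: raddfN. Qed.

Lemma fmul0 a : fmul a (0 : K) = 0.
Proof. exact: raddf0. Qed.

Lemma fmul_sum a (I : finType) (F : I -> K) :
  fmul a (\sum_s F s) = \sum_s fmul a (F s).
Proof. exact: raddf_sum. Qed.

Lemma fmulZ a c psi : fmul a (c *: psi) = c *: fmul a psi.
Proof. exact: linearZ. Qed.

Lemma fcontractD a : {morph @fcontract C N n a : x y / x + y}.
Proof. exact: raddfD. Qed.

Lemma fcontract0 a : fcontract a (0 : K) = 0.
Proof. exact: raddf0. Qed.

Lemma fcontract_sum a (I : finType) (F : I -> K) :
  fcontract a (\sum_s F s) = \sum_s fcontract a (F s).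
Proof. exact: raddf_sum. Qed.

Lemma fcontractZ a c psi : fcontract a (c *: psi) = c *: fcontract a psi.
Proof. exact: linearZ. Qed.

Lemma fmul_sq a psi : fmul a (fmul a psi) = 0.
Proof. by rewrite fmul.unlock ext_mul_sq. Qed.

Lemma fmul_anti a b psi : fmul a (fmul b psi) = - fmul b (fmul a psi).
Proof. by rewrite fmul.unlock; exact: ext_mul_anti. Qed.

Lemma fcontract_sq a psi : fcontract a (fcontract a psi) = 0.
Proof. by rewrite fcontract.unlock contract_sq. Qed.

Lemma fcontract_anti a b psi :
  fcontract a (fcontract b psi) = - fcontract b (fcontract a psi).
Proof. by rewrite fcontract.unlock; exact: contract_anti. Qed.

Lemma fcontract_mul a b psi : fcontract a (fmul b psi) =
  (a == b)%:R *: psi - fmul b (fcontract a psi).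
Proof. by rewrite fmul.unlock fcontract.unlock polyformZ; exact: contract_mul. Qed.

Lemma fmul_anticommuting : anticommuting (@fmul C N n).
Proof. by split; [exact: fmul_anti|exact: fmul_sq]. Qed.

Lemma fcontract_anticommuting : anticommuting (@fcontract C N n).
Proof. by split; [exact: fcontract_anti|exact: fcontract_sq]. Qed.

Lemma hdeg_fZ l c psi : hdeg l psi -> hdeg l (c *: psi).
Proof. by rewrite polyformZ; exact: hdegZ. Qed.

Lemma hdegp_fZ l c psi : hdegp l psi -> hdegp l (c *: psi).
Proof. by rewrite polyformZ; exact: hdegpZ. Qed.

Lemma hdegp_fmul l a psi : hdegp l psi -> hdeg l (fmul a psi).
Proof. by rewrite fmul.unlock; exact: hdegp_mul. Qed.

Lemma hdegp_fcontract l a psi : hdeg l psi -> hdegp l (fcontract a psi).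
Proof. by rewrite fcontract.unlock; exact: hdegp_contract. Qed.

Lemma sum_fmul_contract l psi : hdeg l psi ->
  \sum_a fmul a (fcontract a psi) = l%:R *: psi.
Proof. by rewrite fmul.unlock fcontract.unlock polyformZ; exact: sum_mul_contract. Qed.

Lemma sum_fcontract_mul l psi : hdeg l psi ->
  \sum_a fcontract a (fmul a psi) = (n%:R - l%:R) *: psi.
Proof. by rewrite fmul.unlock fcontract.unlock polyformZ; exact: sum_contract_mul. Qed.

Lemma pderivM v p psi :
  pderiv v (p *: psi) = mderiv v p *: psi + p *: pderiv v psi.
Proof. by apply/ffunP => I; rewrite pderivE ffunE !polyformZE pderivE; exact: mderivM. Qed.

Lemma pderivC v w psi : pderiv v (pderiv w psi) = pderiv w (pderiv v psi).
Proof. by apply/ffunP => I; rewrite !pderivE mderiv_comm. Qed.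

Lemma mderiv_signM v m p : mderiv v ((-1) ^+ m * p) = (-1) ^+ m * mderiv v p.
Proof. by rewrite -signr_odd !mulr_sign; case: ifP => _; rewrite ?raddfN. Qed.

Lemma pderiv_fmul v a psi : pderiv v (fmul a psi) = fmul a (pderiv v psi).
Proof.
apply/ffunP => J; rewrite pderivE !fmulE; case: ifP => _; last exact: raddf0.
by rewrite mderiv_signM pderivE.
Qed.

Lemma pderiv_fcontract v a psi :
  pderiv v (fcontract a psi) = fcontract a (pderiv v psi).
Proof.
apply/ffunP => J; rewrite pderivE !fcontractE; case: ifP => _; first exact: raddf0.
by rewrite mderiv_signM pderivE.
Qed.

Lemma pderiv_const v c : c \in [:: ext1; vol] -> pderiv v (c : K) = 0.
Proof.
have B (I : {set 'I_n}) : pderiv v (ext_basis P I) = 0.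
  apply/ffunP => J; rewrite pderivE !ffunE; case: eqP => _; last exact: raddf0.
  exact: mderivC.
by rewrite !inE volE => /orP[] /eqP ->; apply: B.
Qed.

Lemma hdeg_pderiv l v psi : hdeg l psi -> hdeg l (pderiv v psi).
Proof. by move=> H J Jl; rewrite pderivE H// mderiv0. Qed.

Lemma hdegp_pderiv l v psi : hdegp l psi -> hdegp l (pderiv v psi).
Proof. by move=> H J Jl; rewrite pderivE H// mderiv0. Qed.

(** A strict bound on the degree, so that [dlt 0] forces the form to be zero and serves as the start
    of the inductions on D. *)
Definition dlt D psi := forall I m, (D <= mdeg m)%N -> mcoeff m (psi I) = 0.

Lemma dltD D psi chi : dlt D psi -> dlt D chi -> dlt D (psi + chi).
Proof. by move=> H H' I m mD; rewrite ffunE mcoeffD H// H'// addr0. Qed.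

Lemma dlt0 D : dlt D (0 : K).
Proof. by move=> I m mD; rewrite ffunE mcoeff0. Qed.

Lemma dltN D psi : dlt D psi -> dlt D (- psi).
Proof. by move=> H I m mD; rewrite ffunE mcoeffN H// oppr0. Qed.

Lemma dlt_sum D (I : Type) (r : seq I) (Q : pred I) (F : I -> K) :
  (forall i, Q i -> dlt D (F i)) -> dlt D (\sum_(i <- r | Q i) F i).
Proof. by move=> H; elim/big_rec: _ => [|i x Qi]; [exact: dlt0|apply: dltD; exact: H]. Qed.

Lemma dlt_leq D E psi : (D <= E)%N -> dlt D psi -> dlt E psi.
Proof. by move=> DE H I m mE; apply: H; apply: leq_trans mE. Qed.

Lemma dltZ D c psi : dlt D psi -> dlt D (mpolyC N c *: psi).
Proof. by move=> H I m mD; rewrite polyformZE mcoeffCM H// mulr0. Qed.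

Lemma sub_mnm1K v (m : multinom N) : (0 < m v)%N ->
  mnm_add (mnm_sub m (mnm1 v)) (mnm1 v) = m.
Proof.
move=> mv; apply/mnmP => w; rewrite mnmDE mnmBE mnm1E.
by case: eqP => [<-|_]; rewrite ?subnK// subn0 addn0.
Qed.

Lemma mcoeff_XM v p m : mcoeff m (mpolyX C (mnm1 v) * p) =
  if (0 < m v)%N then mcoeff (mnm_sub m (mnm1 v)) p else 0.
Proof.
rewrite mulrC; case: ifP => mv.
  by rewrite -{1}(sub_mnm1K mv) [mnm_add _ _]addmC mcoeffMX.
apply/eqP; rewrite mcoeff_eq0 (perm_mem (msuppMX _ _)).
apply/mapP => -[m' _ E]; move: mv; rewrite E mnmDE mnm1E eqxx add1n; done.
Qed.

Lemma dltX D v psi : dlt D psi -> dlt D.+1 (mpolyX C (mnm1 v) *: psi).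
Proof.
move=> H I m mD; rewrite polyformZE mcoeff_XM; case: ifP => // mv.
by apply: H; rewrite -ltnS (leq_trans mD)// -{1}(sub_mnm1K mv) mdegD mdeg1 addn1.
Qed.

Lemma dlt_pderiv D v psi : dlt D psi -> dlt D.-1 (pderiv v psi).
Proof.
move=> H I m mD; rewrite pderivE mcoeff_deriv H ?mul0rn// mdegD mdeg1.
by case: D mD {H} => // D; rewrite addn1.
Qed.

Lemma dlt_fmul D a psi : dlt D psi -> dlt D (fmul a psi).
Proof.
move=> H I m mD; rewrite fmulE; case: ifP => _; last by rewrite mcoeff0.
rewrite -signr_odd mulr_sign; case: ifP => _; rewrite ?mcoeffN H ?oppr0//.
Qed.

Lemma dlt_fcontract D a psi : dlt D psi -> dlt D (fcontract a psi).
Proof.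
move=> H I m mD; rewrite fcontractE; case: ifP => _; first by rewrite mcoeff0.
rewrite -signr_odd mulr_sign; case: ifP => _; rewrite ?mcoeffN H ?oppr0//.
Qed.

Lemma dlt_ex psi : exists D, dlt D psi.
Proof.
exists (\max_I msize (psi I)) => I m mD; apply/eqP; rewrite mcoeff_eq0.
apply: msize_mdeg_ge; apply: leq_trans mD.
exact: (leq_bigmax (F := fun I => msize (psi I))).
Qed.

Lemma dlt0_eq0 psi : dlt 0 psi -> psi = 0.
Proof.
move=> H; apply/ffunP => I; apply/mpolyP => m; rewrite H// ffunE mcoeff0//.
Qed.

End PolyForms.

(** * The Fischer inner product *)

Section Fischer.
Variables (C : numClosedFieldType) (N n : nat).
Local Notation P := (mpoly N C).
Local Notation K := (polyform C N n).
Implicit Types (v : 'I_N) (a b : 'I_n) (psi chi : K) (p q : P).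

(** The weights of the Fischer product, that is, the squared norms of the monomials. *)
Definition mfact (m : multinom N) : nat := \prod_(v < N) (m v)`!.

Lemma mfact_gt0 m : (0 < mfact m)%N.
Proof. by rewrite prodn_gt0// => v; rewrite fact_gt0. Qed.

Lemma mfactD1 m v : mfact (mnm_add m (mnm1 v)) = (mfact m * (m v).+1)%N.
Proof.
rewrite /mfact (bigD1 v)//= [in RHS](bigD1 v)//= mnmDE mnm1E eqxx addn1 factS.
rewrite [RHS]mulnAC [(_ * (m v).+1)%N]mulnC; congr (_ * _ * _)%N.
apply: eq_bigr => w wv.
by rewrite mnmDE mnm1E eq_sym (negPf wv) addn0.
Qed.

(** The summand vanishes outside the support of p; [pformE] therefore allows any larger list, and a
    common list for two polynomials gives additivity and symmetry. *)
Definition pform p q : C :=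
  \sum_(m <- msupp p) (mfact m)%:R * (mcoeff m p * (mcoeff m q)^*).

Lemma pformE (s : seq (multinom N)) p q : uniq s ->
  {subset msupp p <= s} ->
  pform p q = \sum_(m <- s) (mfact m)%:R * (mcoeff m p * (mcoeff m q)^*).
Proof.
move=> us sub; rewrite [RHS](bigID [in msupp p]) /= [X in _ + X]big1 ?addr0.
  rewrite -big_filter; apply: perm_big; apply: uniq_perm => //.
    exact: filter_uniq.
  by move=> m; rewrite mem_filter; case: (boolP (m \in msupp p)) => //= /sub->.
by move=> m /memN_msupp_eq0 ->; rewrite mul0r mulr0.
Qed.

Lemma pformDl p p' q : pform (p + p') q = pform p q + pform p' q.
Proof.
pose s := undup (msupp p ++ msupp p'); have us : uniq s := undup_uniq _.
have sp : {subset msupp p <= s} by move=> m mp; rewrite mem_undup mem_cat mp.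
have sp' : {subset msupp p' <= s}.
  by move=> m mp; rewrite mem_undup mem_cat mp orbT.
have spp' : {subset msupp (p + p') <= s} by move=> m /msuppD_le; rewrite mem_undup.
rewrite (pformE _ us spp') (pformE _ us sp) (pformE _ us sp').
rewrite -big_split; apply: eq_bigr => m _ /=.
by rewrite mcoeffD mulrDl mulrDr.
Qed.

Lemma pform_sym p q : pform q p = (pform p q)^*.
Proof.
pose s := undup (msupp p ++ msupp q); have us : uniq s := undup_uniq _.
have sp : {subset msupp p <= s} by move=> m mp; rewrite mem_undup mem_cat mp.
have sq : {subset msupp q <= s} by move=> m mp; rewrite mem_undup mem_cat mp orbT.
rewrite (pformE _ us sp) (pformE _ us sq).
rewrite rmorph_sum; apply: eq_bigr => m _ /=.
by rewrite !rmorphM /= conjCK rmorph_nat [mcoeff m q * _]mulrC.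
Qed.

Lemma pform_signM m p q : pform ((-1) ^+ m * p) ((-1) ^+ m * q) = pform p q.
Proof.
have N1 p' q' : pform (- p') q' = - pform p' q'.
  have Z q'' : pform 0 q'' = 0 by rewrite /pform msupp0 big_nil.
  by apply/eqP; rewrite -addr_eq0 -pformDl addNr Z.
rewrite -signr_odd !mulr_sign; case: ifP => // _.
by rewrite N1 pform_sym N1 rmorphN /= opprK -pform_sym.
Qed.

Lemma pform_signl m p q : pform ((-1) ^+ m * p) q = pform p ((-1) ^+ m * q).
Proof. by rewrite -(pform_signM m) mulrA -exprD addnn -signr_odd odd_double mul1r. Qed.

Lemma pformCl c p q : pform (mpolyC N c * p) q = c * pform p q.
Proof.
rewrite (pformE (s := msupp p))//; last first.
  move=> m; rewrite !mcoeff_msupp mcoeffCM; apply: contraNneq => ->.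
  by rewrite mulr0.
rewrite mulr_sumr; apply: eq_bigr => m _.
by rewrite mcoeffCM -mulrA mulrCA.
Qed.

(** Raising the exponent of v by one multiplies the weight by m v + 1, which is the factor that the
    derivative produces. *)
Lemma pformX v p q : pform (mpolyX C (mnm1 v) * p) q = pform p (mderiv v q).
Proof.
rewrite mulrC /pform (perm_big _ (msuppMX _ _)) big_map.
apply: eq_bigr => m _; rewrite mcoeffMX [mnm_add _ _]addmC mfactD1.
rewrite mcoeff_deriv raddfMn natrM -!mulrA; congr (_ * _).
by rewrite mulr_natl mulrnAr.
Qed.

Lemma pform_ge0 p : 0 <= pform p p.
Proof.
by rewrite sumr_ge0// => m _; rewrite mulr_ge0 ?ler0n// mul_conjC_ge0.
Qed.

Lemma pform_eq0 p : pform p p = 0 -> p = 0.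
Proof.
move=> /eqP; rewrite psumr_eq0 => [/allP H|m _]; last first.
  by rewrite mulr_ge0 ?ler0n// mul_conjC_ge0.
apply/msuppnil0; case E : (msupp p) H => [//|m s] /(_ m (mem_head _ _)).
rewrite mulf_eq0 pnatr_eq0 -leqn0 leqNgt mfact_gt0 mul_conjC_eq0 /=.
by rewrite mcoeff_eq0 E mem_head.
Qed.

Definition fischer psi chi : C := \sum_I pform (psi I) (chi I).

Lemma fischerDl psi psi' chi : fischer (psi + psi') chi = fischer psi chi + fischer psi' chi.
Proof.
by rewrite -big_split; apply: eq_bigr => I _ /=; rewrite ffunE pformDl.
Qed.

Lemma fischer_sym psi chi : fischer chi psi = (fischer psi chi)^*.
Proof. by rewrite rmorph_sum /=; apply: eq_bigr => I _; rewrite pform_sym. Qed.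

Lemma fischerCl c psi chi : fischer (mpolyC N c *: psi) chi = c * fischer psi chi.
Proof.
by rewrite mulr_sumr; apply: eq_bigr => I _; rewrite polyformZE pformCl.
Qed.

Lemma fischerX v psi chi :
  fischer (mpolyX C (mnm1 v) *: psi) chi = fischer psi (pderiv v chi).
Proof. by apply: eq_bigr => I _; rewrite pderivE polyformZE pformX. Qed.

(** The bijection between sets without a and sets with a matches the two sums, and both operators
    carry the same sign. *)
Lemma fischer_fmul a psi chi :
  fischer (fmul a psi) chi = fischer psi (fcontract a chi).
Proof.
have pform0 q : pform 0 q = 0 by rewrite /pform msupp0 big_nil.
rewrite /fischer (bigID (fun I : {set 'I_n} => a \in I)) /=.
rewrite [X in _ + X]big1 ?addr0 => [|I aI]; last by rewrite fmulE (negPf aI).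
rewrite [RHS](bigID (fun I : {set 'I_n} => a \in I)) /=.
rewrite [X in _ = X + _]big1 ?add0r => [|I aI]; last first.
  by rewrite fcontractE aI pform_sym pform0 rmorph0.
rewrite (reindex_onto (fun I => a |: I) (fun I => I :\ a)) /=; last first.
  by move=> I aI; rewrite setD1K.
apply: eq_big => [I|I /andP[_ /eqP E]].
  rewrite setU11 /=; apply/eqP/idP => [<-|aI]; first by rewrite setD11.
  by rewrite setU1K.
rewrite fmulE setU11 E fcontractE -E setD11 E.
by rewrite (below_setU1_ge I (leqnn a)) pform_signl.
Qed.

Lemma fischer_ge0 psi : 0 <= fischer psi psi.
Proof. by rewrite sumr_ge0// => I _; rewrite pform_ge0. Qed.

Lemma fischer_eq0 psi : fischer psi psi = 0 -> psi = 0.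
Proof.
move=> /eqP; rewrite psumr_eq0 => [/allP H|I _]; last exact: pform_ge0.
apply/ffunP => I; rewrite ffunE; apply: pform_eq0; apply/eqP.
by apply: (H I); rewrite mem_index_enum.
Qed.

Lemma fischer0l chi : fischer 0 chi = 0.
Proof. by rewrite -(scale0r chi) -mpolyC0 fischerCl mul0r. Qed.

Lemma fischerNl psi chi : fischer (- psi) chi = - fischer psi chi.
Proof. by apply/eqP; rewrite -addr_eq0 -fischerDl addNr fischer0l. Qed.

Lemma fischerBl psi psi' chi : fischer (psi - psi') chi = fischer psi chi - fischer psi' chi.
Proof. by rewrite fischerDl fischerNl. Qed.

Lemma fischer0r chi : fischer chi 0 = 0.
Proof. by rewrite fischer_sym fischer0l rmorph0. Qed.

Lemma fischerDr psi psi' chi : fischer chi (psi + psi') = fischer chi psi + fischer chi psi'.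
Proof. by rewrite fischer_sym fischerDl rmorphD /= -!fischer_sym. Qed.

Lemma fischerZl c psi chi : fischer (c%:R *: psi) chi = c%:R * fischer psi chi.
Proof. by rewrite -fischerCl mpolyC_nat. Qed.

Lemma fischer_suml (I : Type) (r : seq I) (Q : pred I) (F : I -> K) chi :
  fischer (\sum_(i <- r | Q i) F i) chi = \sum_(i <- r | Q i) fischer (F i) chi.
Proof. by elim/big_rec2: _ => [|i x y _ <-]; rewrite ?fischer0l ?fischerDl. Qed.

Lemma fischer_sumr (I : Type) (r : seq I) (Q : pred I) (F : I -> K) chi :
  fischer chi (\sum_(i <- r | Q i) F i) = \sum_(i <- r | Q i) fischer chi (F i).
Proof. by elim/big_rec2: _ => [|i x y _ <-]; rewrite ?fischer0r ?fischerDr. Qed.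

Definition adjoint (f h : K -> K) := forall psi chi, fischer (f psi) chi = fischer psi (h chi).

Lemma adjoint_sym f h : adjoint f h -> adjoint h f.
Proof. by move=> H psi chi; rewrite fischer_sym -H -fischer_sym. Qed.

Definition subsp (W : K -> Prop) := [/\ W 0, forall x y, W x -> W y -> W (x + y)
  & forall c x, W x -> W (mpolyC N c *: x)].

Lemma subspN W x : subsp W -> W x -> W (- x).
Proof. by move=> [_ _ WZ] /(WZ (-1)); rewrite mpolyCN mpolyC1 scaleN1r. Qed.

Lemma subspB W x y : subsp W -> W x -> W y -> W (x - y).
Proof. by move=> WS Wx /(subspN WS); case: WS => _ WD _; apply: WD. Qed.

(** Gram-Schmidt for a space on which the finitely many coefficients listed in s are jointly
    injective: the induction on s cuts W down to the kernel of one coefficient, which loses at most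
    one dimension. *)
Lemma projection_sep (s : seq ({set 'I_n} * multinom N)) W : subsp W ->
  (forall x, W x -> (forall I m, (I, m) \in s -> mcoeff m (x I) = 0) -> x = 0) ->
  forall psi, exists2 w, W w & forall x, W x -> fischer (psi - w) x = 0.
Proof.
elim: s W => [|[I m] s IH] W WS sep psi.
  exists 0; first by case: WS.
  by move=> w' Ww'; rewrite (sep _ Ww') ?fischer0r.
pose W0 x := W x /\ mcoeff m (x I) = 0.
have [W_0 WD WZ] := WS.
have W0S : subsp W0.
  split; first by split; rewrite // ffunE mcoeff0.
    by move=> x y [Wx x0] [Wy y0]; split; [exact: WD|rewrite ffunE mcoeffD x0 y0 addr0].
  move=> c x [Wx x0]; split; first exact: WZ.
  by rewrite polyformZE mcoeffCM x0 mulr0.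
have {}IH := IH W0 W0S.
have /IH {}IH : forall x, W0 x ->
    (forall I m, (I, m) \in s -> mcoeff m (x I) = 0) -> x = 0.
  move=> x [Wx x0] xs; apply: sep => // I' m'; rewrite inE.
  by case/orP => [/eqP[-> ->]//|]; apply: xs.
have [[w1 [Ww1 w10]]|W_W0] := pselect (exists w, W w /\ mcoeff m (w I) <> 0); last first.
  have [w [Ww _] wP] := IH psi; exists w => // w' Ww'; apply: wP; split=> //.
  by have [//|H] := pselect (mcoeff m (w' I) = 0); case: W_W0; exists w'.
have [w2 [Ww2 w20] w2P] := IH w1.
(* The component of w1 orthogonal to the kernel [W0]; W is spanned by [W0] and e. *)
pose e := w1 - w2.
have We : W e by apply: subspB.
have e0 : mcoeff m (e I) <> 0 by rewrite !ffunE mcoeffB w20 subr0.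
have ee : fischer e e != 0.
  by apply/eqP => /fischer_eq0 E; apply: e0; rewrite E ffunE mcoeff0.
have eP x : W0 x -> fischer e x = 0 by apply: w2P.
clearbody e; have [w3 [Ww3 w30] w3P] := IH psi.
pose c := fischer psi e / fischer e e.
exists (w3 + mpolyC N c *: e); first by apply: WD => //; apply: WZ.
move=> w' Ww'.
(* This multiple of e carries the whole coefficient of w', so that w' splits into a part in [W0] and
   a part along e. *)
pose d := mcoeff m (w' I) / mcoeff m (e I).
have W0w' : W0 (w' - mpolyC N d *: e).
  split; first by apply: subspB => //; apply: WZ.
  by rewrite !ffunE polyformZE mcoeffB mcoeffCM /d mulfVK ?subrr//; apply/eqP.
rewrite -[w'](subrK (mpolyC N d *: e)) fischerDr.
have -> : fischer (psi - (w3 + mpolyC N c *: e)) (w' - mpolyC N d *: e) = 0.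
  by rewrite opprD addrA fischerBl w3P// fischerCl eP// mulr0 subr0.
rewrite add0r fischer_sym fischerCl (_ : fischer e _ = 0) ?mulr0 ?rmorph0//.
rewrite fischer_sym opprD addrA !fischerBl fischerCl /c mulfVK//.
rewrite (_ : fischer w3 e = 0) ?subr0 ?subrr ?rmorph0//.
by rewrite fischer_sym eP ?rmorph0.
Qed.

Lemma projection D W : subsp W -> (forall x, W x -> dlt D x) ->
  forall psi, exists2 w, W w & forall x, W x -> fischer (psi - w) x = 0.
Proof.
(* Finitely many monomials have degree below D, and their coefficients separate the elements of
   W. *)
move=> WS WD; pose s := [seq (Im.1, bmnm Im.2) |
  Im <- enum (predT : pred ({set 'I_n} * bmultinom N D)%type)].
apply: (projection_sep (s := s)) => // x Wx xs; apply/ffunP => I.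
apply/mpolyP => m; rewrite ffunE mcoeff0.
have [mD|mD] := leqP D (mdeg m); first exact: WD.
by apply: xs; apply/mapP; exists (I, BMultinom mD); rewrite ?mem_enum.
Qed.

(* The orthogonal complement of the image of a family of operators is the
   common kernel of their adjoints. *)
Lemma adjoint_decomposition (I : finType) (U : K -> Prop) (D : nat)
    (f h : I -> {additive K -> K}) :
  subsp U -> (forall i, adjoint (f i) (h i)) ->
  (forall i c x, f i (mpolyC N c *: x) = mpolyC N c *: f i x) ->
  (forall i c x, h i (mpolyC N c *: x) = mpolyC N c *: h i x) ->
  (forall i x, U x -> U (f i (h i x))) ->
  (forall i x, dlt D x -> dlt D (f i (h i x))) ->
  forall psi, U psi -> dlt D psi -> exists w, exists u,
    [/\ U w /\ dlt D w, U u /\ dlt D u, psi = \sum_i f i (h i w) + u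
      & forall i, h i u = 0].
Proof.
move=> US fh fZ hZ Ufh Dfh psi Upsi Dpsi.
(* B preserves the bound D, so its image on such forms admits an orthogonal projection. *)
pose B x := \sum_i f i (h i x).
have UB x : U x -> U (B x).
  move=> Ux; rewrite /B; elim/big_rec: _ => [|i y _ Uy]; first by case: US.
  by case: US => _ UD _; apply: UD => //; apply: Ufh.
have DB x : dlt D x -> dlt D (B x) by move=> Dx; apply: dlt_sum => i _; apply: Dfh.
have BD x y : B (x + y) = B x + B y.
  by rewrite /B -big_split; apply: eq_bigr => i _; rewrite !raddfD.
have BZ c x : B (mpolyC N c *: x) = mpolyC N c *: B x.
  by rewrite /B scaler_sumr; apply: eq_bigr => i _; rewrite hZ fZ.
pose W x := exists2 y, U y /\ dlt D y & x = B y.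
have [U0 UD UZ] := US.
have WS : subsp W.
  split.
  - exists 0; first by split=> //; apply: dlt0.
    by rewrite /B big1// => i _; rewrite !raddf0.
  - move=> _ _ [y [Uy Dy] ->] [z [Uz Dz] ->]; exists (y + z); last by rewrite BD.
    by split; [exact: UD|exact: dltD].
  - move=> c _ [y [Uy Dy] ->]; exists (mpolyC N c *: y); last by rewrite BZ.
    by split; [exact: UZ|exact: dltZ].
have WD x : W x -> dlt D x by move=> [y [_ Dy] ->]; apply: DB.
have [_ [w [Uw Dw] ->] wP] := projection WS WD psi.
have Uu : U (psi - B w) by apply: subspB => //; apply: UB.
have Du : dlt D (psi - B w) by apply: dltD => //; apply/dltN/DB.
exists w, (psi - B w); split=> //; first by rewrite addrC subrK.
(* The remainder u is orthogonal to B u, and this inner product is the sum of the squared norms of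
   the h_i u. *)
move=> i; apply: fischer_eq0; apply/eqP.
have : fischer (psi - B w) (B (psi - B w)) = 0 by apply: wP; exists (psi - B w).
set u := psi - B w; rewrite fischer_sumr => /eqP.
under eq_bigr do rewrite fischer_sym fh.
rewrite psumr_eq0 => [/allP /(_ i)|j _]; last by rewrite conjC_ge0 fischer_ge0.
by rewrite mem_index_enum conjC_eq0 => /(_ isT).
Qed.

End Fischer.

(** * Operators on polynomial forms *)

HB.lock Definition xvar n k (a : 'I_n) (j : 'I_k) : 'I_((n + 1) * k) :=
  mxvec_index (lshift 1 a) j.
HB.lock Definition tvar n k (j : 'I_k) : 'I_((n + 1) * k) :=
  mxvec_index (rshift n 0) j.

Lemma mderiv_var (C : comNzRingType) N (v w : 'I_N) : mderiv v (mpolyX C (mnm1 w)) = (v == w)%:R :> mpoly N C.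
Proof.
rewrite mderivX mnm1E eq_sym; have [->|_] := eqVneq v w; last by rewrite scale0r.
rewrite scale1r (_ : mnm_sub _ _ = mnm0) ?mpolyX0//.
by apply/mnmP => i; rewrite mnmBE subnn mnm0E.
Qed.

Section Operators.
Variables (C : numClosedFieldType) (n k : nat).
Local Notation N := ((n + 1) * k)%N.
Local Notation P := (mpoly N C).
Local Notation K := (polyform C N n).
Implicit Types (a b : 'I_n) (i j : 'I_k) (psi chi u : K) (p : P).

Lemma mxvec_index_eq m l (i i' : 'I_m) (j j' : 'I_l) :
  (mxvec_index i j == mxvec_index i' j') = (i == i') && (j == j').
Proof.
apply/eqP/andP => [/cast_ord_inj/enum_rank_inj[-> ->]|[/eqP-> /eqP->]//].
by rewrite !eqxx.
Qed.

Lemma xvar_eq a b i j : (xvar a i == xvar b j) = (a == b) && (i == j).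
Proof. by rewrite unlock mxvec_index_eq (inj_eq (@lshift_inj _ _)). Qed.

Lemma tvar_eq i j : (tvar n i == tvar n j) = (i == j).
Proof. by rewrite unlock mxvec_index_eq eqxx. Qed.

Lemma xvar_tvar a i j : (xvar a i == tvar n j) = false.
Proof. by rewrite !unlock mxvec_index_eq eq_lrshift. Qed.

Lemma var_ind (Q : 'I_N -> Prop) :
  (forall a j, Q (xvar a j)) -> (forall j, Q (tvar n j)) -> forall v, Q v.
Proof.
move=> Qx Qt v; case/mxvec_indexP: v => i j.
case: (split_ordP i) => [a ->|z ->].
  by have := Qx a j; rewrite unlock.
by rewrite (ord1 z); have := Qt j; rewrite unlock.
Qed.

Definition xpol a j : P := mpolyX C (mnm1 (xvar a j)).
Definition tpol j : P := mpolyX C (mnm1 (tvar n j)).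
Definition xmat : 'M[P]_(n, k) := \matrix_(a, j) xpol a j.

Definition dx a j : K -> K := pderiv (xvar a j).
Definition dt j : K -> K := pderiv (tvar n j).
HB.instance Definition _ a j := GRing.Additive.on (dx a j).
HB.instance Definition _ j := GRing.Additive.on (dt j).

Lemma dxD a j : {morph dx a j : x y / x + y}.
Proof. exact: raddfD. Qed.

Lemma dxB a j : {morph dx a j : x y / x - y}.
Proof. exact: raddfB. Qed.

Lemma dx0 a j : dx a j (0 : K) = 0.
Proof. exact: raddf0. Qed.

Lemma dx_sum a j (I : finType) (F : I -> K) :
  dx a j (\sum_i F i) = \sum_i dx a j (F i).
Proof. exact: raddf_sum. Qed.

Lemma dtD j : {morph dt j : x y / x + y}.
Proof. exact: raddfD. Qed.

Lemma dtB j : {morph dt j : x y / x - y}.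
Proof. exact: raddfB. Qed.

Lemma dt0 j : dt j (0 : K) = 0.
Proof. exact: raddf0. Qed.

Lemma dt_sum j (I : finType) (F : I -> K) :
  dt j (\sum_i F i) = \sum_i dt j (F i).
Proof. exact: raddf_sum. Qed.

Lemma dxx a j b i psi : dx a j (xpol b i *: psi) =
  ((a == b) && (j == i))%:R *: psi + xpol b i *: dx a j psi.
Proof. by rewrite /dx pderivM mderiv_var xvar_eq. Qed.

Lemma dxt a j i psi : dx a j (tpol i *: psi) = tpol i *: dx a j psi.
Proof. by rewrite /dx pderivM mderiv_var xvar_tvar scale0r add0r. Qed.

Lemma dtx a j i psi : dt j (xpol a i *: psi) = xpol a i *: dt j psi.
Proof. by rewrite /dt pderivM mderiv_var eq_sym xvar_tvar scale0r add0r. Qed.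

Lemma dtt j i psi : dt j (tpol i *: psi) =
  (j == i)%:R *: psi + tpol i *: dt j psi.
Proof. by rewrite /dt pderivM mderiv_var tvar_eq. Qed.

Definition eta_op j : K -> K := rot_op xmat (@fmul C N n) j.
Definition iot_op j : K -> K := rot_op xmat (@fcontract C N n) j.
HB.instance Definition _ j := GRing.isLinear.Build P K K *:%R (eta_op j)
  (rot_op_linear xmat (fun a => @fmul C N n a : {linear K -> K}) j).
HB.instance Definition _ j := GRing.isLinear.Build P K K *:%R (iot_op j)
  (rot_op_linear xmat (fun a => @fcontract C N n a : {linear K -> K}) j).
(** Its entries are the invariants r_ij. *)
Definition gram : 'M[P]_k := xmat^T *m xmat.

Lemma etaE j psi : eta_op j psi = \sum_a xpol a j *: fmul a psi.
Proof. by apply: eq_bigr => a _; rewrite mxE. Qed.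

Lemma iotE j psi : iot_op j psi = \sum_a xpol a j *: fcontract a psi.
Proof. by apply: eq_bigr => a _; rewrite mxE. Qed.

Lemma gramE i j : gram i j = \sum_a xpol a i * xpol a j.
Proof. by rewrite mxE; apply: eq_bigr => a _; rewrite !mxE. Qed.

Lemma eta_opD j : {morph eta_op j : x y / x + y}.
Proof. exact: raddfD. Qed.

Lemma eta_opB j : {morph eta_op j : x y / x - y}.
Proof. exact: raddfB. Qed.

Lemma eta_op0 j : eta_op j (0 : K) = 0.
Proof. exact: raddf0. Qed.

Lemma eta_op_sum j (I : finType) (F : I -> K) :
  eta_op j (\sum_i F i) = \sum_i eta_op j (F i).
Proof. exact: raddf_sum. Qed.

Lemma eta_opZ j c psi : eta_op j (c *: psi) = c *: eta_op j psi.
Proof. exact: linearZ. Qed.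

Lemma iot_opD j : {morph iot_op j : x y / x + y}.
Proof. exact: raddfD. Qed.

Lemma iot_opB j : {morph iot_op j : x y / x - y}.
Proof. exact: raddfB. Qed.

Lemma iot_op0 j : iot_op j (0 : K) = 0.
Proof. exact: raddf0. Qed.

Lemma iot_op_sum j (I : finType) (F : I -> K) :
  iot_op j (\sum_i F i) = \sum_i iot_op j (F i).
Proof. exact: raddf_sum. Qed.

Lemma iot_opZ j c psi : iot_op j (c *: psi) = c *: iot_op j psi.
Proof. exact: linearZ. Qed.

Lemma eta_anticommuting : anticommuting eta_op.
Proof.
apply: (rot_op_anticommuting xmat (op := fun a => @fmul C N n a : {linear K -> K})).
exact: fmul_anticommuting.
Qed.

Lemma iot_anticommuting : anticommuting iot_op.
Proof.
apply: (rot_op_anticommuting xmat (op := fun a => @fcontract C N n a : {linear K -> K})).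
exact: fcontract_anticommuting.
Qed.

Lemma dx_mul a j b psi : dx a j (fmul b psi) = fmul b (dx a j psi).
Proof. exact: pderiv_fmul. Qed.

Lemma dx_contract a j b psi : dx a j (fcontract b psi) = fcontract b (dx a j psi).
Proof. exact: pderiv_fcontract. Qed.

Lemma dt_mul j b psi : dt j (fmul b psi) = fmul b (dt j psi).
Proof. exact: pderiv_fmul. Qed.

Lemma dxC a i b j psi : dx a i (dx b j psi) = dx b j (dx a i psi).
Proof. exact: pderivC. Qed.

Lemma dtC i j psi : dt i (dt j psi) = dt j (dt i psi).
Proof. exact: pderivC. Qed.

Lemma dxtC a i j psi : dx a i (dt j psi) = dt j (dx a i psi).
Proof. exact: pderivC. Qed.

Lemma mul_eta a j psi : fmul a (eta_op j psi) = - eta_op j (fmul a psi).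
Proof.
rewrite !etaE fmul_sum -sumrN; apply: eq_bigr => b _.
by rewrite fmulZ fmul_anti scalerN.
Qed.

Lemma contract_eta a j psi :
  fcontract a (eta_op j psi) = xpol a j *: psi - eta_op j (fcontract a psi).
Proof.
rewrite !etaE fcontract_sum; under eq_bigr do rewrite fcontractZ fcontract_mul scalerBr.
rewrite sumrB; congr (_ - _); rewrite (bigD1 a)//= big1 ?addr0 ?eqxx ?scale1r//.
by move=> b ba; rewrite eq_sym (negPf ba) scale0r scaler0.
Qed.

Lemma iot_eta i j psi :
  iot_op i (eta_op j psi) = gram i j *: psi - eta_op j (iot_op i psi).
Proof.
rewrite iotE; under eq_bigr do rewrite contract_eta scalerBr scalerA.
rewrite sumrB -scaler_suml -gramE iotE eta_op_sum; congr (_ - _).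
by apply: eq_bigr => a _; rewrite eta_opZ.
Qed.

Lemma dx_eta a i j psi :
  dx a i (eta_op j psi) = (i == j)%:R *: fmul a psi + eta_op j (dx a i psi).
Proof.
rewrite !etaE dx_sum.
under eq_bigr do rewrite dxx dx_mul.
rewrite big_split; congr (_ + _); rewrite (bigD1 a)//= big1 ?addr0 ?eqxx//.
by move=> b ba; rewrite eq_sym (negPf ba) scale0r.
Qed.

Lemma dt_eta i j psi : dt i (eta_op j psi) = eta_op j (dt i psi).
Proof.
rewrite !etaE dt_sum; apply: eq_bigr => a _.
by rewrite dtx dt_mul.
Qed.

(** Three Fischer adjoints: [del_op] of [eta_op], [eps_op] of [iot_op], and [lap_op] of
    multiplication by an entry of [gram]. The polarised Euler operators [eul_op] arise in the
    anticommutator of [del_op] and [eta_op]. *)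
Definition del_op j psi : K := \sum_a fcontract a (dx a j psi).
Definition eps_op j psi : K := \sum_a fmul a (dx a j psi).
Definition lap_op i j psi : K := \sum_a dx a i (dx a j psi).
Definition eul_op i j psi : K := \sum_a xpol a i *: dx a j psi.
(** Infinitesimal rotation of the coordinates in the plane of a and b; [lie] adds the rotation of
    the omega's and is the Lie derivative on forms. *)
Definition rotl a b psi : K :=
  \sum_i (xpol a i *: dx b i psi - xpol b i *: dx a i psi).
Definition lie a b psi : K :=
  rotl a b psi + (fmul a (fcontract b psi) - fmul b (fcontract a psi)).

Fact del_zmod j : zmod_morphism (del_op j).
Proof. by move=> x y; rewrite /del_op -sumrB; apply: eq_bigr => a _; rewrite !raddfB. Qed.
Fact eps_zmod j : zmod_morphism (eps_op j).
Proof. by move=> x y; rewrite /eps_op -sumrB; apply: eq_bigr => a _; rewrite !raddfB. Qed.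
Fact lap_zmod i j : zmod_morphism (lap_op i j).
Proof. by move=> x y; rewrite /lap_op -sumrB; apply: eq_bigr => a _; rewrite !raddfB. Qed.
Fact eul_zmod i j : zmod_morphism (eul_op i j).
Proof.
move=> x y; rewrite /eul_op -sumrB; apply: eq_bigr => a _.
by rewrite raddfB scalerBr.
Qed.
HB.instance Definition _ j := GRing.isZmodMorphism.Build K K (del_op j) (del_zmod j).
HB.instance Definition _ j := GRing.isZmodMorphism.Build K K (eps_op j) (eps_zmod j).
HB.instance Definition _ i j := GRing.isZmodMorphism.Build K K (lap_op i j) (lap_zmod i j).
HB.instance Definition _ i j := GRing.isZmodMorphism.Build K K (eul_op i j) (eul_zmod i j).

Lemma del_opD j : {morph del_op j : x y / x + y}.
Proof. exact: raddfD. Qed.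

Lemma del_opB j : {morph del_op j : x y / x - y}.
Proof. exact: raddfB. Qed.

Lemma del_op0 j : del_op j (0 : K) = 0.
Proof. exact: raddf0. Qed.

Lemma del_op_sum j (I : finType) (F : I -> K) :
  del_op j (\sum_i F i) = \sum_i del_op j (F i).
Proof. exact: raddf_sum. Qed.

Lemma eps_opD j : {morph eps_op j : x y / x + y}.
Proof. exact: raddfD. Qed.

Lemma eps_opB j : {morph eps_op j : x y / x - y}.
Proof. exact: raddfB. Qed.

Lemma eps_op_sum j (I : finType) (F : I -> K) :
  eps_op j (\sum_i F i) = \sum_i eps_op j (F i).
Proof. exact: raddf_sum. Qed.

Lemma lap_opB i j : {morph lap_op i j : x y / x - y}.
Proof. exact: raddfB. Qed.

Lemma eps_eta i j psi : eps_op i (eta_op j psi) = - eta_op j (eps_op i psi).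
Proof.
rewrite /eps_op eta_op_sum -sumrN; apply: eq_bigr => a _.
by rewrite dx_eta fmulD fmulZ fmul_sq scaler0 add0r mul_eta.
Qed.

(** The derivative either falls on eta_i, and then contracting omega_a against itself counts n - l,
    or it passes through, and then contracting eta_i leaves an Euler operator. *)
Lemma del_eta l i j psi : hdeg l psi -> del_op j (eta_op i psi) =
  eul_op i j psi + (i == j)%:R *: ((n%:R - l%:R) *: psi) - eta_op i (del_op j psi).
Proof.
move=> H; rewrite /del_op eta_op_sum.
under eq_bigr => a _ do rewrite dx_eta fcontractD fcontractZ contract_eta addrA.
rewrite sumrB; congr (_ - _).
rewrite [LHS]big_split [RHS]addrC /=; congr (_ + _).
by rewrite -(sum_fcontract_mul H) scaler_sumr; apply: eq_bigr => a _; rewrite eq_sym.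
Qed.

Lemma sum_antisym (I : finType) (F : I -> I -> K) :
  (forall s t, F s t = - F t s) -> \sum_s \sum_t F s t = 0.
Proof.
move=> FA; set S := LHS.
have S2 : S = - S.
  rewrite {1}/S exchange_big -sumrN; apply: eq_bigr => s _; rewrite -sumrN.
  by apply: eq_bigr => t _.
have : mpolyC N (2%:R : C) *: S = 0.
  by rewrite mpolyC_nat scaler_nat mulr2n {1}S2 addNr.
move=> /(congr1 (fun z => mpolyC N (2%:R^-1 : C) *: z)).
by rewrite scalerA -mpolyCM mulVf ?pnatr_eq0// mpolyC1 scale1r scaler0.
Qed.

End Operators.
Arguments xpol {C n k}.
Arguments tpol {C n k}.
Arguments xmat {C n k}.
Arguments gram {C n k}.

(** * Consequences of infinitesimal invariance *)

Section Operators.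
Variables (C : numClosedFieldType) (n k : nat).
Local Notation N := ((n + 1) * k)%N.
Local Notation P := (mpoly N C).
Local Notation K := (polyform C N n).
Implicit Types (a b : 'I_n) (i j : 'I_k) (psi chi u : K) (p : P).

(** Multiply the invariance relation for a and b by omega_a and sum over a. Since eta_i u = 0, the
    terms x_ai omega_a d/dx_bi give -omega_b u for each of the k values of i, while omega_a times
    the contraction by a counts the degree l. *)
Lemma lie_mul_sum l u : (forall a b, lie a b u = 0) -> hdeg l u ->
  (forall j, eta_op j u = 0) ->
  forall b, (l%:R - k%:R) *: fmul b u = \sum_i xpol b i *: eps_op i u.
Proof.
move=> L H E b.
have etadx i : eta_op i (dx b i u) = - fmul b u.
  apply/eqP; rewrite -addr_eq0 addrC; apply/eqP.
  by rewrite -[fmul b u]scale1r -[1]/(true%:R) -(eqxx i) -dx_eta E dx0.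
have mulL a : fmul a (lie a b u) =
    \sum_i (xpol a i *: fmul a (dx b i u) - xpol b i *: fmul a (dx a i u))
    + fmul b (fmul a (fcontract a u)).
  rewrite /lie fmulD fmulB fmul_sq sub0r.
  rewrite -[- fmul a (fmul b _)]fmul_anti; congr (_ + _).
  rewrite /rotl fmul_sum; apply: eq_bigr => i _.
  by rewrite fmulB !fmulZ.
have : \sum_a fmul a (lie a b u) = 0.
  by rewrite big1// => a _; rewrite L fmul0.
under eq_bigr do rewrite mulL.
rewrite big_split -fmul_sum (sum_fmul_contract H) fmulZ exchange_big /=.
under eq_bigr do rewrite sumrB -etaE etadx -scaler_sumr.
rewrite sumrB sumr_const card_ord => /eqP.
rewrite addrAC addr_eq0 opprK => /eqP <-.
by rewrite scalerBl [k%:R *: _]scaler_nat mulNrn addrC.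
Qed.

(** The divergence of the rotation part. The constant collects 1 for each a, minus 1 from a = b,
    minus k from moving the derivatives d/dx_bi in front of the Euler operators. *)
Lemma dx_rotl_sum u b j : (forall i, lap_op j i u = 0) ->
  \sum_a dx a j (rotl a b u) =
  (n%:R - k%:R - 1) *: dx b j u + \sum_i dx b i (eul_op i j u).
Proof.
move=> Lap.
have -> : \sum_i dx b i (eul_op i j u) =
    k%:R *: dx b j u + \sum_i \sum_a xpol a i *: dx a j (dx b i u).
  rewrite scaler_nat -[X in _ *+ X]card_ord -sumr_const -big_split.
  apply: eq_bigr => i _; rewrite dx_sum.
  under eq_bigr do rewrite dxx eqxx andbT dxC.
  rewrite big_split; congr (_ + _); rewrite (bigD1 b)//= big1 ?addr0 ?eqxx ?scale1r//.
  by move=> a ab; rewrite eq_sym (negPf ab) scale0r.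
have dxL a : dx a j (rotl a b u) =
    dx b j u - (a == b)%:R *: dx a j u +
    \sum_i (xpol a i *: dx a j (dx b i u) - xpol b i *: dx a j (dx a i u)).
  rewrite dx_sum; under eq_bigr do rewrite dxB !dxx eqxx /= opprD addrACA.
  rewrite big_split; congr (_ + _); rewrite sumrB; congr (_ - _).
    rewrite (bigD1 j)//= big1 ?addr0 ?eqxx ?scale1r// => i ij.
    by rewrite [j == i]eq_sym (negPf ij) scale0r.
  rewrite (bigD1 j)//= big1 ?addr0 ?eqxx ?andbT// => i ij.
  by rewrite [j == i]eq_sym (negPf ij) andbF scale0r.
under eq_bigr do rewrite dxL.
rewrite big_split sumrB sumr_const card_ord /=.
have -> : \sum_a (a == b)%:R *: dx a j u = dx b j u.
  rewrite (bigD1 b)//= big1 ?addr0 ?eqxx ?scale1r// => a ab.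
  by rewrite (negPf ab) scale0r.
rewrite exchange_big /=; under eq_bigr do rewrite sumrB -scaler_sumr.
rewrite sumrB [X in _ + (_ - X)]big1 => [|i _]; last first.
  by rewrite -/(lap_op j i u) Lap scaler0.
rewrite subr0 addrA; congr (_ + _).
by rewrite !scalerBl scale1r addrAC subrK scaler_nat.
Qed.

(** The divergence of the form part of the Lie derivative is exactly d/dx_bj u, because [del_op] and
    [eps_op] kill u; it cancels the -1 of [dx_rotl_sum]. *)
Lemma dx_eul_sum u : (forall a b, lie a b u = 0) ->
  (forall i j, lap_op i j u = 0) -> (forall j, del_op j u = 0) ->
  (forall j, eps_op j u = 0) -> forall b j,
  (n%:R - k%:R) *: dx b j u + \sum_i dx b i (eul_op i j u) = 0.
Proof.
move=> L Lap Del Eps b j.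
have : \sum_a dx a j (lie a b u) = 0.
  by rewrite big1// => a _; rewrite L dx0.
rewrite /lie; under eq_bigr do rewrite dxD.
rewrite big_split /= dx_rotl_sum//.
have -> : \sum_a dx a j (fmul a (fcontract b u) - fmul b (fcontract a u)) = dx b j u.
  under eq_bigr do rewrite dxB !dx_mul !dx_contract.
  rewrite sumrB -fmul_sum -/(del_op j u) Del fmul0 subr0.
  transitivity (\sum_a ((b == a)%:R *: dx a j u - fcontract b (fmul a (dx a j u)))).
    by apply: eq_bigr => a _; rewrite fcontract_mul opprB addrC subrK.
  rewrite sumrB -fcontract_sum -/(eps_op j u) Eps fcontract0 subr0.
  rewrite (bigD1 b)//= big1 ?addr0 ?eqxx ?scale1r// => a ab.
  by rewrite eq_sym (negPf ab) scale0r.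
by rewrite scalerBl scale1r addrAC subrK.
Qed.

End Operators.

(** * The differential and its Koszul part *)

Section Operators.
Variables (C : numClosedFieldType) (n k : nat).
Local Notation N := ((n + 1) * k)%N.
Local Notation P := (mpoly N C).
Local Notation K := (polyform C N n).
Implicit Types (a b : 'I_n) (i j : 'I_k) (psi chi u : K) (p : P).

Lemma eta_anti i j psi : eta_op i (eta_op j psi) = - eta_op j (eta_op i psi).
Proof. by have [H _] := eta_anticommuting C n k; apply: H. Qed.

Lemma eta_sq i psi : eta_op i (eta_op i psi) = 0.
Proof. by have [_ H] := eta_anticommuting C n k; apply: H. Qed.

Lemma eps_anti i j psi : eps_op i (eps_op j psi) = - eps_op j (eps_op i psi).
Proof.
rewrite /eps_op; under eq_bigr do rewrite dx_sum fmul_sum.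
under [in RHS]eq_bigr do rewrite dx_sum fmul_sum.
rewrite exchange_big -sumrN; apply: eq_bigr => a _; rewrite -sumrN.
by apply: eq_bigr => b _; rewrite !dx_mul dxC fmul_anti.
Qed.

Lemma eps_tpol i j psi : eps_op i (tpol j *: psi) = tpol j *: eps_op i psi.
Proof.
rewrite /eps_op scaler_sumr; apply: eq_bigr => a _.
by rewrite dxt fmulZ.
Qed.

Lemma dt_eps i j psi : dt i (eps_op j psi) = eps_op j (dt i psi).
Proof.
rewrite /eps_op dt_sum; apply: eq_bigr => a _.
by rewrite dt_mul -dxtC.
Qed.

Lemma del_tpol i j psi : del_op i (tpol j *: psi) = tpol j *: del_op i psi.
Proof.
rewrite /del_op scaler_sumr; apply: eq_bigr => a _.
by rewrite dxt fcontractZ.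
Qed.

(** [koszul] and [koszul_adj] are T and its adjoint, [dd] is d', and [ddt] is the part of d' that
    preserves the polynomial degree. *)
Definition koszul psi : K := \sum_j tpol j *: eta_op j psi.
Definition koszul_adj psi : K := \sum_j del_op j (dt j psi).
Definition ddt psi : K := \sum_j (eta_op j (dt j psi) + tpol j *: eps_op j psi).
Definition dd psi : K := ddt psi - 2%:R *: koszul psi.

Fact koszul_zmod : zmod_morphism koszul.
Proof.
by move=> x y; rewrite /koszul -sumrB; apply: eq_bigr => j _; rewrite eta_opB scalerBr.
Qed.
Fact koszul_adj_zmod : zmod_morphism koszul_adj.
Proof.
by move=> x y; rewrite /koszul_adj -sumrB; apply: eq_bigr => j _; rewrite dtB del_opB.
Qed.
Fact ddt_zmod : zmod_morphism ddt.
Proof.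
move=> x y; rewrite /ddt -sumrB; apply: eq_bigr => j _.
by rewrite dtB eta_opB eps_opB scalerBr opprD addrACA.
Qed.
HB.instance Definition _ := GRing.isZmodMorphism.Build K K koszul koszul_zmod.
HB.instance Definition _ := GRing.isZmodMorphism.Build K K koszul_adj koszul_adj_zmod.
HB.instance Definition _ := GRing.isZmodMorphism.Build K K ddt ddt_zmod.

Lemma koszulD  : {morph koszul  : x y / x + y}.
Proof. exact: raddfD. Qed.

Lemma koszulB  : {morph koszul  : x y / x - y}.
Proof. exact: raddfB. Qed.

Lemma koszul0  : koszul  (0 : K) = 0.
Proof. exact: raddf0. Qed.

Lemma koszul_sum  (I : finType) (F : I -> K) :
  koszul  (\sum_s F s) = \sum_s koszul  (F s).
Proof. exact: raddf_sum. Qed.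

Lemma koszul_adjD  : {morph koszul_adj  : x y / x + y}.
Proof. exact: raddfD. Qed.

Lemma koszul_adjB  : {morph koszul_adj  : x y / x - y}.
Proof. exact: raddfB. Qed.

Lemma koszul_adj0  : koszul_adj  (0 : K) = 0.
Proof. exact: raddf0. Qed.

Lemma ddtD  : {morph ddt  : x y / x + y}.
Proof. exact: raddfD. Qed.

Lemma ddtB  : {morph ddt  : x y / x - y}.
Proof. exact: raddfB. Qed.

Lemma ddt0  : ddt  (0 : K) = 0.
Proof. exact: raddf0. Qed.

Lemma koszulZ p psi : koszul (p *: psi) = p *: koszul psi.
Proof.
rewrite /koszul scaler_sumr; apply: eq_bigr => j _.
by rewrite eta_opZ !scalerA mulrC.
Qed.

Fact dd_zmod : zmod_morphism dd.
Proof.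
by move=> x y; rewrite /dd ddtB koszulB scalerBr !opprD !opprK addrACA.
Qed.
HB.instance Definition _ := GRing.isZmodMorphism.Build K K dd dd_zmod.

Lemma ddD  : {morph dd  : x y / x + y}.
Proof. exact: raddfD. Qed.

Lemma ddB  : {morph dd  : x y / x - y}.
Proof. exact: raddfB. Qed.

Lemma dd0  : dd  (0 : K) = 0.
Proof. exact: raddf0. Qed.

Lemma pderiv_Cz v (c : C) psi :
  pderiv v (mpolyC N c *: psi) = mpolyC N c *: pderiv v psi.
Proof. by rewrite pderivM mderivC scale0r add0r. Qed.

Lemma dx_C a j c psi : dx a j (mpolyC N c *: psi) = mpolyC N c *: dx a j psi.
Proof. exact: pderiv_Cz. Qed.

Lemma dt_C j c psi : dt j (mpolyC N c *: psi) = mpolyC N c *: dt j psi.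
Proof. exact: pderiv_Cz. Qed.

Lemma del_C j c psi : del_op j (mpolyC N c *: psi) = mpolyC N c *: del_op j psi.
Proof.
rewrite /del_op scaler_sumr; apply: eq_bigr => a _.
by rewrite dx_C fcontractZ.
Qed.

Lemma eps_C j c psi : eps_op j (mpolyC N c *: psi) = mpolyC N c *: eps_op j psi.
Proof.
rewrite /eps_op scaler_sumr; apply: eq_bigr => a _.
by rewrite dx_C fmulZ.
Qed.

Lemma lap_C i j c psi :
  lap_op i j (mpolyC N c *: psi) = mpolyC N c *: lap_op i j psi.
Proof. by rewrite /lap_op scaler_sumr; apply: eq_bigr => a _; rewrite !dx_C. Qed.

Lemma koszul_adj_C c psi :
  koszul_adj (mpolyC N c *: psi) = mpolyC N c *: koszul_adj psi.
Proof.
by rewrite /koszul_adj scaler_sumr; apply: eq_bigr => j _; rewrite dt_C del_C.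
Qed.

Lemma dd_C c psi : dd (mpolyC N c *: psi) = mpolyC N c *: dd psi.
Proof.
rewrite /dd koszulZ scalerBr !scalerA [_ * 2%:R]mulrC; congr (_ - _).
rewrite /ddt scaler_sumr; apply: eq_bigr => j _.
by rewrite dt_C eps_C eta_opZ scalerDr !scalerA [tpol _ * _]mulrC.
Qed.

Lemma koszul_sq psi : koszul (koszul psi) = 0.
Proof.
rewrite /koszul; under eq_bigr do rewrite eta_op_sum scaler_sumr.
apply: sum_antisym => i j; rewrite !eta_opZ !scalerA [tpol j * _]mulrC.
by rewrite eta_anti scalerN.
Qed.

(** The form q is closed under [ddt]: where a derivative meets t_j or eta_j it produces the square
    of eta_j or of some omega_a. *)
Lemma ddt_koszul psi : ddt (koszul psi) = - koszul (ddt psi).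
Proof.
have ddt_t i chi : eta_op i (dt i (koszul chi)) =
    \sum_j tpol j *: eta_op i (eta_op j (dt i chi)).
  rewrite /koszul dt_sum eta_op_sum.
  under eq_bigr do rewrite dtt dt_eta eta_opD !eta_opZ.
  rewrite big_split /= [X in X + _]big1 ?add0r// => j _.
  have [->|_] := eqVneq i j; last by rewrite scale0r.
  by rewrite eta_sq scaler0.
have eps_k i chi : eps_op i (koszul chi) = - koszul (eps_op i chi).
  rewrite /koszul eps_op_sum -sumrN; apply: eq_bigr => j _.
  by rewrite eps_tpol eps_eta scalerN.
rewrite {1}/ddt; under eq_bigr do rewrite ddt_t eps_k scalerN.
rewrite /ddt koszul_sum -sumrN; apply: eq_bigr => i _.
rewrite koszulD opprD koszulZ; congr (_ - _).
rewrite /koszul -sumrN; apply: eq_bigr => j _.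
by rewrite eta_anti scalerN.
Qed.

(** All products with indices i and j are antisymmetric and cancel, except for the terms in which
    d/dt_i meets the factor t_i. *)
Lemma ddt_sq psi : ddt (ddt psi) = \sum_i eta_op i (eps_op i psi).
Proof.
have E i j : eta_op i (dt i (eta_op j (dt j psi) + tpol j *: eps_op j psi)) +
    tpol i *: eps_op i (eta_op j (dt j psi) + tpol j *: eps_op j psi) =
    (i == j)%:R *: eta_op i (eps_op j psi) +
    (eta_op i (eta_op j (dt i (dt j psi)))
     + (tpol i * tpol j) *: eps_op i (eps_op j psi)
     + (tpol j *: eta_op i (eps_op j (dt i psi))
        - tpol i *: eta_op j (eps_op i (dt j psi)))).
  rewrite dtD eps_opD dtt dt_eta dt_eps eps_eta eps_tpol !eta_opD !eta_opZ.
  rewrite scalerDr scalerN scalerA.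
  have AC (a d t f g : K) : a + (d + t) + (f + g) = d + (a + g + (t + f)).
    by rewrite [a + _]addrCA -!addrA; congr (_ + (_ + _)); rewrite addrA addrC.
  exact: AC.
rewrite {1}/ddt.
have -> : \sum_i (eta_op i (dt i (ddt psi)) + tpol i *: eps_op i (ddt psi)) =
    \sum_i \sum_j ((i == j)%:R *: eta_op i (eps_op j psi) +
    (eta_op i (eta_op j (dt i (dt j psi)))
     + (tpol i * tpol j) *: eps_op i (eps_op j psi)
     + (tpol j *: eta_op i (eps_op j (dt i psi))
        - tpol i *: eta_op j (eps_op i (dt j psi))))).
  apply: eq_bigr => i _; rewrite /ddt dt_sum eps_op_sum eta_op_sum scaler_sumr.
  by rewrite -big_split; apply: eq_bigr => j _; apply: E.
under eq_bigr do rewrite big_split.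
rewrite big_split /= [X in _ + X]sum_antisym ?addr0 => [|i j].
  apply: eq_bigr => i _; rewrite (bigD1 i)//= big1 ?addr0 ?eqxx ?scale1r// => j ji.
  by rewrite eq_sym (negPf ji) scale0r.
rewrite opprD opprB opprD; congr (_ + _ + _).
- by rewrite dtC eta_anti.
- by rewrite mulrC eps_anti scalerN.
Qed.

(** Symmetrising in a and b turns the sum into omega_a omega_b applied to a rotation of the
    coordinates; by invariance this is minus the rotation of the omega's, which omega_a omega_b
    annihilates. *)
Lemma sum_eta_eps psi : (forall a b, lie a b psi = 0) ->
  \sum_i eta_op i (eps_op i psi) = 0.
Proof.
move=> L; pose M a b := \sum_i xpol a i *: fmul a (fmul b (dx b i psi)).
have -> : \sum_i eta_op i (eps_op i psi) = \sum_a \sum_b M a b.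
  transitivity (\sum_i \sum_a \sum_b xpol a i *: fmul a (fmul b (dx b i psi))).
    apply: eq_bigr => i _; rewrite etaE; apply: eq_bigr => a _.
    by rewrite /eps_op fmul_sum scaler_sumr.
  by rewrite exchange_big; apply: eq_bigr => a _; rewrite exchange_big.
have ML a b : M a b + M b a = - fmul a (fmul b (fmul a (fcontract b psi) - fmul b (fcontract a psi))).
  have -> : M a b + M b a = fmul a (fmul b (rotl a b psi)).
    rewrite /rotl !fmul_sum /M -big_split; apply: eq_bigr => i _ /=.
    by rewrite !fmulB !fmulZ [in X in _ + X]fmul_anti scalerN.
  have := L a b; rewrite /lie => /eqP; rewrite addr_eq0 => /eqP ->.
  by rewrite !fmulN.
have {}ML a b : M a b + M b a = 0.
  rewrite ML !fmulB fmul_sq fmul0 subr0 fmul_anti.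
  by rewrite fmul_sq fmul0 !oppr0.
apply: sum_antisym => a b; apply/eqP; rewrite -addr_eq0; apply/eqP/ML.
Qed.

Lemma adj_x a j : adjoint (fun psi : K => xpol a j *: psi) (dx a j).
Proof. exact: fischerX. Qed.

Lemma adj_t j : adjoint (fun psi : K => tpol j *: psi) (dt j).
Proof. exact: fischerX. Qed.

Lemma adj_eta j : adjoint (@eta_op C n k j) (del_op j).
Proof.
move=> psi chi; rewrite etaE /del_op fischer_suml fischer_sumr.
by apply: eq_bigr => a _; rewrite adj_x fischer_fmul.
Qed.

Lemma adj_iot j : adjoint (@iot_op C n k j) (eps_op j).
Proof.
move=> psi chi; rewrite iotE /eps_op fischer_suml fischer_sumr.
apply: eq_bigr => a _; rewrite adj_x.
by rewrite (adjoint_sym (@fischer_fmul C N n a)).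
Qed.

Lemma adj_gram i j : adjoint (fun psi : K => gram i j *: psi) (lap_op i j).
Proof.
move=> psi chi; rewrite gramE scaler_suml /lap_op fischer_suml fischer_sumr.
by apply: eq_bigr => a _; rewrite -scalerA !adj_x dxC.
Qed.

Lemma adj_koszul : adjoint koszul koszul_adj.
Proof.
move=> psi chi; rewrite /koszul /koszul_adj fischer_suml fischer_sumr.
by apply: eq_bigr => j _; rewrite adj_t adj_eta.
Qed.

Lemma dd_sq psi : (forall a b, lie a b psi = 0) -> dd (dd psi) = 0.
Proof.
move=> L; rewrite /dd ddtB koszulB ddt_sq sum_eta_eps// sub0r.
have Z2 chi : ddt (2%:R *: chi) = 2%:R *: ddt chi.
  by rewrite !scaler_nat !mulr2n ddtD.
by rewrite Z2 ddt_koszul koszulZ koszul_sq scaler0 subr0 scalerN opprK subrr.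
Qed.

(** For chi = u, the sum over i and j is, for each a, the squared norm of the sum over j of d/dx_aj
    d/dt_j u. *)
Lemma eul_form i j u chi : fischer (tpol i *: eul_op i j (dt j u)) chi =
  \sum_a fischer (dx a j (dt j u)) (dx a i (dt i chi)).
Proof.
rewrite /eul_op scaler_sumr fischer_suml; apply: eq_bigr => a _.
by rewrite adj_t adj_x.
Qed.

(** By [del_eta] the terms [eta_op i] after [del_op j] of the two products cancel; for l <= n each
    remaining part has a nonnegative inner product with u. *)
Lemma koszul_laplacian l u : hdeg l u ->
  koszul_adj (koszul u) + koszul (koszul_adj u) =
  \sum_j del_op j (eta_op j u) +
  (\sum_i \sum_j tpol i *: eul_op i j (dt j u)
   + (n%:R - l%:R) *: \sum_j tpol j *: dt j u).
Proof.
move=> H; have Hdt j : hdeg l (dt j u) by apply: hdeg_pderiv.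
have -> : koszul_adj (koszul u) = \sum_j del_op j (eta_op j u) +
    \sum_j \sum_i tpol i *: del_op j (eta_op i (dt j u)).
  rewrite -big_split; apply: eq_bigr => j _ /=.
  rewrite /koszul dt_sum del_op_sum.
  under [LHS]eq_bigr do rewrite dtt dt_eta del_opD del_tpol.
  rewrite big_split; congr (_ + _); rewrite (bigD1 j)//= eqxx scale1r.
  rewrite big1 ?addr0// => i ij.
  by rewrite eq_sym (negPf ij) scale0r del_op0.
have -> : koszul (koszul_adj u) =
    \sum_j \sum_i tpol i *: eta_op i (del_op j (dt j u)).
  rewrite exchange_big; apply: eq_bigr => i _.
  by rewrite /koszul_adj eta_op_sum scaler_sumr.
rewrite -addrA; congr (_ + _); rewrite -big_split /=.
rewrite [X in _ = X + _]exchange_big scaler_sumr -big_split; apply: eq_bigr => j _ /=.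
rewrite -big_split /=.
under eq_bigr => i _ do rewrite (del_eta i j (Hdt j)) -scalerDr subrK scalerDr.
rewrite big_split; congr (_ + _); rewrite (bigD1 j)//= eqxx scale1r.
rewrite big1 ?addr0 => [|i ij]; first by rewrite !scalerA mulrC.
by rewrite (negPf ij) scale0r scaler0.
Qed.

Lemma koszul_harmonic l u : hdeg l u -> (l < n)%N ->
  koszul u = 0 -> koszul_adj u = 0 ->
  (forall j, dt j u = 0) /\ (forall j, eta_op j u = 0).
Proof.
move=> H ln ku kau.
have := koszul_laplacian H; rewrite ku kau koszul0 koszul_adj0 addr0.
move=> /(congr1 (fun z => fischer z u)); rewrite fischer0l !fischerDl.
rewrite -natrB ?(ltnW ln)// fischerZl !fischer_suml.
have -> : \sum_j fischer (del_op j (eta_op j u)) u = \sum_j fischer (eta_op j u) (eta_op j u).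
  by apply: eq_bigr => j _; rewrite (adjoint_sym (adj_eta j)).
have -> : \sum_j fischer (tpol j *: dt j u) u = \sum_j fischer (dt j u) (dt j u).
  by apply: eq_bigr => j _; rewrite adj_t.
have -> : \sum_i fischer (\sum_j tpol i *: eul_op i j (dt j u)) u =
    \sum_a fischer (\sum_j dx a j (dt j u)) (\sum_j dx a j (dt j u)).
  under eq_bigr do rewrite fischer_suml; under eq_bigr do under eq_bigr do rewrite eul_form.
  rewrite exchange_big; under eq_bigr do rewrite exchange_big /=.
  rewrite exchange_big; apply: eq_bigr => a _ /=.
  rewrite fischer_suml; apply: eq_bigr => j _; by rewrite fischer_sumr.
have S1 : 0 <= \sum_j fischer (eta_op j u) (eta_op j u) by apply: sumr_ge0 => j _; apply: fischer_ge0.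
have S2 : 0 <= \sum_j fischer (dt j u) (dt j u) by apply: sumr_ge0 => j _; apply: fischer_ge0.
have S3 : 0 <= \sum_a fischer (\sum_j dx a j (dt j u)) (\sum_j dx a j (dt j u)).
  by apply: sumr_ge0 => a _; apply: fischer_ge0.
move=> /esym/eqP; rewrite paddr_eq0 ?addr_ge0 ?mulr_ge0 ?ler0n//.
(* Since l < n the coefficient n - l is nonzero, so the squared norms of the t-derivatives vanish as
   well. *)
rewrite paddr_eq0 ?mulr_ge0 ?ler0n// mulf_eq0 pnatr_eq0 subn_eq0 leqNgt ln /=.
move=> /and3P[E1 _ E2]; split=> j; apply: fischer_eq0; apply/eqP.
  move: E2; rewrite psumr_eq0 => [/allP/(_ j)|? _]; last exact: fischer_ge0.
  by rewrite mem_index_enum => /(_ isT).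
move: E1; rewrite psumr_eq0 => [/allP/(_ j)|? _]; last exact: fischer_ge0.
by rewrite mem_index_enum => /(_ isT).
Qed.

(** Pairing the relation of [dx_eul_sum] with d/dx_bj u and summing gives (n - k) times the squared
    norm of the gradient plus the squared norms of all [eul_op i j u]. *)
Lemma x_harmonic u : (k <= n)%N -> (forall a b, lie a b u = 0) ->
  (forall i j, lap_op i j u = 0) -> (forall j, del_op j u = 0) ->
  (forall j, eps_op j u = 0) -> forall a j, dx a j u = 0.
Proof.
move=> kn L Lap Del Eps.
have form_dx_eul i j : \sum_b fischer (dx b i (eul_op i j u)) (dx b j u) =
    fischer (eul_op i j u) (eul_op i j u).
  rewrite {3}/eul_op fischer_sumr; apply: eq_bigr => b _.
  by rewrite (adjoint_sym (adj_x b i)).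
have : \sum_b \sum_j fischer ((n%:R - k%:R) *: dx b j u +
    \sum_i dx b i (eul_op i j u)) (dx b j u) = 0.
  by rewrite big1// => b _; rewrite big1// => j _; rewrite dx_eul_sum// fischer0l.
under eq_bigr do under eq_bigr do rewrite fischerDl -natrB// fischerZl fischer_suml.
under eq_bigr do rewrite big_split.
rewrite big_split /= => /eqP.
have -> : \sum_b \sum_j \sum_i fischer (dx b i (eul_op i j u)) (dx b j u) =
   \sum_j \sum_i fischer (eul_op i j u) (eul_op i j u).
  rewrite exchange_big; apply: eq_bigr => j _; rewrite exchange_big.
  by apply: eq_bigr => i _; rewrite form_dx_eul.
have pos2 : 0 <= \sum_j \sum_i fischer (eul_op i j u) (eul_op i j u).
  by apply: sumr_ge0 => j _; apply: sumr_ge0 => i _; apply: fischer_ge0.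
rewrite paddr_eq0//; last first.
  apply: sumr_ge0 => b _; apply: sumr_ge0 => j _.
  by rewrite mulr_ge0 ?ler0n ?fischer_ge0.
(* For k = n the gradient term carries no information, so the conclusion is drawn from the Euler
   operators: the inner product of [eul_op i i u] with u is the sum of the squared norms of the
   d/dx_ai u. *)
move=> /andP[_].
rewrite psumr_eq0 => [/allP E|j _]; last by apply: sumr_ge0 => i _; apply: fischer_ge0.
have eul0 i : eul_op i i u = 0.
  have := E i; rewrite mem_index_enum => /(_ isT).
  rewrite psumr_eq0 => [/allP /(_ i)|j _]; last exact: fischer_ge0.
  by rewrite mem_index_enum => /(_ isT)/eqP; apply: fischer_eq0.
have : \sum_i fischer (eul_op i i u) u = 0.
  by rewrite big1// => i _; rewrite eul0 fischer0l.
have -> : \sum_i fischer (eul_op i i u) u = \sum_i \sum_a fischer (dx a i u) (dx a i u).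
  apply: eq_bigr => i _; rewrite /eul_op fischer_suml.
  by apply: eq_bigr => a _; rewrite adj_x.
move=> {}E a j; move/eqP: E; rewrite psumr_eq0 => [/allP/(_ j)|? _]; last first.
  by apply: sumr_ge0 => ? _; apply: fischer_ge0.
rewrite mem_index_enum => /(_ isT); rewrite psumr_eq0 => [/allP/(_ a)|? _]; last first.
  exact: fischer_ge0.
by rewrite mem_index_enum => /(_ isT)/eqP; apply: fischer_eq0.
Qed.

End Operators.

(** * The action of the orthogonal group *)

Lemma mpoly_gen_ind (C : comNzRingType) N (Q : mpoly N C -> Prop) :
  (forall c, Q (mpolyC N c)) -> (forall v, Q (mpolyX C (mnm1 v))) ->
  (forall p q, Q p -> Q q -> Q (p + q)) ->
  (forall p q, Q p -> Q q -> Q (p * q)) -> forall p, Q p.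
Proof.
move=> QC QX QD QM; elim/mpolyind => [|c m p _ _ Qp].
  by rewrite -mpolyC0; apply: QC.
apply: (QD) => //; rewrite -mul_mpolyC; apply: (QM) => //.
rewrite mpolyXE_id; elim/big_ind: _ => [|p1 p2|v _].
- by rewrite -mpolyC1; apply: QC.
- exact: QM.
- elim: (fun_of_multinom m v) => [|e IH]; first by rewrite expr0 -mpolyC1.
  by rewrite exprS; apply: QM.
Qed.

Section Action.
Variables (C : numClosedFieldType) (n k : nat).
Local Notation N := ((n + 1) * k)%N.
Local Notation P := (mpoly N C).
Local Notation K := (polyform C N n).
Implicit Types (a b : 'I_n) (i j : 'I_k) (psi chi u : K) (p : P).

Implicit Types (g : 'M[C]_n).

(** For orthogonal g these are the coordinates of g^-1 v, so that [subst g] is the action of g on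
    functions; the entries of g occur transposed because its inverse is its transpose. *)
Definition sub_mx g : 'M[P]_(n + 1, k) :=
  col_mx (\matrix_(a, j) \sum_b mpolyC N (g b a) * xpol b j) (\row_j tpol j).

Definition subst g (p : P) : P := comp_mpoly [tuple mxvec (sub_mx g) 0 v | v < N] p.

HB.instance Definition _ g := GRing.RMorphism.copy (subst g)
  (comp_mpoly [tuple mxvec (sub_mx g) 0 v | v < N]).

Lemma subst_x g a j : subst g (xpol a j) = \sum_b mpolyC N (g b a) * xpol b j.
Proof.
rewrite /subst comp_mpolyXU -tnth_nth tnth_mktuple xvar.unlock mxvecE.
by rewrite col_mxEu mxE.
Qed.

Lemma subst_t g j : subst g (tpol j) = tpol j.
Proof.
rewrite /subst comp_mpolyXU -tnth_nth tnth_mktuple tvar.unlock mxvecE.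
by rewrite col_mxEd mxE.
Qed.

Lemma substC g c : subst g (mpolyC N c) = mpolyC N c.
Proof. exact: comp_mpolyC. Qed.

Lemma substM g : {morph subst g : p q / p * q}.
Proof. exact: rmorphM. Qed.

Lemma substD g : {morph subst g : p q / p + q}.
Proof. exact: rmorphD. Qed.

Lemma coord_ind (Q : P -> Prop) :
  (forall c, Q (mpolyC N c)) -> (forall a j, Q (xpol a j)) ->
  (forall j, Q (tpol j)) -> (forall p q, Q p -> Q q -> Q (p + q)) ->
  (forall p q, Q p -> Q q -> Q (p * q)) -> forall p, Q p.
Proof. by move=> QC Qx Qt QD QM; apply: mpoly_gen_ind => //; apply: var_ind. Qed.

Lemma mderiv_x_subst b j g p : mderiv (xvar b j) (subst g p) =
  \sum_a mpolyC N (g b a) * subst g (mderiv (xvar a j) p).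
Proof.
move: p; apply: coord_ind => [c|a i|i|p q IHp IHq|p q IHp IHq].
- rewrite substC mderivC big1// => a _; rewrite mderivC.
  by rewrite (raddf0 (subst g)) mulr0.
- rewrite subst_x raddf_sum (bigD1 b)//= big1 ?addr0 => [|c cb]; last first.
    by rewrite mderiv_mulC mderiv_var xvar_eq eq_sym (negPf cb) mulr0.
  rewrite mderiv_mulC mderiv_var xvar_eq eqxx /= (bigD1 a)//= big1 => [|c ca].
    by rewrite addr0 mderiv_var xvar_eq eqxx /= rmorph_nat.
  by rewrite mderiv_var xvar_eq (negPf ca) rmorph0 mulr0.
- rewrite subst_t mderiv_var xvar_tvar big1// => a _.
  by rewrite mderiv_var xvar_tvar rmorph0 mulr0.
- rewrite substD !mderivD IHp IHq -big_split; apply: eq_bigr => a _ /=.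
  by rewrite mderivD substD mulrDr.
- rewrite substM mderivM IHp IHq mulr_suml mulr_sumr -big_split.
  apply: eq_bigr => a _ /=; rewrite mderivM substD !substM mulrDr !mulrA.
  by rewrite [subst g p * _]mulrC.
Qed.

Lemma mderiv_t_subst j g p :
  mderiv (tvar n j) (subst g p) = subst g (mderiv (tvar n j) p).
Proof.
move: p; apply: coord_ind => [c|a i|i|p q IHp IHq|p q IHp IHq].
- by rewrite substC mderivC (raddf0 (subst g)).
- rewrite subst_x raddf_sum /= mderiv_var eq_sym xvar_tvar rmorph0 big1// => b _.
  by rewrite mderiv_mulC mderiv_var eq_sym xvar_tvar mulr0.
- by rewrite subst_t mderiv_var tvar_eq rmorph_nat.
- by rewrite substD !mderivD IHp IHq substD.
- by rewrite substM !mderivM IHp IHq substD !substM.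
Qed.

Definition cmx g : 'M[P]_n := map_mx (mpolyC N (R:=C)) g.

Definition subst_form g psi : K := [ffun I => subst g (psi I)].

End Action.

HB.lock Definition act (C : numClosedFieldType) n k (g : 'M[C]_n)
  (psi : polyform C ((n + 1) * k) n) : polyform C ((n + 1) * k) n :=
  ext_map (cmx k g) (subst_form g psi : ext (mpoly ((n + 1) * k) C) n).

Section ActionTheory.
Variables (C : numClosedFieldType) (n k : nat).
Local Notation N := ((n + 1) * k)%N.
Local Notation P := (mpoly N C).
Local Notation K := (polyform C N n).
Implicit Types (a b : 'I_n) (i j : 'I_k) (psi chi u : K) (p : P).

Implicit Types (g : 'M[C]_n).

Lemma actE g psi : act g psi = ext_map (cmx k g) (subst_form g psi : ext P n).
Proof. by rewrite act.unlock. Qed.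

Lemma actZ g p psi : act g (p *: psi) = subst g p *: act g psi.
Proof.
rewrite !actE [RHS]polyformZ -linearZ; congr ext_map.
by apply/ffunP => I; rewrite !ffunE polyformZE substM.
Qed.

Lemma act_zmod g : zmod_morphism (@act C n k g).
Proof.
move=> x y; rewrite !actE -(linearB (ext_map (cmx k g))); congr ext_map.
by apply/ffunP => I; rewrite !ffunE rmorphB.
Qed.
HB.instance Definition _ g := GRing.isZmodMorphism.Build K K (@act C n k g) (act_zmod g).

Lemma actD g : {morph @act C n k g : x y / x + y}. Proof. exact: raddfD. Qed.
Lemma act0 g : act g (0 : K) = 0. Proof. exact: raddf0. Qed.
Lemma act_sum g (I : finType) (F : I -> K) :
  act g (\sum_s F s) = \sum_s act g (F s).
Proof. exact: raddf_sum. Qed.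

Lemma actC g c psi : act g (mpolyC N c *: psi) = mpolyC N c *: act g psi.
Proof. by rewrite actZ substC. Qed.

Lemma subst_signM g m p : subst g ((-1) ^+ m * p) = (-1) ^+ m * subst g p.
Proof. by rewrite substM rmorphXn rmorphN1. Qed.

Lemma act_fmul g a psi :
  act g (fmul a psi) = \sum_b mpolyC N (g b a) *: fmul b (act g psi).
Proof.
rewrite !actE (_ : subst_form _ _ = ext_mul a (subst_form g psi : ext P n)).
  rewrite ext_map_mul; apply: eq_bigr => b _.
  by rewrite [RHS]polyformZ fmul.unlock mxE.
apply/ffunP => J; rewrite ext_mulE !ffunE fmulE; case: ifP => _; last exact: rmorph0.
exact: subst_signM.
Qed.

Lemma act_fcontract g a psi : g^T *m g = 1%:M ->
  act g (fcontract a psi) = \sum_b mpolyC N (g b a) *: fcontract b (act g psi).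
Proof.
move=> gO; rewrite !actE (_ : subst_form _ _ = contract a (subst_form g psi : ext P n)).
  rewrite ext_map_contract; last by rewrite matrix.map_trmx -map_mxM gO map_mx1.
  by apply: eq_bigr => b _; rewrite [RHS]polyformZ fcontract.unlock mxE.
apply/ffunP => J; rewrite contractE !ffunE fcontractE; case: ifP => _; first exact: rmorph0.
exact: subst_signM.
Qed.

Lemma pderiv_ext_map (v : 'I_N) g (psi : K) :
  pderiv v (ext_map (cmx k g) (psi : ext P n) : K) =
  ext_map (cmx k g) (pderiv v psi : ext P n).
Proof.
have W I : pderiv v (ext_map (cmx k g) (ext_basis P I) : K) = 0.
  rewrite ext_map_word /word; elim: index_enum => [|i s IH] /=.
    by rewrite pderiv_const// inE eqxx.
  case: ifP => _//; rewrite /rot_mul /rot_op [pderiv v _]raddf_sum big1// => b _.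
  rewrite mxE -polyformZ /= pderivM mderivC scale0r add0r.
  have -> : ext_mul b (word_on s (rot_op (cmx k g) (@ext_mul P n)) ext1 I) =
     fmul b (word_on s (rot_op (cmx k g) (@ext_mul P n)) ext1 I : K).
    by rewrite fmul.unlock.
  by rewrite pderiv_fmul IH fmul0 scaler0.
have E (chi : K) : ext_map (cmx k g) (chi : ext P n) =
    \sum_I chi I *: (ext_map (cmx k g) (ext_basis P I) : K).
  rewrite {1}[chi : ext P n]ext_expand linear_sum; apply: eq_bigr => I _.
  by rewrite linearZ polyformZ.
rewrite !E [pderiv v _]raddf_sum; apply: eq_bigr => I _.
by rewrite /= pderivM W scaler0 addr0 pderivE.
Qed.

Lemma act_dt g j psi : act g (dt j psi) = dt j (act g psi).
Proof.
rewrite !actE /dt pderiv_ext_map; congr ext_map; apply/ffunP => I.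
by rewrite pderivE !ffunE pderivE mderiv_t_subst.
Qed.

(** The chain rule expresses the derivatives of the transform by the transforms of the derivatives;
    g^T g = 1 inverts this relation. *)
Lemma act_dx g a j psi : g^T *m g = 1%:M ->
  act g (dx a j psi) = \sum_b mpolyC N (g b a) *: dx b j (act g psi).
Proof.
move=> gO; rewrite !actE /dx.
under eq_bigr do rewrite pderiv_ext_map polyformZ -linearZ /=.
rewrite -linear_sum; congr ext_map; apply/ffunP => I; rewrite ffunE pderivE.
rewrite sum_ffunE; under eq_bigr do rewrite ffunE pderivE ffunE mderiv_x_subst.
under eq_bigr do rewrite -[_ *: _]/(_ * _) mulr_sumr.
rewrite exchange_big (bigD1 a)//= [X in _ + X]big1 ?addr0 => [|c ca].
  under eq_bigr do rewrite mulrA -mpolyCM.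
  rewrite -mulr_suml -raddf_sum (_ : \sum_b _ = 1) ?mpolyC1 ?mul1r//=.
  transitivity ((g^T *m g) a a); last by rewrite gO mxE eqxx.
  by rewrite mxE; apply: eq_bigr => b _; rewrite mxE.
under eq_bigr do rewrite mulrA -mpolyCM.
rewrite -mulr_suml -raddf_sum (_ : \sum_b _ = 0) ?mpolyC0 ?mul0r//=.
transitivity ((g^T *m g) a c); last by rewrite gO mxE eq_sym (negPf ca).
by rewrite mxE; apply: eq_bigr => b _; rewrite mxE.
Qed.

(* A family of operators that transforms like the coordinates of a vector; the
   contraction of two such families commutes with orthogonal matrices. *)
Definition vector_op (z : 'I_n -> K -> K) := forall g, g^T *m g = 1%:M ->
  forall a psi, act g (z a psi) = \sum_b mpolyC N (g b a) *: z b (act g psi).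

Lemma act_contraction g (z : 'I_n -> {additive K -> K}) (z' : 'I_n -> K -> K) psi :
  (forall a c x, z a (mpolyC N c *: x) = mpolyC N c *: z a x) ->
  vector_op (fun a => z a) -> vector_op z' -> g^T *m g = 1%:M ->
  act g (\sum_a z a (z' a psi)) = \sum_a z a (z' a (act g psi)).
Proof.
move=> zC zv zv' gO; have gO' := mulmx1C gO; rewrite act_sum.
transitivity (\sum_a \sum_b \sum_c
    mpolyC N (g b a * g c a) *: z b (z' c (act g psi))).
  apply: eq_bigr => a _; rewrite zv//; apply: eq_bigr => b _.
  rewrite zv'// raddf_sum scaler_sumr; apply: eq_bigr => c _ /=.
  by rewrite zC scalerA mpolyCM.
rewrite exchange_big; apply: eq_bigr => b _; rewrite exchange_big /=.
have E c : \sum_a mpolyC N (g b a * g c a) *: z b (z' c (act g psi)) =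
    (b == c)%:R *: z b (z' c (act g psi)).
  rewrite -scaler_suml -raddf_sum /= (_ : \sum_a _ = (b == c)%:R) ?mpolyC_nat//.
  transitivity ((g *m g^T) b c); last by rewrite gO' mxE.
  by rewrite mxE; apply: eq_bigr => a _; rewrite mxE.
under eq_bigr do rewrite E.
rewrite (bigD1 b)//= big1 ?addr0 ?eqxx ?scale1r// => c cb.
by rewrite eq_sym (negPf cb) scale0r.
Qed.

Definition xscale j a : K -> K := fun psi => xpol a j *: psi.
Fact xscale_zmod j a : zmod_morphism (xscale j a).
Proof. by move=> x y; rewrite /xscale scalerBr. Qed.
HB.instance Definition _ j a :=
  GRing.isZmodMorphism.Build K K (xscale j a) (xscale_zmod j a).

Lemma xscale_C j a c psi :
  xscale j a (mpolyC N c *: psi) = mpolyC N c *: xscale j a psi.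
Proof. by rewrite /xscale !scalerA mulrC. Qed.

Lemma vector_xscale j : vector_op (xscale j).
Proof.
move=> g gO a psi; rewrite /xscale actZ subst_x scaler_suml.
by apply: eq_bigr => b _; rewrite scalerA.
Qed.

Lemma vector_fmul : vector_op (@fmul C N n).
Proof. by move=> g gO a psi; apply: act_fmul. Qed.

Lemma vector_fcontract : vector_op (@fcontract C N n).
Proof. by move=> g gO a psi; apply: act_fcontract. Qed.

Lemma vector_dx j : vector_op (fun a => @dx C n k a j).
Proof. by move=> g gO a psi; apply: act_dx. Qed.

Lemma act_eta g j psi : g^T *m g = 1%:M ->
  act g (eta_op j psi) = eta_op j (act g psi).
Proof.
move=> gO; rewrite !etaE.
exact: (act_contraction (z := fun a => xscale j a : {additive K -> K}) psi
  (xscale_C j) (vector_xscale j) vector_fmul gO).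
Qed.

Lemma act_iot g j psi : g^T *m g = 1%:M ->
  act g (iot_op j psi) = iot_op j (act g psi).
Proof.
move=> gO; rewrite !iotE.
exact: (act_contraction (z := fun a => xscale j a : {additive K -> K}) psi
  (xscale_C j) (vector_xscale j) vector_fcontract gO).
Qed.

Lemma act_del g j psi : g^T *m g = 1%:M ->
  act g (del_op j psi) = del_op j (act g psi).
Proof.
move=> gO; exact: (act_contraction (z := fun a => @fcontract C N n a : {additive K -> K})
  psi (fun a c => @fcontractZ C N n a (mpolyC N c)) vector_fcontract (vector_dx j) gO).
Qed.

Lemma act_eps g j psi : g^T *m g = 1%:M ->
  act g (eps_op j psi) = eps_op j (act g psi).
Proof.
move=> gO; exact: (act_contraction (z := fun a => @fmul C N n a : {additive K -> K})
  psi (fun a c => @fmulZ C N n a (mpolyC N c)) vector_fmul (vector_dx j) gO).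
Qed.

Lemma act_lap g i j psi : g^T *m g = 1%:M ->
  act g (lap_op i j psi) = lap_op i j (act g psi).
Proof.
move=> gO; exact: (act_contraction (z := fun a => @dx C n k a i : {additive K -> K})
  psi (fun a => @dx_C C n k a i) (vector_dx i) (vector_dx j) gO).
Qed.

Lemma subst_gram g i j : g^T *m g = 1%:M -> subst g (gram i j) = gram i j.
Proof.
move=> gO; have gO' := mulmx1C gO.
rewrite !gramE raddf_sum /=.
transitivity (\sum_a \sum_b \sum_c
    mpolyC N (g b a * g c a) * (xpol b i * xpol c j)).
  apply: eq_bigr => a _; rewrite substM !subst_x mulr_suml.
  apply: eq_bigr => b _; rewrite mulr_sumr; apply: eq_bigr => c _.
  by rewrite mulrACA mpolyCM.
rewrite exchange_big; apply: eq_bigr => b _; rewrite exchange_big /=.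
have E c : \sum_a mpolyC N (g b a * g c a) * (xpol b i * xpol c j) =
    (b == c)%:R * (xpol b i * xpol c j).
  rewrite -mulr_suml -raddf_sum /= (_ : \sum_a _ = (b == c)%:R) ?mpolyC_nat//.
  transitivity ((g *m g^T) b c); last by rewrite gO' mxE.
  by rewrite mxE; apply: eq_bigr => a _; rewrite mxE.
under eq_bigr do rewrite E.
rewrite (bigD1 b)//= big1 ?addr0 ?eqxx ?mul1r// => c cb.
by rewrite eq_sym (negPf cb) mul0r.
Qed.

Lemma act_koszul g psi : g^T *m g = 1%:M ->
  act g (koszul psi) = koszul (act g psi).
Proof.
move=> gO; rewrite /koszul act_sum; apply: eq_bigr => j _.
by rewrite actZ subst_t act_eta.
Qed.

Lemma act_koszul_adj g psi : g^T *m g = 1%:M ->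
  act g (koszul_adj psi) = koszul_adj (act g psi).
Proof.
move=> gO; rewrite /koszul_adj act_sum; apply: eq_bigr => j _.
by rewrite act_del// act_dt.
Qed.

Lemma act_ddt g psi : g^T *m g = 1%:M -> act g (ddt psi) = ddt (act g psi).
Proof.
move=> gO; rewrite /ddt act_sum; apply: eq_bigr => j _.
by rewrite actD actZ subst_t act_eta// act_dt act_eps.
Qed.

Lemma act_vol g : act g (vol : ext P n) = mpolyC N (\det g) *: (vol : K).
Proof.
rewrite actE (_ : subst_form _ _ = vol); last first.
  apply/ffunP => J; rewrite ffunE volE ffunE; exact: rmorph_nat.
by rewrite ext_map_vol det_map_mx polyformZ.
Qed.

Lemma act_ext1 g : act g (ext1 : ext P n) = (ext1 : ext P n).
Proof.
rewrite actE (_ : subst_form _ _ = ext1); last first.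
  apply/ffunP => J; rewrite !ffunE; exact: rmorph_nat.
exact: ext_map1.
Qed.

End ActionTheory.

(** * Homogeneous components and degree bounds *)

HB.lock Definition pid (C : comNzRingType) N n (d : nat)
  (psi : polyform C N n) : polyform C N n := [ffun I => pihomog mdeg d (psi I)].

Section Degree.
Variables (C : numClosedFieldType) (n k : nat).
Local Notation N := ((n + 1) * k)%N.
Local Notation P := (mpoly N C).
Local Notation K := (polyform C N n).
Implicit Types (a b : 'I_n) (i j : 'I_k) (psi chi u : K) (p : P).

Lemma mcoeff_pihomog d m p : mcoeff m (pihomog mdeg d p) =
  if mdeg m == d then mcoeff m p else 0.
Proof.
have [md|md] := eqVneq (mdeg m) d; last first.
  exact: dhomog_nemf_coeff (pihomogP _ _ _) md.
have [p' [pE p'0]] : exists p' : P, p = pihomog mdeg d p + p' /\ mcoeff m p' = 0.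
  exists (\sum_(m <- msupp p | mdeg m != d) mcoeff m p *: mpolyX C m).
  split.
    by rewrite {1}[p]mpolyE (bigID (fun m => mdeg m == d)) /= pihomogE.
  rewrite raddf_sum big1// => m' m'd; rewrite /= mcoeffZ mcoeffX.
  by have [E|_] := eqVneq m' m; rewrite ?mulr0//; rewrite E md eqxx in m'd.
by rewrite [in RHS]pE mcoeffD p'0 addr0.
Qed.

Lemma pid_coeff d psi I m : mcoeff m (pid d psi I) =
  if mdeg m == d then mcoeff m (psi I) else 0.
Proof. by rewrite pid.unlock ffunE mcoeff_pihomog. Qed.

Lemma polyformP psi chi :
  (forall I m, mcoeff m (psi I) = mcoeff m (chi I)) -> psi = chi.
Proof. by move=> E; apply/ffunP => I; apply/mpolyP => m. Qed.

Fact pid_zmod d : zmod_morphism (@pid C N n d).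
Proof.
move=> x y; apply: polyformP => I m.
have E (z w : K) : (z - w) I = z I - w I by rewrite !ffunE.
by rewrite E mcoeffB !pid_coeff E mcoeffB; case: ifP; rewrite ?subr0.
Qed.
HB.instance Definition _ d :=
  GRing.isZmodMorphism.Build K K (@pid C N n d) (pid_zmod d).

Lemma pidB d : {morph @pid C N n d : x y / x - y}. Proof. exact: raddfB. Qed.
Lemma pid0 d : pid d (0 : K) = 0. Proof. exact: raddf0. Qed.
Lemma pid_sum d (I : finType) (F : I -> K) :
  pid d (\sum_s F s) = \sum_s pid d (F s).
Proof. exact: raddf_sum. Qed.

Lemma pid_C d c psi : pid d (mpolyC N c *: psi) = mpolyC N c *: pid d psi.
Proof.
apply: polyformP => I m; rewrite polyformZE mcoeffCM !pid_coeff polyformZE mcoeffCM.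
by case: ifP => // _; rewrite mulr0.
Qed.

Lemma pid_X d (v : 'I_N) psi :
  pid d.+1 (mpolyX C (mnm1 v) *: psi) = mpolyX C (mnm1 v) *: pid d psi.
Proof.
apply: polyformP => I m; rewrite polyformZE pid_coeff polyformZE !mcoeff_XM.
case: (ltnP 0 (m v)) => mv; last by rewrite if_same.
by rewrite pid_coeff -{1}(sub_mnm1K mv) mdegD mdeg1 [(mdeg _ + 1)%N]addn1.
Qed.

Lemma pid_pderiv d (v : 'I_N) psi : pid d (pderiv v psi) = pderiv v (pid d.+1 psi).
Proof.
apply: polyformP => I m; rewrite pid_coeff !pderivE !mcoeff_deriv pid_coeff.
by rewrite mdegD mdeg1 [(mdeg _ + 1)%N]addn1 eqSS; case: ifP => // _; rewrite mul0rn.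
Qed.

Lemma mcoeff_signM e (p : P) m : mcoeff m ((-1) ^+ e * p) = (-1) ^+ e * mcoeff m p.
Proof. by rewrite -signr_odd !mulr_sign -signr_odd mulr_sign; case: (odd e) => //=; rewrite ?oddb /= ?mcoeffN. Qed.

Lemma pid_fmul d a psi : pid d (fmul a psi) = fmul a (pid d psi).
Proof.
apply: polyformP => I m; rewrite pid_coeff !fmulE.
case: (a \in I); last by rewrite mcoeff0 if_same.
by rewrite !mcoeff_signM pid_coeff; case: ifP => // _; rewrite mulr0.
Qed.

Lemma pid_fcontract d a psi : pid d (fcontract a psi) = fcontract a (pid d psi).
Proof.
apply: polyformP => I m; rewrite pid_coeff !fcontractE.
case: (a \in I); first by rewrite mcoeff0 if_same.
by rewrite !mcoeff_signM pid_coeff; case: ifP => // _; rewrite mulr0.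
Qed.

Lemma pid_dlt d psi : dlt d psi -> pid d psi = 0.
Proof.
move=> H; apply: polyformP => I m; rewrite pid_coeff ffunE mcoeff0.
by case: eqP => // E; apply: H; rewrite E.
Qed.

Lemma dlt_pid d psi : dlt d.+1 (pid d psi).
Proof.
by move=> I m md; rewrite pid_coeff; case: eqP => // E; rewrite E ltnn in md.
Qed.

Lemma dlt_sub_pid d psi : dlt d.+1 psi -> dlt d (psi - pid d psi).
Proof.
move=> H I m md; rewrite !ffunE mcoeffB pid_coeff; case: eqP => [_|/eqP E].
  by rewrite subrr.
by rewrite subr0 H// ltn_neqAle eq_sym E.
Qed.

Lemma hdeg_pid l d psi : hdeg l psi -> hdeg l (pid d psi).
Proof. by move=> H J Jl; rewrite pid.unlock ffunE H//; apply: raddf0. Qed.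

Lemma pid_eta d j psi : pid d.+1 (eta_op j psi) = eta_op j (pid d psi).
Proof. by rewrite !etaE pid_sum; apply: eq_bigr => a _; rewrite pid_X pid_fmul. Qed.

Lemma pid_del d j psi : pid d (del_op j psi) = del_op j (pid d.+1 psi).
Proof.
rewrite /del_op pid_sum; apply: eq_bigr => a _.
by rewrite pid_fcontract [pid _ (dx _ _ _)]pid_pderiv.
Qed.

Lemma pid_koszul d psi : pid d.+2 (koszul psi) = koszul (pid d psi).
Proof.
by rewrite /koszul pid_sum; apply: eq_bigr => j _; rewrite pid_X pid_eta.
Qed.

Lemma pid_koszul_adj d psi : pid d (koszul_adj psi) = koszul_adj (pid d.+2 psi).
Proof.
rewrite /koszul_adj pid_sum; apply: eq_bigr => j _.
by rewrite pid_del [pid _ (dt _ _)]pid_pderiv.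
Qed.

Lemma dlt_x d a j psi : dlt d psi -> dlt d.+1 (xpol a j *: psi).
Proof. exact: dltX. Qed.

Lemma dlt_t d j psi : dlt d psi -> dlt d.+1 (tpol j *: psi).
Proof. exact: dltX. Qed.

Lemma dlt_dx d a j psi : dlt d psi -> dlt d.-1 (dx a j psi).
Proof. exact: dlt_pderiv. Qed.

Lemma dlt_dt d j psi : dlt d psi -> dlt d.-1 (dt j psi).
Proof. exact: dlt_pderiv. Qed.

Lemma dlt_eta d j psi : dlt d psi -> dlt d.+1 (eta_op j psi).
Proof.
by move=> H; rewrite etaE; apply: dlt_sum => a _; apply/dlt_x/dlt_fmul.
Qed.

Lemma dlt_iot d j psi : dlt d psi -> dlt d.+1 (iot_op j psi).
Proof.
by move=> H; rewrite iotE; apply: dlt_sum => a _; apply/dlt_x/dlt_fcontract.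
Qed.

Lemma dlt_del d j psi : dlt d psi -> dlt d.-1 (del_op j psi).
Proof. by move=> H; apply: dlt_sum => a _; apply/dlt_fcontract/dlt_dx. Qed.

Lemma dlt_eps d j psi : dlt d psi -> dlt d.-1 (eps_op j psi).
Proof. by move=> H; apply: dlt_sum => a _; apply/dlt_fmul/dlt_dx. Qed.

Lemma dlt_lap d i j psi : dlt d psi -> dlt d.-2 (lap_op i j psi).
Proof. by move=> H; apply: dlt_sum => a _; apply/dlt_dx/dlt_dx. Qed.

Lemma dlt_gram d i j psi : dlt d psi -> dlt d.+2 (gram i j *: psi).
Proof.
move=> H; rewrite gramE scaler_suml; apply: dlt_sum => a _.
by rewrite -scalerA; apply/dlt_x/dlt_x.
Qed.

Lemma dlt_koszul d psi : dlt d psi -> dlt d.+2 (koszul psi).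
Proof. by move=> H; apply: dlt_sum => j _; apply/dlt_t/dlt_eta. Qed.

Lemma dlt_koszul_adj d psi : dlt d psi -> dlt d.-2 (koszul_adj psi).
Proof. by move=> H; apply: dlt_sum => j _; apply/dlt_del/dlt_dt. Qed.

Lemma dlt_ddt d psi : dlt d psi -> dlt d (ddt psi).
Proof.
case: d => [/dlt0_eq0 ->|d H]; first by rewrite ddt0; apply: dlt0.
apply: dlt_sum => j _; apply: dltD.
  by apply: (dlt_eta (d := d)); apply: (dlt_dt (d := d.+1)).
by apply: (dlt_t (d := d)); apply: (dlt_eps (d := d.+1)).
Qed.

Lemma hdegp_eta l j psi : hdegp l psi -> hdeg l (eta_op j psi).
Proof.
by move=> H; rewrite etaE; apply: hdeg_sum => a _; apply/hdeg_fZ/hdegp_fmul.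
Qed.

Lemma hdeg_eta l j psi : hdeg l psi -> hdeg l.+1 (eta_op j psi).
Proof. by move=> /hdegpS /hdegp_eta. Qed.

Lemma hdegp_del l j psi : hdeg l psi -> hdegp l (del_op j psi).
Proof.
by move=> H; apply: hdegp_sum => a _; apply/hdegp_fcontract/hdeg_pderiv.
Qed.

Lemma hdegp_eps l j psi : hdegp l psi -> hdeg l (eps_op j psi).
Proof.
by move=> H; apply: hdeg_sum => a _; apply/hdegp_fmul/hdegp_pderiv.
Qed.

Lemma hdegp_koszul l psi : hdegp l psi -> hdeg l (koszul psi).
Proof.
by move=> H; apply: hdeg_sum => j _; apply/hdeg_fZ/hdegp_eta.
Qed.

Lemma hdegp_koszul_adj l psi : hdeg l psi -> hdegp l (koszul_adj psi).
Proof. by move=> H; apply: hdegp_sum => j _; apply/hdegp_del/hdeg_pderiv. Qed.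

Lemma hdegp_ddt l psi : hdegp l psi -> hdeg l (ddt psi).
Proof.
move=> H; apply: hdeg_sum => j _; apply: hdegD; last exact/hdeg_fZ/hdegp_eps.
exact/hdegp_eta/hdegp_pderiv.
Qed.

Lemma hdegp_dd l psi : hdegp l psi -> hdeg l (dd psi).
Proof.
move=> H; apply: hdegB; first exact: hdegp_ddt.
exact/hdeg_fZ/hdegp_koszul.
Qed.

(** The matrix of the action on the exterior algebra has constant entries; this is why the action
    commutes with taking homogeneous components. *)
Lemma ext_map_cmx (g : 'M[C]_n) : exists c : {set 'I_n} -> {set 'I_n} -> C,
  forall (chi : K) J, ext_map (cmx k g) (chi : ext P n) J =
    \sum_I mpolyC N (c I J) * chi I.
Proof.
have W I : forall J, exists c, ext_map (cmx k g) (ext_basis P I) J = mpolyC N c.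
  rewrite ext_map_word /word; elim: index_enum => [J|i s IH J] /=.
    exists (J == finset.set0)%:R; rewrite ffunE; exact: (esym (rmorph_nat _ _)).
  case: ifP => _; last exact: IH.
  rewrite /rot_mul /rot_op sum_ffunE.
  elim/big_rec: _ => [|b p _ [c ->]]; first by exists 0; rewrite mpolyC0.
  rewrite ffunE mxE ext_mulE; case: ifP => bJ; last first.
    by exists c; rewrite -[_ *: _]/(_ * _) mulr0 add0r.
  have [c' E] := IH (J :\ b).
  exists (g b i * ((-1) ^+ below J b * c') + c).
  rewrite mpolyCD !mpolyCM -E; congr (_ * (_ * _) + _).
  by rewrite !rmorphXn /= !rmorphN1.
have [c cE] : exists c : {set 'I_n} -> {set 'I_n} -> C, forall I J,
    ext_map (cmx k g) (ext_basis P I) J = mpolyC N (c I J).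
  have [c cE] := choice (fun IJ : {set 'I_n} * {set 'I_n} => W IJ.1 IJ.2).
  by exists (fun I J => c (I, J)) => I J; rewrite -(cE (I, J)).
exists c => chi J; rewrite {1}[chi : ext P n]ext_expand linear_sum sum_ffunE.
by apply: eq_bigr => I _; rewrite linearZ ffunE cE -[_ *: _]/(_ * _) mulrC.
Qed.

Lemma pihomog_subst d (g : 'M[C]_n) (p : P) :
  pihomog mdeg d (subst g p) = subst g (pihomog mdeg d p).
Proof.
have hX (v : 'I_N) : subst g (mpolyX C (mnm1 v)) \is @ishomog1 N C 1%N mdeg.
  elim/var_ind: v => [a j|j].
    rewrite [subst g _]subst_x; apply: rpred_sum => b _.
    by rewrite mul_mpolyC; apply: dhomogZ; rewrite [_ \in _]dhomogX; apply/eqP/mdeg1.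
  by rewrite [subst g _]subst_t dhomogX; apply/eqP/mdeg1.
have hM m : subst g (mpolyX C m) \is @ishomog1 N C (mdeg m) mdeg.
  rewrite mpolyXE_id rmorph_prod mdegE.
  elim: index_enum => [|v s IH]; first by rewrite !big_nil; exact: dhomog1.
  rewrite !big_cons; apply: dhomogM IH; rewrite rmorphXn /=.
  by have := dhomogMn (m v) (hX v); rewrite mul1n.
have substZ c (q : P) : subst g (c *: q) = c *: subst g q.
  by rewrite -!mul_mpolyC substM substC.
elim/mpolyind: p => [|c m p _ _ IH].
  by rewrite (raddf0 (subst g)) pihomog0 (raddf0 (subst g)).
rewrite substD !pihomogD substD IH; congr (_ + _).
have piZ e q : pihomog mdeg d (e *: q : P) = e *: pihomog mdeg d q.
  exact: linearZ.
rewrite substZ !piZ substZ pihomogX; congr (_ *: _).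
have [<-|md] := eqVneq (mdeg m) d; first by rewrite pihomog_dE.
by rewrite (raddf0 (subst g)); exact: pihomog_ne0 md (hM m).
Qed.

Lemma pid_act d (g : 'M[C]_n) psi : pid d (act g psi) = act g (pid d psi).
Proof.
have [c cE] := ext_map_cmx g; apply: polyformP => J m.
rewrite pid_coeff !actE.
apply: etrans (congr1 (fun z => if mdeg m == d then mcoeff m z else 0)
  (cE (subst_form g psi) J)) _.
apply: etrans _ (esym (congr1 (mcoeff m) (cE (subst_form g (pid d psi)) J))).
rewrite !(big_morph _ (mcoeffD m) (mcoeff0 _ m)).
transitivity (\sum_I if mdeg m == d then
    mcoeff m (mpolyC N (c I J) * subst_form g psi I) else 0).
  by case: ifP => _ //; rewrite big1.
apply: eq_bigr => I _; rewrite !mcoeffCM /subst_form !ffunE pid.unlock ffunE.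
by rewrite -pihomog_subst mcoeff_pihomog; case: ifP => _ //; rewrite mulr0.
Qed.

End Degree.

(** * Infinitesimal invariance *)

Section Jets.
Variable R : realType.
Local Notation C := R[i].
Local Open Scope complex_scope.
Implicit Types (phi chi : R -> C) (p q : C) (u : R).

Definition bounded1 phi := exists M : R, forall u, `|u| <= 1 -> `|phi u| <= M%:C.

(** Value p and derivative q at u = 0, with a second-order remainder bounded for |u| <= 1. Sums and
    products of jets are purely algebraic, and limits occur only in the guise of [jet_uniq]. *)
Definition jet phi p q := exists2 chi, bounded1 chi &
  forall u, `|u| <= 1 -> phi u = p + u%:C * q + u%:C ^+ 2 * chi u.

Lemma bounded1_cst p : bounded1 (fun=> p).
Proof. by exists (complex.Re `|p|) => u _; rewrite RRe_real// normr_real. Qed.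

Lemma norm_realC u : `|u%:C| = `|u|%:C :> C.
Proof. by rewrite normc_def /= expr0n addr0 sqrtr_sqr. Qed.

Lemma bounded1_real (f : R -> R) (M : R) :
  (forall u, `|u| <= 1 -> `|f u| <= M) -> bounded1 (fun u => (f u)%:C).
Proof. by move=> fM; exists M => u /fM fu; rewrite norm_realC lecR. Qed.

Lemma bounded1D phi chi :
  bounded1 phi -> bounded1 chi -> bounded1 (fun u => phi u + chi u).
Proof.
move=> [M HM] [M' HM']; exists (M + M') => u u1.
by rewrite rmorphD (le_trans (ler_normD _ _))// lerD ?HM ?HM'.
Qed.

Lemma bounded1M phi chi :
  bounded1 phi -> bounded1 chi -> bounded1 (fun u => phi u * chi u).
Proof.
move=> [M HM] [M' HM']; exists (M * M') => u u1.
by rewrite rmorphM normrM ler_pM ?HM ?HM'.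
Qed.

Lemma bounded1_id : bounded1 (fun u => u%:C).
Proof. exact: (@bounded1_real id 1). Qed.

Lemma jet_cst p : jet (fun=> p) p 0.
Proof.
exists (fun=> 0); first exact: bounded1_cst.
by move=> u _; rewrite !mulr0 !addr0.
Qed.

Lemma jetD phi chi p q p' q' :
  jet phi p q -> jet chi p' q' -> jet (fun u => phi u + chi u) (p + p') (q + q').
Proof.
move=> [f bf Ef] [h bh Eh]; exists (fun u => f u + h u); first exact: bounded1D.
move=> u u1; rewrite Ef// Eh// !mulrDr.
by rewrite [LHS]addrACA; congr (_ + _); rewrite addrACA.
Qed.

Lemma jetM phi chi p q p' q' : jet phi p q -> jet chi p' q' ->
  jet (fun u => phi u * chi u) (p * p') (q * p' + p * q').
Proof.
move=> [f bf Ef] [h bh Eh].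
exists (fun u => (q * q' + (p * h u + f u * p')) +
   (u%:C * (q * h u + f u * q') + u%:C * (u%:C * (f u * h u)))).
  by do ?[apply: bounded1D|apply: bounded1M|apply: bounded1_cst|
    apply: bounded1_id] => //.
by move=> u u1; rewrite Ef// Eh//; ring.
Qed.

Lemma jet_sum (I : finType) (F : I -> R -> C) P Q :
  (forall i, jet (F i) (P i) (Q i)) ->
  jet (fun u => \sum_i F i u) (\sum_i P i) (\sum_i Q i).
Proof.
move=> H; elim: (index_enum I) => [|i s IH].
  by rewrite !big_nil; under eq_fun do rewrite big_nil; apply: jet_cst.
by rewrite !big_cons; under eq_fun do rewrite big_cons; apply: jetD.
Qed.

Lemma jet_eq phi chi p q : phi =1 chi -> jet phi p q -> jet chi p q.
Proof. by move=> E; rewrite (funext E). Qed.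

Lemma jet_uniq p q : jet (fun=> p) p q -> q = 0.
Proof.
move=> [chi [M HM] E]; apply/eqP; apply/negPn/negP => q0.
pose r := complex.Re `|q|; have rE : r%:C = `|q| by rewrite RRe_real// normr_real.
have r0 : 0 < r by rewrite -ltcR rE normr_gt0.
have M0 : 0 <= M.
  by rewrite -lecR (le_trans (normr_ge0 (chi 0)))// HM// normr0.
(* Positive, at most 1, and so small that u M < r; this contradicts r = |q| = u |chi u| <= u M. *)
pose u := r / (M + 1 + r).
have D0 : 0 < M + 1 + r by rewrite addr_gt0// ltr_wpDl.
have u0 : 0 < u by rewrite divr_gt0.
have u1 : `|u| <= 1.
  by rewrite gtr0_norm// ler_pdivrMr// mul1r lerDr addr_ge0.
have := E u u1; rewrite -addrA -[LHS]addr0 => /addrI /esym/eqP.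
rewrite expr2 -mulrA -mulrDr mulf_eq0 => /orP[|].
  by rewrite (inj_eq (@complexI R)) gt_eqF.
rewrite addr_eq0 => /eqP qE.
have : `|q| <= (u * M)%:C.
  by rewrite qE normrN normrM norm_realC (gtr0_norm u0) (rmorphM (real_complex R) u M) ler_wpM2l ?HM// ler0c ltW.
rewrite -rE lecR /u mulrAC ler_pdivlMr// ler_pM2l//.
by rewrite leNgt -addrA ltrDl addr_gt0.
Qed.

End Jets.

Lemma mderiv_eq0 (C : numClosedFieldType) N (p : mpoly N C) :
  (forall v, mderiv v p = 0) -> p = mpolyC N (mcoeff (mnm0 (n:=N)) p).
Proof.
move=> dp; apply/mpolyP => m; rewrite mcoeffC; have [->|m0] := eqVneq m mnm0.
  by rewrite mulr1.
rewrite mulr0; have [v mv] : exists v, (0 < m v)%N.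
  apply/existsP; apply: contraNT m0 => /existsPn H; apply/eqP/mnmP => v.
  by rewrite mnm0E; apply/eqP; rewrite -leqn0 leqNgt.
have := congr1 (mcoeff (mnm_sub m (mnm1 v))) (dp v).
rewrite mcoeff_deriv sub_mnm1K// mcoeff0 => /eqP; rewrite mulrn_eq0 /=.
by move/eqP.
Qed.

(** * Polynomials that vanish at all real points *)

Section Vanishing.
Variables (R : realType) (N : nat).
Local Notation C := R[i].
Local Open Scope complex_scope.
Implicit Types (p q : mpoly N C) (z : 'I_N -> C) (v w : 'I_N).

Lemma jet_line p z v :
  jet (fun u => meval (fun w => z w + (v == w)%:R * u%:C) p)
    (meval z p) (meval z (mderiv v p)).
Proof.
move: p; apply: mpoly_gen_ind => [c|w|p q Jp Jq|p q Jp Jq].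
- rewrite mderivC meval0 mevalC; apply: jet_eq (jet_cst c) => u.
  by rewrite mevalC.
- rewrite mderiv_var mevalXU -(mpolyC_nat) mevalC.
  exists (fun=> 0); first exact: bounded1_cst.
  by move=> u _; rewrite mevalXU mulr0 addr0 mulrC.
- rewrite mderivD !mevalD; apply: jet_eq (jetD Jp Jq) => u.
  by rewrite mevalD.
- rewrite mderivM mevalD !mevalM; apply: jet_eq (jetM Jp Jq) => u.
  by rewrite mevalM.
Qed.

(** Jets along real lines show that the partial derivatives vanish at all real points too, so an
    induction on the degree leaves only a constant. *)
Lemma meval_eq0 p : (forall x : 'I_N -> R, meval (fun v => (x v)%:C) p = 0) ->
  p = 0.
Proof.
have [D pD] : exists D, forall m, (D <= mdeg m)%N -> mcoeff m p = 0.
  exists (msize p) => m /msize_mdeg_ge; exact: memN_msupp_eq0.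
elim: D p pD => [|D IH] p pD p0; first by apply/mpolyP => m; rewrite pD ?mcoeff0.
have dp v : mderiv v p = 0.
  apply: IH => [m mD|x].
    by rewrite mcoeff_deriv pD ?mul0rn// mdegD mdeg1 addn1.
  apply: (@jet_uniq _ 0); rewrite -[X in jet _ X _](p0 x).
  apply: jet_eq (jet_line p _ v) => u.
  rewrite -[RHS](p0 (fun w => x w + (v == w)%:R * u)); apply: meval_eq => w.
  by rewrite rmorphD rmorphM rmorph_nat.
have pC := mderiv_eq0 dp.
by have := p0 (fun=> 0); rewrite pC mevalC => ->; rewrite mpolyC0.
Qed.

End Vanishing.

(** * A rational path of rotations *)

Section Rotation.
Variables (R : realType) (n : nat) (a b : 'I_n).
Hypothesis ab : a != b.
Local Notation C := R[i].
Local Open Scope complex_scope.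

Definition rot_gen : 'M[R]_n := delta_mx a b - delta_mx b a.
Definition rot_proj : 'M[R]_n := delta_mx a a + delta_mx b b.
Definition rot_mx (c s : R) : 'M[R]_n :=
  1%:M + ((c - 1) *: rot_proj + s *: rot_gen).

Lemma rot_mx_orthogonal c s : c ^+ 2 + s ^+ 2 = 1 ->
  rot_mx c s *m (rot_mx c s)^T = 1%:M.
Proof.
move=> cs.
have ba : (b == a) = false by rewrite eq_sym (negPf ab).
have DD : rot_proj *m rot_proj = rot_proj.
  rewrite /rot_proj mulmxDl !mulmxDr !mul_delta_mx_cond !eqxx (negPf ab) ba.
  by rewrite !mulr1n !mulr0n addr0 add0r.
have XX : rot_gen *m rot_gen = - rot_proj.
  rewrite /rot_gen /rot_proj mulmxBl !mulmxBr !mul_delta_mx_cond !eqxx (negPf ab) ba.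
  by rewrite !mulr1n !mulr0n subr0 !sub0r opprD.
have DX : rot_proj *m rot_gen = rot_gen.
  rewrite /rot_gen /rot_proj mulmxDl !mulmxBr !mul_delta_mx_cond !eqxx (negPf ab) ba.
  by rewrite !mulr1n !mulr0n subr0 !sub0r.
have XD : rot_gen *m rot_proj = rot_gen.
  rewrite /rot_gen /rot_proj mulmxBl !mulmxDr !mul_delta_mx_cond !eqxx (negPf ab) ba.
  by rewrite !mulr1n !mulr0n addr0 !add0r.
have DT : rot_proj^T = rot_proj by rewrite /rot_proj linearD /= !trmx_delta.
have XT : rot_gen^T = - rot_gen by rewrite /rot_gen linearB /= !trmx_delta opprB.
rewrite /rot_mx; move: rot_proj rot_gen DD XX DX XD DT XT => D X DD XX DX XD DT XT.
have -> : (1%:M + ((c - 1) *: D + s *: X))^T = 1%:M + ((c - 1) *: D - s *: X).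
  by rewrite !linearD /= trmx1 !linearZ /= DT XT scalerN.
rewrite mulmxDl mul1mx mulmxDr mulmx1 mulmxDl !mulmxBr.
rewrite -!scalemxAl -!scalemxAr DD XX DX XD; apply/matrixP => i j; rewrite !mxE.
have -> : s * (s * - D i j) = - (1 - c ^+ 2) * D i j by rewrite -cs; ring.
by ring.
Qed.

(** The rational parametrisation of the circle makes the entries rational in u. Squaring the
    rotation h gives determinant 1 at once, since det h det h = det (h h^T). The velocity at 0 is
    twice the generator for h, hence four times for the square. *)
Definition rot_path (u : R) : 'M[R]_n :=
  let h := rot_mx ((1 - u ^+ 2) / (1 + u ^+ 2)) (2%:R * u / (1 + u ^+ 2)) in
  h *m h.

Lemma rot_path_SO u : special_orthogonal_mx (rot_path u).
Proof.
have D0 : 1 + u ^+ 2 != 0 by rewrite gt_eqF// ltr_wpDr// sqr_ge0.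
have hO := @rot_mx_orthogonal ((1 - u ^+ 2) / (1 + u ^+ 2))
  (2%:R * u / (1 + u ^+ 2)) _.
rewrite /rot_path; move: hO; set h := rot_mx _ _ => hO.
have {}hO : h *m h^T = 1%:M by apply: hO; field.
split; first by rewrite /orthogonal_mx trmx_mul mulmxA -(mulmxA h) hO mulmx1.
by rewrite det_mulmx -[X in _ * X]det_tr -det_mulmx hO det1.
Qed.

Lemma rot_path_jet e d : jet (fun u => (rot_path u e d)%:C)
  (e == d)%:R (4%:R * (rot_gen e d)%:C).
Proof.
have bu : bounded1 (fun u : R => (1 + u ^+ 2)^-1%:C).
  apply: (@bounded1_real _ _ 1) => u _.
  have D0 : 0 < 1 + u ^+ 2 by rewrite ltr_wpDr// sqr_ge0.
  by rewrite gtr0_norm ?invr_gt0// invf_le1// lerDl sqr_ge0.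
have hj e' d' : jet (fun u : R =>
    (rot_mx ((1 - u ^+ 2) / (1 + u ^+ 2)) (2%:R * u / (1 + u ^+ 2)) e' d')%:C)
    (e' == d')%:R (2%:R * (rot_gen e' d')%:C).
  exists (fun u => (1 + u ^+ 2)^-1%:C *
    (- 2%:R * (rot_proj e' d')%:C + - 2%:R * (rot_gen e' d')%:C * u%:C)).
    apply: bounded1M => //; apply: bounded1D; first exact: bounded1_cst.
    by apply: bounded1M; [exact: bounded1_cst|exact: bounded1_id].
  move=> u _; have D0 : 1 + u ^+ 2 != 0 by rewrite gt_eqF// ltr_wpDr// sqr_ge0.
  have -> : rot_mx ((1 - u ^+ 2) / (1 + u ^+ 2)) (2%:R * u / (1 + u ^+ 2)) e' d'
    = (e' == d')%:R + u * (2%:R * rot_gen e' d') + u ^+ 2 * ((1 + u ^+ 2)^-1 *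
       (- 2%:R * rot_proj e' d' + - 2%:R * rot_gen e' d' * u)).
    by rewrite !mxE; move: (_ == d')%:R => z; field.
  by rewrite !(rmorphD, rmorphM, rmorphN, rmorphXn, rmorph_nat).
have -> : (e == d)%:R = \sum_j (e == j)%:R * (j == d)%:R :> C.
  rewrite (bigD1 e)//= eqxx mul1r big1 ?addr0// => j je.
  by rewrite eq_sym (negPf je) mul0r.
have -> : 4%:R * (rot_gen e d)%:C = \sum_j (2%:R * (rot_gen e j)%:C * (j == d)%:R
    + (e == j)%:R * (2%:R * (rot_gen j d)%:C)) :> C.
  rewrite big_split /= (bigD1 d)//= eqxx mulr1 big1 ?addr0 => [|j jd]; last first.
    by rewrite (negPf jd) mulr0.
  rewrite (bigD1 e)//= eqxx mul1r big1 ?addr0 => [|j je]; last first.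
    by rewrite eq_sym (negPf je) mul0r.
  by rewrite -mulrDl -natrD.
apply: jet_eq (jet_sum (fun j => jetM (hj e j) (hj j d))) => u.
rewrite /rot_path mxE rmorph_sum; apply: eq_bigr => j _.
exact: (esym (rmorphM _ _ _)).
Qed.

End Rotation.

Lemma sum_delta (A : pzRingType) (V : lmodType A) (I : finType) (i : I)
    (c : bool) (F : I -> V) :
  \sum_e ((e == i) && c)%:R *: F e = c%:R *: F i.
Proof.
rewrite (bigD1 i)//= eqxx big1 ?addr0// => e /negPf->.
by rewrite scale0r.
Qed.

(** * From invariance under rotations to the Lie derivative *)

Section Lie.
Variables (R : realType) (n k : nat).
Local Notation C := R[i].
Local Notation N := ((n + 1) * k)%N.
Local Notation P := (mpoly N C).
Local Notation K := (polyform C N n).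
Local Open Scope complex_scope.
Implicit Types (a b d : 'I_n) (i j : 'I_k) (psi chi : K) (p q : P).

Definition rotp a b p : P :=
  \sum_i (@xpol C n k a i * mderiv (xvar b i) p - @xpol C n k b i * mderiv (xvar a i) p).

Lemma rotpD a b p q : rotp a b (p + q) = rotp a b p + rotp a b q.
Proof.
rewrite /rotp -big_split; apply: eq_bigr => i _ /=.
by rewrite !mderivD !mulrDr opprD addrACA.
Qed.

Lemma rotpM a b p q : rotp a b (p * q) = rotp a b p * q + p * rotp a b q.
Proof.
rewrite /rotp mulr_suml mulr_sumr -big_split; apply: eq_bigr => i _ /=.
by rewrite !mderivM; ring.
Qed.

Lemma rotpC a b c : rotp a b (mpolyC N c) = 0.
Proof. by rewrite /rotp big1// => i _; rewrite !mderivC !mulr0 subr0. Qed.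

Lemma rotp_t a b j : rotp a b (@tpol C n k j : P) = 0.
Proof.
by rewrite /rotp big1// => i _; rewrite !mderiv_var !xvar_tvar !mulr0 subr0.
Qed.

Lemma rotp_x a b d j : rotp a b (@xpol C n k d j : P) =
  \sum_e mpolyC N (rot_gen R a b e d)%:C * (@xpol C n k e j : P).
Proof.
transitivity ((b == d)%:R * @xpol C n k a j - (a == d)%:R * @xpol C n k b j).
  rewrite /rotp (bigD1 j)//= big1 ?addr0 => [|i ij].
    by rewrite !mderiv_var !xvar_eq !eqxx !andbT mulrC [@xpol C n k b j * _]mulrC.
  by rewrite !mderiv_var !xvar_eq (negPf ij) !andbF !mulr0 subr0.
transitivity (\sum_e (((e == a) && (b == d))%:R * @xpol C n k e j -
   ((e == b) && (a == d))%:R * @xpol C n k e j : P)).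
  rewrite sumrB (bigD1 a)//= eqxx big1 ?addr0 => [|e /negPf->]; last by rewrite mul0r.
  rewrite (bigD1 b)//= eqxx big1 ?addr0// => e /negPf->; by rewrite mul0r.
apply: eq_bigr => e _; rewrite !mxE -mulrBl; congr (_ * _).
rewrite rmorphB !rmorph_nat mpolyCB !mpolyC_nat.
by rewrite ![d == _]eq_sym.
Qed.

Lemma lieZ a b p psi : lie a b (p *: psi) = rotp a b p *: psi + p *: lie a b psi.
Proof.
rewrite /lie !fcontractZ !fmulZ -scalerBr [p *: (rotl _ _ _ + _)]scalerDr addrA; congr (_ + _).
rewrite /rotl /rotp scaler_suml scaler_sumr -big_split; apply: eq_bigr => i _ /=.
rewrite [dx b i _]pderivM [dx a i _]pderivM [p *: (_ - _)]scalerBr !scalerDr opprD scalerBl !scalerA.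
by rewrite addrACA [p * @xpol C n k a i]mulrC [p * @xpol C n k b i]mulrC.
Qed.

Lemma lie_fmul a b d psi : lie a b (fmul d psi) =
  \sum_e mpolyC N (rot_gen R a b e d)%:C *: fmul e psi + fmul d (lie a b psi).
Proof.
have rotl_fmul : rotl a b (fmul d psi) = fmul d (rotl a b psi).
  rewrite /rotl fmul_sum; apply: eq_bigr => i _.
  by rewrite !dx_mul fmulB !fmulZ.
have E e e' : fmul e (fcontract e' (fmul d psi)) =
    (e' == d)%:R *: fmul e psi + fmul d (fmul e (fcontract e' psi)).
  rewrite fcontract_mul fmulB fmulZ; congr (_ + _).
  by rewrite fmul_anti opprK.
rewrite /lie rotl_fmul !E fmulD fmulB.
rewrite opprD addrACA [LHS]addrCA; congr (_ + _).
transitivity (\sum_e (((e == a) && (b == d))%:R *: fmul e psi -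
   ((e == b) && (a == d))%:R *: fmul e psi)).
  by rewrite sumrB (sum_delta _ _ (fun e => fmul e psi)) (sum_delta _ _ (fun e => fmul e psi)).
apply: eq_bigr => e _; rewrite !mxE -scalerBl; congr (_ *: _).
rewrite rmorphB !rmorph_nat mpolyCB !mpolyC_nat.
by rewrite ![d == _]eq_sym.
Qed.

Lemma lie1 a b : lie a b (ext1 : K) = 0.
Proof.
have c1 e : fcontract e (ext1 : K) = 0 by rewrite fcontract.unlock contract1.
rewrite /lie !c1 !fmul0 subrr addr0 /rotl big1// => i _.
by rewrite /dx !pderiv_const ?inE ?eqxx// !scaler0 subr0.
Qed.

Lemma lieD a b : {morph @lie C n k a b : x y / x + y}.
Proof.
move=> x y; rewrite /lie !fcontractD !fmulD opprD [X in _ + X]addrACA.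
rewrite [RHS]addrACA; congr (_ + _); rewrite /rotl -big_split; apply: eq_bigr => i _.
by rewrite !dxD !scalerDr opprD addrACA.
Qed.

Lemma polyform_ind (Q : K -> Prop) : Q ext1 ->
  (forall a psi, Q psi -> Q (fmul a psi)) ->
  (forall p psi, Q psi -> Q (p *: psi)) ->
  (forall psi chi, Q psi -> Q chi -> Q (psi + chi)) -> forall psi, Q psi.
Proof.
move=> Q1 Qm QZ QD psi; rewrite [psi : ext P n]ext_expand.
have Qb : forall I, Q (ext_basis P I).
  refine (@ext_basis_ind P n Q Q1 _) => a v /(Qm a).
  by rewrite fmul.unlock.
have Q0 : Q 0 by rewrite -(scale0r (ext1 : K)); exact: QZ.
elim: index_enum => [|I s IH]; first by rewrite big_nil.
rewrite big_cons; apply: (QD) IH; rewrite -polyformZ; exact: (QZ).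
Qed.

Section Jet.
Variables (a b : 'I_n) (G : R -> 'M[R]_n) (z : 'I_N -> C).
Hypothesis Gjet : forall e d, jet (fun u => (G u e d)%:C)
  (e == d)%:R (4%:R * (rot_gen R a b e d)%:C).

Definition gmx u : 'M[C]_n := map_mx (real_complex R) (G u).

Lemma jet_subst p : jet (fun u => meval z (subst (gmx u) p))
  (meval z p) (4%:R * meval z (rotp a b p)).
Proof.
pose Q p := jet (fun u => meval z (subst (gmx u) p))
  (meval z p) (4%:R * meval z (rotp a b p)).
move: p; refine (@coord_ind C n k Q _ _ _ _ _) => [c|d j|j|p q Jp Jq|p q Jp Jq];
  rewrite /Q.
- rewrite rotpC meval0 mulr0 mevalC.
  by apply: jet_eq (jet_cst c) => u; rewrite substC mevalC.
- rewrite rotp_x.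
  have -> : meval z (@xpol C n k d j) = \sum_e (e == d)%:R * meval z (@xpol C n k e j).
    rewrite (bigD1 d)//= eqxx mul1r big1 ?addr0// => e /negPf->.
    by rewrite mul0r.
  have -> : 4%:R * meval z (\sum_e mpolyC N (rot_gen R a b e d)%:C * @xpol C n k e j) =
      \sum_e (4%:R * (rot_gen R a b e d)%:C * meval z (@xpol C n k e j) + (e == d)%:R * 0).
    rewrite raddf_sum mulr_sumr; apply: eq_bigr => e _ /=.
    by rewrite mevalM mevalC mulr0 addr0 mulrA.
  apply: jet_eq (jet_sum (fun e => jetM (Gjet e d) (jet_cst (meval z (@xpol C n k e j))))) => u.
  rewrite subst_x raddf_sum; apply: eq_bigr => e _ /=.
  by rewrite mevalM mevalC mxE.
- rewrite rotp_t meval0 mulr0.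
  by apply: jet_eq (jet_cst _) => u; rewrite subst_t.
- rewrite rotpD !mevalD mulrDr; apply: jet_eq (jetD Jp Jq) => u.
  by rewrite substD mevalD.
- rewrite rotpM mevalD !mevalM mulrDr [4%:R * (_ * _)]mulrA.
  rewrite [4%:R * (meval z p * _)]mulrCA; apply: jet_eq (jetM Jp Jq) => u.
  by rewrite substM mevalM.
Qed.

Definition form_jet (F : R -> K) psi chi := forall I,
  jet (fun u => meval z (F u I)) (meval z (psi I)) (meval z (chi I)).

(** The action is multiplicative and [lie] obeys product rules, so an induction over generators
    suffices; the path [G] enters only through its jet at 0. *)
Lemma form_jet_act psi :
  form_jet (fun u => act (gmx u) psi) psi (4%:R *: lie a b psi).
Proof.
pose Q psi := form_jet (fun u => act (gmx u) psi) psi (4%:R *: lie a b psi).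
move: psi; refine (polyform_ind (Q := Q) _ _ _ _) => [|d psi J|p psi J|psi chi J J'] I.
- rewrite lie1 scaler0 [X in jet _ _ (meval _ X)]ffunE meval0.
  apply: jet_eq (jet_cst _) => u.
  by rewrite act_ext1.
- have -> : meval z (fmul d psi I) = \sum_e (e == d)%:R * meval z (fmul e psi I).
    rewrite (bigD1 d)//= eqxx mul1r big1 ?addr0// => e /negPf->.
    by rewrite mul0r.
  have Je e : jet (fun u => meval z (fmul e (act (gmx u) psi) I))
      (meval z (fmul e psi I)) (meval z (fmul e (4%:R *: lie a b psi) I)).
    have E chi : meval z (fmul e chi I) = (if e \in I then (-1) ^+ below I e else 0)
       * meval z (chi (I :\ e)).
      rewrite fmulE; case: ifP => _; last by rewrite meval0 mul0r.
      by rewrite mevalM rmorphXn rmorphN1.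
    have := jetM (jet_cst (if e \in I then (-1) ^+ below I e else 0)) (J (I :\ e)).
    rewrite mul0r add0r -!E; apply: jet_eq => u; exact: (esym (E _)).
  have := jet_sum (fun e => jetM (Gjet e d) (Je e)).
  set S := (X in jet _ _ X -> _).
  have -> : S = meval z ((4%:R *: lie a b (fmul d psi)) I).
    rewrite lie_fmul scalerDr scaler_sumr.
    have E (x y : K) : (x + y) I = x I + y I by rewrite !ffunE.
    rewrite E mevalD sum_ffunE raddf_sum /=.
    rewrite /S big_split /=; congr (_ + _).
      by apply: eq_bigr => e _; rewrite scalerA polyformZE !mevalM -(mpolyC_nat N C 4) !mevalC.
    rewrite (bigD1 d)//= eqxx mul1r big1 ?addr0; last first.
      by move=> e /negPf->; rewrite mul0r.
    by rewrite fmulZ.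
  apply: jet_eq => u; rewrite act_fmul sum_ffunE raddf_sum; apply: eq_bigr => e _ /=.
  by rewrite polyformZE mevalM mevalC mxE.
- have := jetM (jet_subst p) (J I).
  have -> : 4%:R * meval z (rotp a b p) * meval z (psi I) +
      meval z p * meval z ((4%:R *: lie a b psi) I) =
      meval z ((4%:R *: lie a b (p *: psi)) I).
    have E (x y : K) : (x + y) I = x I + y I by rewrite !ffunE.
    rewrite lieZ !polyformZE (E (_ *: _)) !polyformZE -(mpolyC_nat N C 4) !mevalM.
    by rewrite mevalD !mevalM mevalC; ring.
  rewrite -mevalM -(polyformZE p); apply: jet_eq => u.
  by rewrite actZ polyformZE mevalM.
- rewrite lieD scalerDr; have E (x y : K) : meval z ((x + y) I) = meval z (x I) + meval z (y I).
    by rewrite !ffunE mevalD.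
  by rewrite !E; apply: jet_eq (jetD (J I) (J' I)) => u; rewrite actD E.
Qed.

End Jet.

(** Along [rot_path] the transforms of an invariant form are constant, so by uniqueness of jets four
    times the Lie derivative vanishes at every real point. *)
Lemma lie_invariant psi :
  (forall g : 'M[R]_n, special_orthogonal_mx g ->
     act (map_mx (real_complex R) g) psi = psi) ->
  forall a b, lie a b psi = 0.
Proof.
move=> psiI a b; have [->|ab] := eqVneq a b.
  by rewrite /lie subrr addr0 /rotl big1// => i _; rewrite subrr.
apply/ffunP => I; rewrite [RHS]ffunE; apply: meval_eq0 => x.
set z := fun v => _; apply/eqP.
have n4 : 4%:R != 0 :> C by rewrite pnatr_eq0.
rewrite -[X in X == _]mul1r -(mulVf n4) -mulrA mulf_eq0; apply/orP; right.
apply/eqP/(@jet_uniq _ (meval z (psi I))).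
have := form_jet_act z (@rot_path_jet R n a b) psi I.
rewrite polyformZE mevalM -(mpolyC_nat N C 4) mevalC.
by apply: jet_eq => u; rewrite psiI//; apply: rot_path_SO.
Qed.

End Lie.

(** * Invariant forms *)

Section Invariant.
Variables (C : numClosedFieldType) (n k : nat) (O : 'M[C]_n -> Prop).
Local Notation N := ((n + 1) * k)%N.
Local Notation P := (mpoly N C).
Local Notation K := (polyform C N n).
Implicit Types (a b d : 'I_n) (i j : 'I_k) (psi chi u : K) (p q f : P).
Implicit Types (J : {set 'I_k}) (I : {set 'I_n}).

Hypothesis O_orth : forall g, O g -> g^T *m g = 1%:M.

(** Forms are tested against the elements of determinant 1 only, coefficients against all of [O],
    which later becomes the set of real orthogonal matrices seen over the complex numbers. *)
Definition so_inv psi := forall g, O g -> \det g = 1 -> act g psi = psi.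
Definition o_inv f := forall g, O g -> subst g f = f.

Lemma inv_subsp : subsp so_inv.
Proof.
split=> [g _ _|x y xI yI g gO g1|c x xI g gO g1]; first exact: act0.
  by rewrite actD xI// yI.
by rewrite actC xI.
Qed.

Lemma inv_eta j psi : so_inv psi -> so_inv (eta_op j psi).
Proof. by move=> H g gO g1; rewrite act_eta ?H// O_orth. Qed.

Lemma inv_iot j psi : so_inv psi -> so_inv (iot_op j psi).
Proof. by move=> H g gO g1; rewrite act_iot ?H// O_orth. Qed.

Lemma inv_del j psi : so_inv psi -> so_inv (del_op j psi).
Proof. by move=> H g gO g1; rewrite act_del ?H// O_orth. Qed.

Lemma inv_eps j psi : so_inv psi -> so_inv (eps_op j psi).
Proof. by move=> H g gO g1; rewrite act_eps ?H// O_orth. Qed.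

Lemma inv_lap i j psi : so_inv psi -> so_inv (lap_op i j psi).
Proof. by move=> H g gO g1; rewrite act_lap ?H// O_orth. Qed.

Lemma inv_dt j psi : so_inv psi -> so_inv (dt j psi).
Proof. by move=> H g gO g1; rewrite act_dt H. Qed.

Lemma inv_scale f psi : o_inv f -> so_inv psi -> so_inv (f *: psi).
Proof. by move=> fO H g gO g1; rewrite actZ H// fO. Qed.

Lemma inv_koszul psi : so_inv psi -> so_inv (koszul psi).
Proof. by move=> H g gO g1; rewrite act_koszul ?H// O_orth. Qed.

Lemma inv_koszul_adj psi : so_inv psi -> so_inv (koszul_adj psi).
Proof. by move=> H g gO g1; rewrite act_koszul_adj ?H// O_orth. Qed.

Lemma inv_ddt psi : so_inv psi -> so_inv (ddt psi).
Proof. by move=> H g gO g1; rewrite act_ddt ?H// O_orth. Qed.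

Lemma inv_pid (D : nat) psi : so_inv psi -> so_inv (pid D psi).
Proof. by move=> H g gO g1; rewrite -pid_act H. Qed.

Lemma o_inv_gram i j : o_inv (gram i j).
Proof. by move=> g gO; rewrite subst_gram ?O_orth. Qed.

Lemma o_inv_t j : o_inv (tpol j).
Proof. by move=> g gO; rewrite subst_t. Qed.

Lemma o_invC c : o_inv (mpolyC N c).
Proof. by move=> g gO; rewrite substC. Qed.

Lemma o_invD f f' : o_inv f -> o_inv f' -> o_inv (f + f').
Proof. by move=> H H' g gO; rewrite substD H ?H'. Qed.

Lemma o_invM f f' : o_inv f -> o_inv f' -> o_inv (f * f').
Proof. by move=> H H' g gO; rewrite substM H ?H'. Qed.

Lemma o_inv0 : o_inv 0.
Proof. by rewrite -mpolyC0; apply: o_invC. Qed.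

Lemma o_inv1 : o_inv 1.
Proof. by rewrite -mpolyC1; apply: o_invC. Qed.

Lemma o_invN f : o_inv f -> o_inv (- f).
Proof. by move=> H; rewrite -mulN1r -mpolyC1 -mpolyCN; apply: o_invM => //; apply: o_invC. Qed.

Section Words.
Variables (op op' : 'I_k -> {linear K -> K}) (e : K) (c : 'I_k -> 'I_k -> P).
Hypothesis op_anti : anticommuting op.
Hypothesis op_comm : forall i j psi,
  op' i (op j psi) = c i j *: psi - op j (op' i psi).
Hypothesis op'_e : forall j, op' j e = 0.
Hypothesis cO : forall i j, o_inv (c i j).

(** Instantiated twice: [op] = eta, [op'] = iota, e = 1, and [op] = iota, [op'] = eta, e = vol. In
    both cases c consists of entries of the Gram matrix, which are invariant, so the span is stable
    under both families. *)
Definition span_words psi := exists2 f : {set 'I_k} -> P,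
  (forall J, o_inv (f J)) & psi = \sum_J f J *: word op e J.

Lemma span_word J : span_words (word op e J).
Proof.
exists (fun J' => mpolyC N (J' == J)%:R) => [J'|]; first exact: o_invC.
rewrite (bigD1 J)//= eqxx mpolyC1 scale1r big1 ?addr0// => J' /negPf->.
by rewrite mpolyC0 scale0r.
Qed.

Lemma spanD psi chi : span_words psi -> span_words chi -> span_words (psi + chi).
Proof.
move=> [f fO ->] [h hO ->]; exists (fun J => f J + h J) => [J|].
  exact: o_invD.
by rewrite -big_split; apply: eq_bigr => J _; rewrite scalerDl.
Qed.

Lemma spanZ p psi : o_inv p -> span_words psi -> span_words (p *: psi).
Proof.
move=> pO [f fO ->]; exists (fun J => p * f J) => [J|]; first exact: o_invM.
by rewrite scaler_sumr; apply: eq_bigr => J _; rewrite scalerA.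
Qed.

Lemma span0 : span_words 0.
Proof.
by exists (fun=> 0) => [J|]; [exact: o_inv0|rewrite big1// => J _; rewrite scale0r].
Qed.

Lemma spanN psi : span_words psi -> span_words (- psi).
Proof.
by move=> H; rewrite -scaleN1r; apply: spanZ => //; apply/o_invN/o_inv1.
Qed.

Lemma span_sum (T : finType) (F : T -> K) :
  (forall s, span_words (F s)) -> span_words (\sum_s F s).
Proof.
by move=> H; elim/big_rec: _ => [|i p _ pO]; [exact: span0|exact: spanD].
Qed.

Lemma span_op j psi : span_words psi -> span_words (op j psi).
Proof.
move=> [f fO ->]; rewrite linear_sum; apply: span_sum => J /=.
have -> : op j (f J *: word op e J) = f J *: op j (word op e J) by exact: linearZ.
apply: spanZ => //; rewrite (mul_word _ _ _ op_anti).
case: ifP => _; first exact: span0.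
apply: spanZ; last exact: span_word.
by elim: parity => [|d IH]; rewrite ?expr0 ?exprS; [exact: o_inv1|apply/o_invM/IH/o_invN/o_inv1].
Qed.

Lemma span_op' j psi : span_words psi -> span_words (op' j psi).
Proof.
have span_s s J : span_words (word_on s op e J).
  elim: s => [|i s IH] /=; first by rewrite -(word0 op e); apply: span_word.
  by case: ifP => _ //; apply: span_op.
have span_s' s J : span_words (op' j (word_on s op e J)).
  elim: s => [|i s IH] /=; first by rewrite op'_e; apply: span0.
  case: ifP => _ //; rewrite op_comm; apply: spanD; first exact: spanZ.
  by apply/spanN/span_op.
move=> [f fO ->]; rewrite linear_sum; apply: span_sum => J /=.
have -> : op' j (f J *: word op e J) = f J *: op' j (word op e J) by exact: linearZ.
by apply: spanZ => //; apply: span_s'.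
Qed.

End Words.

End Invariant.

(** * Generation of the invariant forms *)

Section Structure.
Variables (C : numClosedFieldType) (n k : nat) (O : 'M[C]_n -> Prop).
Local Notation N := ((n + 1) * k)%N.
Local Notation P := (mpoly N C).
Local Notation K := (polyform C N n).
Implicit Types (a b d : 'I_n) (i j : 'I_k) (psi chi u : K) (p q f : P).
Implicit Types (J : {set 'I_k}) (I : {set 'I_n}).

Hypothesis O_orth : forall g, O g -> g^T *m g = 1%:M.
Hypothesis lie_inv : forall psi, so_inv O psi -> forall a b, lie a b psi = 0.
Hypothesis kn : (k <= n)%N.
Local Notation so_inv := (so_inv O).
Local Notation o_inv := (o_inv O).

Lemma const_form u : (forall a j, dx a j u = 0) -> (forall j, dt j u = 0) ->
  (forall a b, lie a b u = 0) -> exists c d : C,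
  u = mpolyC N c *: (ext1 : K) + mpolyC N d *: (vol : K).
Proof.
move=> ux ut ul.
have uC I : u I = mpolyC N (mcoeff (mnm0 (n:=N)) (u I)).
  apply: mderiv_eq0; apply: var_ind => [a j|j]; rewrite -pderivE.
    by rewrite [pderiv _ _]ux ffunE.
  by rewrite [pderiv _ _]ut ffunE.
have uab a b : fmul a (fcontract b u) = fmul b (fcontract a u).
  apply/eqP; rewrite -subr_eq0; have := ul a b; rewrite /lie /rotl.
  rewrite big1 ?add0r => [->|i _]; first exact: eqxx.
  by rewrite !ux !scaler0 subr0.
have u0 I : I != finset.set0 -> I != setT -> u I = 0.
  move=> /set0Pn[b bI]; rewrite eqEsubset subsetT /= => /subsetPn[a _ aI].
  have ab : a != b by apply: contraNneq aI => ->.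
  (* Compare the coefficients at I with b exchanged for a: on the left stands u at I up to sign, and
     on the right zero, because b is missing. *)
  have := congr1 (fun w : K => w (a |: (I :\ b))) (uab a b).
  rewrite [LHS]fmulE setU11 [RHS]fmulE !inE (eq_sym b) (negPf ab) eqxx /=.
  rewrite setU1K ?inE ?(negPf aI) ?andbF// fcontractE !inE eqxx /= setD1K//.
  by move/eqP; rewrite !mulf_eq0 !signr_eq0 => /eqP.
exists (mcoeff (mnm0 (n:=N)) (u finset.set0)).
(* For n = 0 the empty and the full set coincide, and the coefficient must not be counted twice. *)
exists (if finset.set0 == [set: 'I_n] then 0 else mcoeff (mnm0 (n:=N)) (u setT)).
apply/ffunP => I.
have E (x y : K) : (x + y) I = x I + y I by rewrite !ffunE.
rewrite E !polyformZE volE !ffunE.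
have [->|I0] := eqVneq I finset.set0.
  rewrite mulr1; case: ifP => _; last by rewrite mulr0 addr0 -uC.
  by rewrite mulr1 mpolyC0 addr0 -uC.
rewrite mulr0 add0r; have [IT|IT] := eqVneq I setT; last by rewrite mulr0 u0.
by rewrite mulr1 -IT (eq_sym _ I) (negPf I0) -uC.
Qed.

Definition eta_word J : K := word (fun j => @eta_op C n k j) (ext1 : K) J.
Definition iot_word J : K := word (fun j => @iot_op C n k j) (vol : K) J.

Definition in_words psi := exists f h : {set 'I_k} -> P,
  [/\ forall J, o_inv (f J), forall J, o_inv (h J)
    & psi = \sum_J f J *: eta_word J + \sum_J h J *: iot_word J].

Definition span_eta := span_words O (fun j => @eta_op C n k j) (ext1 : K).
Definition span_iot := span_words O (fun j => @iot_op C n k j) (vol : K).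

Lemma in_wordsE psi : in_words psi <-> exists x y,
  [/\ span_eta x, span_iot y & psi = x + y].
Proof.
split=> [[f [h [fO hO ->]]]|[x [y [[f fO ->] [h hO ->] ->]]]].
  by do 2!eexists; split; [exists f|exists h|].
by exists f, h.
Qed.

Lemma eta_iot i j psi :
  eta_op i (iot_op j psi) = gram j i *: psi - iot_op j (eta_op i psi).
Proof. by rewrite iot_eta subKr. Qed.

Lemma iot_ext1 j : iot_op j (ext1 : K) = 0.
Proof.
rewrite iotE big1// => a _.
by rewrite fcontract.unlock contract1 scaler0.
Qed.

Lemma eta_vol j : eta_op j (vol : K) = 0.
Proof.
rewrite etaE big1// => a _.
by rewrite fmul.unlock ext_mul_vol scaler0.
Qed.

Lemma in_wordsD psi chi : in_words psi -> in_words chi -> in_words (psi + chi).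
Proof.
move=> /in_wordsE[x [y [xE yI ->]]] /in_wordsE[x' [y' [xE' yI' ->]]].
apply/in_wordsE; exists (x + x'), (y + y'); split; first exact: spanD.
  exact: spanD.
by rewrite addrACA.
Qed.

Lemma in_words0 : in_words 0.
Proof.
by apply/in_wordsE; exists 0, 0; split; [exact: span0|exact: span0|rewrite addr0].
Qed.

Lemma in_words_sum (T : finType) (F : T -> K) :
  (forall s, in_words (F s)) -> in_words (\sum_s F s).
Proof.
by move=> H; elim/big_rec: _ => [|s x _ xW]; [exact: in_words0|exact: in_wordsD].
Qed.

Lemma in_wordsZ p psi : o_inv p -> in_words psi -> in_words (p *: psi).
Proof.
move=> pO /in_wordsE[x [y [xE yI ->]]]; apply/in_wordsE.
by exists (p *: x), (p *: y); rewrite scalerDr; split=> //; apply: spanZ.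
Qed.

Lemma in_words_eta j psi : in_words psi -> in_words (eta_op j psi).
Proof.
move=> /in_wordsE[x [y [xE yI ->]]]; apply/in_wordsE.
exists (eta_op j x), (eta_op j y); rewrite eta_opD; split=> //.
  have := @span_op C n k O (fun j => @eta_op C n k j : {linear K -> K})
    (ext1 : K) (@eta_anticommuting C n k) j x xE.
  by [].
have := @span_op' C n k O (fun j => @iot_op C n k j : {linear K -> K})
  (fun j => @eta_op C n k j : {linear K -> K}) (vol : K) (fun i j => gram j i)
  (@iot_anticommuting C n k) eta_iot eta_vol (fun i j => o_inv_gram O_orth j i)
  j y yI.
by [].
Qed.

Lemma in_words_iot j psi : in_words psi -> in_words (iot_op j psi).
Proof.
move=> /in_wordsE[x [y [xE yI ->]]]; apply/in_wordsE.
exists (iot_op j x), (iot_op j y); rewrite iot_opD; split=> //; last first.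
  have := @span_op C n k O (fun j => @iot_op C n k j : {linear K -> K})
    (vol : K) (@iot_anticommuting C n k) j y yI.
  by [].
have := @span_op' C n k O (fun j => @eta_op C n k j : {linear K -> K})
  (fun j => @iot_op C n k j : {linear K -> K}) (ext1 : K) (fun i j => gram i j)
  (@eta_anticommuting C n k) (@iot_eta C n k) iot_ext1 (o_inv_gram O_orth) j x xE.
by [].
Qed.

(** The four summands of the index type are the multiplications by r_ij and by t_j and the operators
    eta_j and iota_j. As one finite family they fall under [adjoint_decomposition]. *)
Definition raise (s : 'I_k * 'I_k + 'I_k + 'I_k + 'I_k) : K -> K :=
  match s with
  | inl (inl (inl ij)) => fun psi => gram ij.1 ij.2 *: psi
  | inl (inl (inr j)) => fun psi => tpol j *: psi
  | inl (inr j) => @eta_op C n k j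
  | inr j => @iot_op C n k j
  end.

Definition lower (s : 'I_k * 'I_k + 'I_k + 'I_k + 'I_k) : K -> K :=
  match s with
  | inl (inl (inl ij)) => @lap_op C n k ij.1 ij.2
  | inl (inl (inr j)) => @dt C n k j
  | inl (inr j) => @del_op C n k j
  | inr j => @eps_op C n k j
  end.

Fact raise_zmod s : zmod_morphism (raise s).
Proof.
case: s => [[[[i j]|j]|j]|j] x y /=; first exact: scalerBr.
- exact: scalerBr.
- exact: eta_opB.
- exact: iot_opB.
Qed.
HB.instance Definition _ s := GRing.isZmodMorphism.Build K K (raise s) (raise_zmod s).

Fact lower_zmod s : zmod_morphism (lower s).
Proof.
case: s => [[[[i j]|j]|j]|j] x y /=; first exact: lap_opB.
- exact: dtB.
- exact: del_opB.
- exact: eps_opB.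
Qed.
HB.instance Definition _ s := GRing.isZmodMorphism.Build K K (lower s) (lower_zmod s).

Lemma raise_adjoint s : adjoint (raise s) (lower s).
Proof.
case: s => [[[[i j]|j]|j]|j] /=; first exact: adj_gram.
- exact: adj_t.
- exact: adj_eta.
- exact: adj_iot.
Qed.

Lemma scaleC p c psi : p *: (mpolyC N c *: psi) = mpolyC N c *: (p *: psi).
Proof. by rewrite !scalerA mulrC. Qed.

Lemma raise_C s c psi : raise s (mpolyC N c *: psi) = mpolyC N c *: raise s psi.
Proof.
case: s => [[[[i j]|j]|j]|j] /=; first exact: scaleC.
- exact: scaleC.
- exact: eta_opZ.
- exact: iot_opZ.
Qed.

Lemma lower_C s c psi : lower s (mpolyC N c *: psi) = mpolyC N c *: lower s psi.
Proof.
case: s => [[[[i j]|j]|j]|j] /=; first exact: lap_C.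
- exact: dt_C.
- exact: del_C.
- exact: eps_C.
Qed.

Lemma raise_inv s psi : so_inv psi -> so_inv (raise s psi).
Proof.
case: s => [[[[i j]|j]|j]|j] /= H; first by apply: inv_scale H; apply: o_inv_gram.
- by apply: inv_scale H; apply: o_inv_t.
- exact: inv_eta.
- exact: inv_iot.
Qed.

Lemma lower_inv s psi : so_inv psi -> so_inv (lower s psi).
Proof.
case: s => [[[[i j]|j]|j]|j] /= H; first exact: inv_lap.
- exact: inv_dt.
- exact: inv_del.
- exact: inv_eps.
Qed.

Lemma raise_in_words s psi : in_words psi -> in_words (raise s psi).
Proof.
case: s => [[[[i j]|j]|j]|j] /= H; first by apply: in_wordsZ H; apply: o_inv_gram.
- by apply: in_wordsZ H; apply: o_inv_t.
- exact: in_words_eta.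
- exact: in_words_iot.
Qed.

Lemma lower_dlt s D psi : dlt D psi -> dlt D.-1 (lower s psi).
Proof.
case: s => [[[[i j]|j]|j]|j] /= H; last exact: dlt_eps.
- exact: dlt_leq (leq_pred _) (dlt_lap _ _ H).
- exact: dlt_dt.
- exact: dlt_del.
Qed.

Lemma raise_lower_dlt s D psi : dlt D psi -> dlt D (raise s (lower s psi)).
Proof.
case: D => [/dlt0_eq0->|D].
  have -> : lower s 0 = 0 by exact: raddf0.
  by have -> : raise s 0 = 0; [exact: raddf0|exact: dlt0].
case: s => [[[[i j]|j]|j]|j] /= H; last exact: dlt_iot (dlt_eps _ H).
- case: D H => [|D] H; last exact: dlt_gram (dlt_lap _ _ H).
  rewrite (dlt0_eq0 (dlt_lap i j H)) scaler0; exact: dlt0.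
- exact: dlt_t (dlt_dt _ H).
- exact: dlt_eta (dlt_del _ H).
Qed.

(** Induction on the degree: every operator in [lower] drops it, so the image part of the
    decomposition is built from smaller invariant forms, and the part killed by all of [lower] is a
    combination of 1 and vol by [x_harmonic] and [const_form]. *)
Lemma inv_in_words psi : so_inv psi -> in_words psi.
Proof.
have [D] := dlt_ex psi; elim: D psi => [psi /dlt0_eq0-> _|D IH psi psiD psiI].
  exact: in_words0.
have [w [u [[wI wD] [uI uD] -> hu]]] := adjoint_decomposition
  (f := fun s => raise s : {additive K -> K})
  (h := fun s => lower s : {additive K -> K}) (@inv_subsp C n k O)
  raise_adjoint raise_C lower_C (fun s x xI => raise_inv s (lower_inv s xI))
  (fun s x xD => raise_lower_dlt s xD) psiI psiD.
apply: in_wordsD.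
  apply: in_words_sum => s; apply/raise_in_words/IH; first exact: lower_dlt wD.
  exact: lower_inv.
have [c [d ->]] := const_form (x_harmonic kn (lie_inv uI)
  (fun i j => hu (inl (inl (inl (i, j))))) (fun j => hu (inl (inr j)))
  (fun j => hu (inr j))) (fun j => hu (inl (inl (inr j)))) (lie_inv uI).
apply/in_wordsE; do 2!eexists; split; last by [].
- apply: spanZ; first exact: o_invC.
  have := @span_word C n k O (fun j => @eta_op C n k j : {linear K -> K})
    (ext1 : K) finset.set0.
  by rewrite word0.
- apply: spanZ; first exact: o_invC.
  have := @span_word C n k O (fun j => @iot_op C n k j : {linear K -> K})
    (vol : K) finset.set0.
  by rewrite word0.
Qed.

End Structure.

(** * Cancellation by nonzero determinants *)

Section Cancellation.
Variables (C : numClosedFieldType) (n k : nat).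
Local Notation N := ((n + 1) * k)%N.
Local Notation P := (mpoly N C).
Local Notation K := (polyform C N n).
Implicit Types (a b d : 'I_n) (psi chi u : K) (p q f : P).
Implicit Types (J : {set 'I_k}) (I : {set 'I_n}).

Lemma polyform_scale_eq0 p psi : p *: psi = 0 -> p = 0 \/ psi = 0.
Proof.
have [->|p0] := eqVneq p 0; first by left.
move=> E; right; apply/ffunP => I; rewrite [RHS]ffunE.
have /eqP := congr1 (fun x : K => x I) E; rewrite polyformZE [X in _ == X]ffunE.
by rewrite mulf_eq0 (negPf p0) => /eqP.
Qed.

(** Multiplying by the adjugate leaves det M times v, and polynomial forms have no torsion. *)
Lemma det_cancel m (M : 'M[P]_m) (v : 'I_m -> K) : \det M != 0 ->
  (forall i, \sum_j M i j *: v j = 0) -> forall i, v i = 0.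
Proof.
move=> M0 H l; have : \sum_i \adj M l i *: (\sum_j M i j *: v j) = 0.
  by rewrite big1// => i _; rewrite H scaler0.
under eq_bigr do rewrite scaler_sumr.
rewrite exchange_big /= (_ : \sum_j _ = \det M *: v l).
  by move/polyform_scale_eq0 => [E|//]; rewrite E eqxx in M0.
have E j : \sum_i \adj M l i *: (M i j *: v j) = (\det M *+ (l == j)) *: v j.
  under eq_bigr do rewrite scalerA.
  rewrite -scaler_suml; congr (_ *: _).
  by have := congr1 (fun A : 'M_m => A l j) (mul_adj_mx M); rewrite !mxE.
under eq_bigr do rewrite E.
rewrite (bigD1 l)//= eqxx mulr1n big1 ?addr0// => j jl.
by rewrite eq_sym (negPf jl) mulr0n scale0r.
Qed.

(** A point with t = 0 whose x-part has 1 on the diagonal and 0 elsewhere. There the Gram matrix,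
    for k <= n, and the matrix x x^T, for n <= k, become the identity, so their determinants are
    nonzero polynomials. *)
Let point : 'M[C]_(n + 1, k) := col_mx (pid_mx k) 0.
Let ev : P -> C := meval (fun v => mxvec point 0 v).

Let ev_x a j : ev (xpol a j) = pid_mx k a j.
Proof. by rewrite /ev mevalXU xvar.unlock mxvecE col_mxEu. Qed.

Lemma det_gram_neq0 : (k <= n)%N -> \det (gram : 'M[P]_k) != 0.
Proof.
move=> kn; have : ev (\det (gram : 'M[P]_k)) = 1.
  have -> : ev (\det (gram : 'M[P]_k)) = \det (map_mx ev gram).
    exact: (esym (det_map_mx (meval (fun v => mxvec point 0 v)) _)).
  rewrite (_ : map_mx ev gram = 1%:M) ?det1//; apply/matrixP => i j.
  rewrite mxE gramE /ev raddf_sum /=.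
  under eq_bigr do rewrite mevalM -!/(ev _) !ev_x.
  transitivity (((pid_mx k : 'M[C]_(n, k))^T *m pid_mx k) i j).
    by rewrite mxE; apply: eq_bigr => a _; rewrite [_^T _ _]mxE.
  by rewrite tr_pid_mx mul_pid_mx minnn (minn_idPr kn) pid_mx_1.
by move=> E; apply/eqP => D0; move: E; rewrite D0 /ev meval0 => /esym/eqP; rewrite oner_eq0.
Qed.

Lemma det_frame_neq0 : (n <= k)%N -> \det ((xmat : 'M[P]_(n, k)) *m xmat^T) != 0.
Proof.
move=> nk; have : ev (\det ((xmat : 'M[P]_(n, k)) *m xmat^T)) = 1.
  have -> : ev (\det ((xmat : 'M[P]_(n, k)) *m xmat^T)) =
      \det (map_mx ev (xmat *m xmat^T)).
    exact: (esym (det_map_mx (meval (fun v => mxvec point 0 v)) _)).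
  rewrite (_ : map_mx ev _ = 1%:M) ?det1//; apply/matrixP => a b.
  rewrite mxE mxE /ev raddf_sum /=.
  under eq_bigr do rewrite [_^T _ _]mxE ![xmat _ _]mxE mevalM -!/(ev _) !ev_x.
  transitivity ((pid_mx k *m (pid_mx k : 'M[C]_(n, k))^T) a b).
    by rewrite mxE; apply: eq_bigr => i _; rewrite [_^T _ _]mxE.
  rewrite tr_pid_mx mul_pid_mx minnn minnn.
  by rewrite !mxE (leq_trans (ltn_ord a) nk) andbT.
by move=> E; apply/eqP => D0; move: E; rewrite D0 /ev meval0 => /esym/eqP; rewrite oner_eq0.
Qed.

Lemma fmul_eq0 l u : hdeg l u -> (l < n)%N -> (forall a, fmul a u = 0) -> u = 0.
Proof.
move=> ul ln u0; have := sum_fcontract_mul ul.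
rewrite big1 => [E|a _]; last by rewrite u0 fcontract0.
have : (n - l)%:R *: u = 0 by rewrite natrB 1?ltnW// -E.
move/polyform_scale_eq0 => [/eqP|//].
by rewrite -mpolyC_nat mpolyC_eq0 pnatr_eq0 subn_eq0 leqNgt ln.
Qed.

(** [adjoint_decomposition] for T alone, as a family indexed by [unit]. *)
Lemma koszul_decomposition (U : K -> Prop) D psi : subsp U ->
  (forall x, U x -> U (koszul (koszul_adj x))) -> U psi -> dlt D psi ->
  exists w, exists u, [/\ U w /\ dlt D w, U u /\ dlt D u,
    psi = koszul (koszul_adj w) + u & koszul_adj u = 0].
Proof.
move=> US UT psiU psiD.
have TD (x : K) : dlt D x -> dlt D (koszul (koszul_adj x)).
  case: D {psiD} => [|[|D]] H; last exact: dlt_koszul (dlt_koszul_adj H).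
  - by rewrite (dlt0_eq0 H) koszul_adj0 koszul0; apply: dlt0.
  - by rewrite (dlt0_eq0 (dlt_koszul_adj H)) koszul0; apply: dlt0.
have [w [u [wU uU -> hu]]] := @adjoint_decomposition C N n unit U D
  (fun=> @koszul C n k : {additive K -> K})
  (fun=> @koszul_adj C n k : {additive K -> K})
  US (fun=> @adj_koszul C n k) (fun _ c x => koszulZ _ x)
  (fun=> @koszul_adj_C C n k) (fun _ x => UT x) (fun _ x => TD x) psi psiU psiD.
exists w, u; split=> //; last exact: (hu tt).
congr (_ + _); rewrite (bigD1 tt)//= big1 ?addr0// => -[] //.
Qed.

End Cancellation.

(** * Words in eta and iota *)

Section Words.
Variables (C : numClosedFieldType) (n k : nat) (O : 'M[C]_n -> Prop).
Local Notation N := ((n + 1) * k)%N.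
Local Notation P := (mpoly N C).
Local Notation K := (polyform C N n).
Implicit Types (a b d : 'I_n) (i j : 'I_k) (psi chi u : K) (p q f : P).
Implicit Types (J : {set 'I_k}) (I : {set 'I_n}).
Local Notation eta_word := (@eta_word C n k).
Local Notation iot_word := (@iot_word C n k).

Let count_mem J : #|J| = count (mem J) (index_enum 'I_k).
Proof. by rewrite cardE /index_enum /enum_mem size_filter. Qed.

Lemma hdeg_eta_word J : hdeg #|J| (eta_word J).
Proof.
rewrite count_mem /eta_word /word; elim: index_enum => [|i s IH] /=.
  exact: hdeg1.
by case: ifP => _; rewrite ?add0n// add1n; apply: hdeg_eta.
Qed.

Lemma iot_word_eq0 J I : (#|I| + #|J|)%N <> n -> iot_word J I = 0.
Proof.
rewrite count_mem /iot_word /word; elim: index_enum I => [I|i s IH I] /=.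
  by rewrite addn0; exact: hdeg_vol.
case: ifP => _; last exact: IH.
move=> H; rewrite iotE sum_ffunE big1// => a _.
rewrite polyformZE fcontractE; case: ifP => [_|/negbT aI]; first by rewrite mulr0.
by rewrite IH ?mulr0//; rewrite cardsU1 aI add1n addSnnS.
Qed.

(** A word of length m in eta has degree m, and one in iota applied to vol has degree n - m, so only
    words of matching length survive. *)
Lemma in_words_deg l psi : hdeg l psi -> in_words O psi ->
  exists f h : {set 'I_k} -> P, [/\ forall J, o_inv O (f J),
    forall J, o_inv O (h J) &
    psi = \sum_(J : {set 'I_k} | #|J| == l) f J *: eta_word J +
          \sum_(J : {set 'I_k} | (l + #|J|)%N == n) h J *: iot_word J].
Proof.
move=> psil [f [h [fO hO E]]]; exists f, h; split=> //; apply/ffunP => I.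
have Ea (x y : K) : (x + y) I = x I + y I by rewrite !ffunE.
rewrite Ea; have [Il|/eqP Il] := eqVneq #|I| l; last first.
  rewrite psil// !sum_ffunE !big1 ?addr0// => J /eqP Jl; rewrite polyformZE.
    by rewrite iot_word_eq0 ?mulr0// => E'; apply: Il; apply/eqP; rewrite -(eqn_add2r #|J|) E' Jl.
  by rewrite (@hdeg_eta_word J) ?mulr0// Jl.
rewrite {1}E Ea !sum_ffunE; congr (_ + _).
  rewrite (bigID (fun J : {set 'I_k} => #|J| == l)) /= [X in _ + X]big1 ?addr0// => J /eqP Jl.
  by rewrite polyformZE (@hdeg_eta_word J) ?mulr0// Il => /esym.
rewrite (bigID (fun J : {set 'I_k} => (l + #|J|)%N == n)) /= [X in _ + X]big1 ?addr0// => J /eqP Jl.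
by rewrite polyformZE iot_word_eq0 ?mulr0// Il.
Qed.

Lemma eta_eta_wordT j : eta_op j (eta_word setT) = 0.
Proof.
have := @mul_word P K k (fun j => @eta_op C n k j : {linear K -> K}) (ext1 : K)
  setT j (@eta_anticommuting C n k).
by rewrite in_setT.
Qed.

(** The frames dual to the eta_j and the iota_j, multiplied by det gram: the adjugate replaces the
    inverse Gram matrix and keeps the coefficients polynomial. *)
Definition cof_iot i psi : K := \sum_j \adj gram i j *: iot_op j psi.
Definition cof_eta i psi : K := \sum_j \adj gram i j *: eta_op j psi.

Lemma cof_iotZ i p psi : cof_iot i (p *: psi) = p *: cof_iot i psi.
Proof.
rewrite /cof_iot scaler_sumr; apply: eq_bigr => j _.
by rewrite iot_opZ !scalerA mulrC.
Qed.

Lemma cof_iot_eta i j psi : cof_iot i (eta_op j psi) =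
  (\det gram *+ (i == j)) *: psi - eta_op j (cof_iot i psi).
Proof.
rewrite /cof_iot; under eq_bigr do rewrite iot_eta scalerBr scalerA.
rewrite sumrB -scaler_suml; congr (_ *: _ - _); last first.
  by rewrite eta_op_sum; apply: eq_bigr => l _; rewrite eta_opZ.
by have := congr1 (fun A : 'M_k => A i j) (mul_adj_mx (gram : 'M[P]_k)); rewrite [LHS]mxE [RHS]mxE.
Qed.

Lemma cof_eta_iot i j psi : cof_eta i (iot_op j psi) =
  (\det gram *+ (i == j)) *: psi - iot_op j (cof_eta i psi).
Proof.
have gramC l m : gram l m = gram m l :> P.
  by rewrite !gramE; apply: eq_bigr => a _; rewrite mulrC.
rewrite /cof_eta; under eq_bigr do rewrite eta_iot gramC scalerBr scalerA.
rewrite sumrB -scaler_suml; congr (_ *: _ - _); last first.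
  by rewrite iot_op_sum; apply: eq_bigr => l _; rewrite iot_opZ.
by have := congr1 (fun A : 'M_k => A i j) (mul_adj_mx (gram : 'M[P]_k)); rewrite [LHS]mxE [RHS]mxE.
Qed.

(** The operators [cof_iot] strip off the factors eta_i one after the other, each at the price of a
    nonzero factor det gram. *)
Lemma eta_wordT_free p : (k <= n)%N -> p *: eta_word setT = 0 -> p = 0.
Proof.
move=> kn; have D0 := @det_gram_neq0 C n k kn.
have W0 s i : i \notin s -> cof_iot i (word_on s (fun j => @eta_op C n k j) (ext1 : K) setT) = 0.
  elim: s => [_|j s IH] /=.
    by rewrite /cof_iot big1// => j _; rewrite iot_ext1 scaler0.
  rewrite inE negb_or in_setT => /andP[/negPf ij is_]; rewrite cof_iot_eta ij mulr0n scale0r.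
  by rewrite IH// eta_op0 subr0.
rewrite /eta_word /word; have := index_enum_uniq 'I_k.
elim: index_enum => [_|i s IH] /=.
  move=> /(congr1 (fun x : K => x finset.set0)); rewrite polyformZE !ffunE eqxx mulr1.
  by [].
rewrite in_setT => /andP[is_ us] E; apply: (IH us).
have /eqP := congr1 (cof_iot i) E.
rewrite cof_iotZ cof_iot_eta eqxx mulr1n W0// eta_op0 subr0.
have -> : cof_iot i 0 = 0 by rewrite /cof_iot big1// => j _; rewrite iot_op0 scaler0.
rewrite scalerA mulrC -scalerA => /eqP/polyform_scale_eq0[E0|//].
by rewrite E0 eqxx in D0.
Qed.

(* The iot-words are eigenvectors of [\sum_i iot_i y_i], where the y_i are the
   combinations of the eta_j dual to the iot_i. *)
Lemma cof_number J :
  \sum_i iot_op i (cof_eta i (iot_word J)) = #|J|%:R *: (\det gram *: iot_word J).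
Proof.
suff H s : \sum_i iot_op i (cof_eta i
      (word_on s (fun j => @iot_op C n k j) (vol : K) J)) =
    (count (mem J) s)%:R *:
      (\det gram *: word_on s (fun j => @iot_op C n k j) (vol : K) J).
  by rewrite count_mem; apply: H.
elim: s => [|l s IH] /=.
  rewrite scale0r big1// => i _; rewrite /cof_eta big1 ?iot_op0// => j _.
  by rewrite eta_vol scaler0.
case: ifP => lJ; last by rewrite add0n IH.
set w := word_on _ _ _ _ in IH *.
transitivity (\det gram *: iot_op l w + iot_op l (\sum_i iot_op i (cof_eta i w))).
  transitivity (\sum_i ((\det gram *+ (i == l)) *: iot_op i w +
      iot_op l (iot_op i (cof_eta i w)))).
    apply: eq_bigr => i _; rewrite cof_eta_iot iot_opB iot_opZ; congr (_ + _).
    have [anti _] := @iot_anticommuting C n k.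
    by rewrite -anti.
  rewrite big_split /= -iot_op_sum (bigD1 l)//= eqxx mulr1n big1 ?addr0// => i /negPf->.
  by rewrite mulr0n scale0r.
by rewrite IH !iot_opZ add1n -natr1 scalerDl scale1r addrC.
Qed.

Lemma inv_eta_word J : (forall g, O g -> g^T *m g = 1%:M) ->
  forall g, O g -> act g (eta_word J) = eta_word J.
Proof.
move=> Oo g gO; rewrite /eta_word /word; elim: index_enum => [|i s IH] /=.
  exact: act_ext1.
by case: ifP => _ //; rewrite act_eta ?IH// Oo.
Qed.

Lemma act_iot_word J : (forall g, O g -> g^T *m g = 1%:M) ->
  forall g, O g -> act g (iot_word J) = mpolyC N (\det g) *: iot_word J.
Proof.
move=> Oo g gO; rewrite /iot_word /word; elim: index_enum => [|i s IH] /=.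
  exact: act_vol.
by case: ifP => _ //; rewrite act_iot ?IH ?iot_opZ// Oo.
Qed.

Lemma dt_eta_word i J : dt i (eta_word J) = 0.
Proof.
rewrite /eta_word /word; elim: index_enum => [|j s IH] /=.
  by rewrite /dt pderiv_const// inE eqxx.
by case: ifP => _ //; rewrite dt_eta IH eta_op0.
Qed.

Lemma dtM j p psi : dt j (p *: psi) = mderiv (tvar n j) p *: psi + p *: dt j psi.
Proof. exact: pderivM. Qed.

End Words.

(** * The Koszul complex *)

Lemma zmod_rearrange (V : zmodType) (x y z u : V) :
  x = x - (y - z + u) + y + u - z.
Proof.
by rewrite opprD opprB addrA [_ - u + y]addrAC -(addrA x) subrK subrK addrK.
Qed.

Section Koszul.
Variables (C : numClosedFieldType) (n k : nat) (O : 'M[C]_n -> Prop).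
Local Notation N := ((n + 1) * k)%N.
Local Notation P := (mpoly N C).
Local Notation K := (polyform C N n).
Implicit Types (a b d : 'I_n) (i j : 'I_k) (psi chi u : K) (p q f : P) (l : nat).

Hypothesis O_orth : forall g, O g -> g^T *m g = 1%:M.
Hypothesis lie_inv : forall psi, so_inv O psi -> forall a b, lie a b psi = 0.
Local Notation so_inv := (so_inv O).

(** For l < n these are, by [koszul_harmonic], the invariant forms of degree l in the kernels of T
    and of its adjoint: the harmonic representatives below the top degree. *)
Definition cyc l u := [/\ so_inv u, hdeg l u, forall j, dt j u = 0
  & forall j, eta_op j u = 0].

Lemma hdeg0 l : hdeg l (0 : K).
Proof. by move=> I _; rewrite ffunE. Qed.

Lemma hdegp0 l : hdegp l (0 : K).
Proof. by move=> I _; rewrite ffunE. Qed.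

Lemma so_invD psi chi : so_inv psi -> so_inv chi -> so_inv (psi + chi).
Proof. by have [_ H _] := @inv_subsp C n k O; exact: H. Qed.

Lemma so_invC c psi : so_inv psi -> so_inv (mpolyC N c *: psi).
Proof. by have [_ _ H] := @inv_subsp C n k O; exact: H. Qed.

Lemma so_invB psi chi : so_inv psi -> so_inv chi -> so_inv (psi - chi).
Proof. exact: subspB (@inv_subsp C n k O). Qed.

Lemma so_inv0 : so_inv (0 : K).
Proof. by have [] := @inv_subsp C n k O. Qed.

(** Contracting [lie_mul_sum] with x_bj turns its left side into (l - k) eta_j u = 0 and its right
    side into the Gram matrix applied to the eps_i u; its determinant is nonzero for k <= n. *)
Lemma cyc_eps l u : (k <= n)%N -> cyc l u -> forall i, eps_op i u = 0.
Proof.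
move=> kn [uI ul ut ue]; apply: (det_cancel (@det_gram_neq0 C n k kn)) => j.
have H := lie_mul_sum (lie_inv uI) ul ue.
transitivity (\sum_b xpol b j *: (\sum_i xpol b i *: eps_op i u)).
  under [RHS]eq_bigr do rewrite scaler_sumr.
  rewrite exchange_big; apply: eq_bigr => i _ /=.
  rewrite gramE scaler_suml; apply: eq_bigr => b _; exact: (esym (scalerA _ _ _)).
under eq_bigr do rewrite -H.
transitivity ((l%:R - k%:R) *: eta_op j u); last by rewrite ue scaler0.
rewrite etaE scaler_sumr; apply: eq_bigr => b _.
by rewrite !scalerA mulrC.
Qed.

(** For k <= n, [lie_mul_sum] leaves (l - k) omega_b u = 0. For k > n the equations eta_j u = 0 give
    omega_a u = 0, because x x^T has nonzero determinant. A form of degree below n killed by every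
    omega_a is zero. *)
Lemma cyc_eq0 l u : (l < n)%N -> l != k -> cyc l u -> u = 0.
Proof.
move=> ln lk uZ; have [uI ul ut ue] := uZ.
apply: (fmul_eq0 ul ln); have [kn|/ltnW nk] := leqP k n.
  move=> b; have := lie_mul_sum (lie_inv uI) ul ue b.
  rewrite big1 => [|i _]; last by rewrite (cyc_eps kn uZ) scaler0.
  move/polyform_scale_eq0 => [/eqP|//].
  rewrite -!(mpolyC_nat N C) -mpolyCB mpolyC_eq0 subr_eq0 eqr_nat.
  by rewrite (negPf lk).
apply: (det_cancel (@det_frame_neq0 C n k nk)) => b.
transitivity (\sum_j xpol b j *: eta_op j u); last first.
  by rewrite big1// => j _; rewrite ue scaler0.
under [RHS]eq_bigr do rewrite etaE scaler_sumr.
rewrite exchange_big; apply: eq_bigr => a _ /=.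
rewrite mxE scaler_suml; apply: eq_bigr => j _.
by rewrite scalerA [_^T _ _]mxE !mxE.
Qed.

Lemma cyc_closed l u : (l < n)%N -> cyc l u -> dd u = 0.
Proof.
move=> ln uZ; have [uI ul ut ue] := uZ.
have [lk|lk] := eqVneq l k; last by rewrite (cyc_eq0 ln lk uZ) dd0.
have kn : (k <= n)%N by rewrite -lk ltnW.
rewrite /dd /ddt /koszul !big1 ?scaler0 ?subr0// => j _.
  by rewrite ue scaler0.
by rewrite ut eta_op0 (cyc_eps kn uZ) scaler0 addr0.
Qed.

Lemma dd_dd psi : so_inv psi -> dd (dd psi) = 0.
Proof. by move=> H; apply/dd_sq/lie_inv. Qed.

Let half : P := mpolyC N 2%:R^-1.

Let half2 psi : half *: (2%:R *: psi) = psi.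
Proof.
rewrite scalerA -(mpolyC_nat N C 2) -mpolyCM mulVf ?mpolyC1 ?scale1r//.
by rewrite pnatr_eq0.
Qed.

Let koszul_half psi : koszul psi = half *: ddt psi - half *: dd psi.
Proof. by rewrite -scalerBr /dd subKr half2. Qed.

(** [ddt] keeps the degree, here at most D, so degree D + 2 can only come from T. *)
Lemma pid_dd D psi : dlt D.+1 psi ->
  pid D.+2 (dd psi) = - (2%:R *: koszul (pid D psi)).
Proof.
move=> psiD; rewrite /dd pidB pid_dlt ?sub0r.
  by rewrite -(mpolyC_nat N C 2) pid_C pid_koszul.
by apply: dlt_leq (dlt_ddt psiD); exact: leqnSn.
Qed.

Let koszul_split l D psi : so_inv psi -> hdeg l psi -> dlt D psi ->
  exists w u, [/\ so_inv w /\ hdeg l w, dlt D w, so_inv u /\ hdeg l u, dlt D u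
    & psi = koszul (koszul_adj w) + u /\ koszul_adj u = 0].
Proof.
move=> psiI psil psiD; pose U (x : K) := so_inv x /\ hdeg l x.
have [|x [xI xl]|//||] := @koszul_decomposition C n k U D psi.
- split; first by split; [exact: so_inv0|exact: hdeg0].
    by move=> x y [xI xl] [yI yl]; split; [exact: so_invD|exact: hdegD].
  by move=> c x [xI xl]; split; [exact: so_invC|exact: hdeg_fZ].
- split; first exact/(inv_koszul O_orth)/inv_koszul_adj.
  exact/hdegp_koszul/hdegp_koszul_adj.
- by [].
- by move=> w [u [[wU wD] [uU uD] E u0]]; exists w, u.
Qed.

(** Split the top component as T chi + u with u coclosed, hence harmonic. Since T chi = 1/2 ddt chi
    - 1/2 dd chi, it is traded for an exact form and a remainder of lower degree, [koszul_adj]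
    having lowered the degree of chi by 2. *)
Lemma reduce_top D l psi : (l < n)%N -> so_inv psi -> hdeg l psi ->
  dlt D.+1 psi -> koszul (pid D psi) = 0 ->
  exists psi' u chi, [/\ so_inv psi' /\ hdeg l psi', dlt D psi', cyc l u,
    so_inv chi /\ hdegp l chi & psi = psi' + u + dd chi].
Proof.
move=> ln psiI psil psiD Tp.
have [w [u [[wI wl] wD [uI ul] uD [E u0]]]] := koszul_split (inv_pid D psiI)
  (hdeg_pid D psil) (@dlt_pid C n k D psi).
have chiI := inv_koszul_adj O_orth wI; have chil := hdegp_koszul_adj wl.
have chiD := dlt_koszul_adj wD.
move: (koszul_adj w) chiI chil chiD E => chi chiI chil chiD E.
have Tu : koszul u = 0.
  by move: Tp; rewrite E koszulD koszul_sq add0r.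
have [ut ue] := koszul_harmonic ul ln Tu u0.
exists (psi - pid D psi + half *: ddt chi), u, (- (half *: chi)); split.
- split; first by apply: so_invD; [exact/so_invB/inv_pid|exact/so_invC/inv_ddt].
  apply: hdegD; last exact/hdeg_fZ/hdegp_ddt.
  exact/hdegB/hdeg_pid.
- apply: dltD; first exact: dlt_sub_pid.
  apply/dltZ/dlt_ddt/(dlt_leq _ chiD).
  by case: (D) => //.
- by [].
- split; first by apply: subspN (@inv_subsp C n k O) _; exact: so_invC.
  by rewrite -scaleN1r; apply/hdegp_fZ/hdegp_fZ.
- have -> : dd (- (half *: chi)) = - (half *: dd chi).
    by rewrite -[in RHS]dd_C; exact: raddfN.
  by rewrite [in psi - _]E koszul_half; apply: zmod_rearrange.
Qed.

Lemma cyc0 l : cyc l 0.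
Proof.
split; [exact: so_inv0|exact: hdeg0|exact: dt0|exact: eta_op0].
Qed.

Lemma cycD l u u' : cyc l u -> cyc l u' -> cyc l (u + u').
Proof.
move=> [uI ul ut ue] [uI' ul' ut' ue']; split; first exact: so_invD.
- exact: hdegD.
- by move=> j; rewrite dtD ut ut' addr0.
- by move=> j; rewrite eta_opD ue ue' addr0.
Qed.

(** The top component of a closed form is killed by T, so [reduce_top] applies; everything it splits
    off is closed, so the rest is closed too and the induction continues. *)
Lemma closed_split l psi : (l < n)%N -> so_inv psi -> hdeg l psi ->
  dd psi = 0 -> exists u chi,
  [/\ cyc l u, so_inv chi, hdegp l chi & psi = u + dd chi].
Proof.
move=> ln; have [D] := dlt_ex psi; elim: D psi => [psi /dlt0_eq0-> _ _ _|].
  exists 0, 0; rewrite dd0 addr0.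
  by split=> //; [exact: cyc0|exact: so_inv0|exact: hdegp0].
move=> D IH psi psiD psiI psil dpsi.
have Tp : koszul (pid D psi) = 0.
  have /eqP := pid_dd psiD; rewrite dpsi pid0 eq_sym oppr_eq0 => /eqP E.
  by rewrite -[LHS]half2 E scaler0.
have [psi' [u [chi [[psiI' psil'] psiD' uZ [chiI chil] E]]]] :=
  reduce_top ln psiI psil psiD Tp.
have dpsi' : dd psi' = 0.
  by have := dpsi; rewrite E (ddD (_ + _)) (ddD _ u) (cyc_closed ln uZ) (dd_dd chiI) !addr0.
have [u' [chi' [uZ' chiI' chil' E']]] := IH psi' psiD' psiI' psil' dpsi'.
exists (u' + u), (chi' + chi); split; first exact: cycD.
- exact: so_invD.
- exact: hdegpD.
- rewrite E E' (ddD chi'); move: (dd chi') (dd chi) => X Y.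
  by rewrite -!addrA (addrCA X).
Qed.

(** Let p be the top component of chi. Coclosedness gives T^* T p = 0, hence T p = 0, and chi can be
    replaced by a form of lower degree with the same differential. This makes coclosed
    representatives unique. *)
Lemma exact_coclosed l chi : (l < n)%N -> so_inv chi -> hdeg l chi ->
  koszul_adj (dd chi) = 0 -> dd chi = 0.
Proof.
move=> ln; have [D] := dlt_ex chi; elim: D chi => [chi /dlt0_eq0-> *|].
  exact: dd0.
move=> D IH chi chiD chiI chil Ty.
have Tp : koszul (pid D chi) = 0.
  have E : 2%:R *: koszul_adj (koszul (pid D chi)) = 0.
    transitivity (koszul_adj (0 - pid D.+2 (dd chi))).
      by rewrite pid_dd// sub0r opprK -(mpolyC_nat N C 2) koszul_adj_C.
    by rewrite koszul_adjB koszul_adj0 -pid_koszul_adj Ty pid0 subr0.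
  apply: fischer_eq0; rewrite adj_koszul -[koszul_adj _]half2 E scaler0.
  exact: fischer0r.
have [chi' [u [chi'' [[chiI' chil'] chiD' uZ [chiI'' _] E]]]] :=
  reduce_top ln chiI chil chiD Tp.
have dchi : dd chi = dd chi'.
  by rewrite E (ddD (_ + _)) (ddD _ u) (cyc_closed ln uZ) (dd_dd chiI'') !addr0.
by rewrite dchi; apply: (IH chi' chiD' chiI' chil'); rewrite -dchi.
Qed.

(** There is no closedness to exploit in degree n. Instead all of psi is split as T chi + u, and T
    chi is traded for an exact form and 1/2 ddt chi, to which the induction on the degree
    applies. *)
Lemma top_split psi : so_inv psi -> hdeg n psi -> exists y chi,
  [/\ so_inv y /\ hdeg n y, koszul_adj y = 0, so_inv chi, hdegp n chi
    & psi = y + dd chi].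
Proof.
have [D] := dlt_ex psi; elim: D psi => [psi /dlt0_eq0-> _ _|D IH psi psiD psiI psil].
  exists 0, 0; rewrite dd0 addr0; split=> //; last exact: hdegp0.
  - by split; [exact: so_inv0|exact: hdeg0].
  - exact: koszul_adj0.
  - exact: so_inv0.
have [w [u [[wI wl] wD [uI ul] uD [E u0]]]] := koszul_split psiI psil psiD.
have chiI := inv_koszul_adj O_orth wI; have chil := hdegp_koszul_adj wl.
have chiD := dlt_koszul_adj wD.
move: (koszul_adj w) chiI chil chiD E => chi chiI chil chiD E.
have [|||y [chi' [yU y0 chiI' chil' E']]] := IH (half *: ddt chi).
- apply/dltZ/dlt_ddt/(dlt_leq _ chiD).
  by case: (D).
- exact/so_invC/inv_ddt.
- exact/hdeg_fZ/hdegp_ddt.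
exists (y + u), (chi' - half *: chi); split.
- by case: yU => yI yl; split; [exact: so_invD|exact: hdegD].
- by rewrite koszul_adjD y0 u0 addr0.
- exact/so_invB/so_invC.
- exact/hdegpB/hdegp_fZ.
- rewrite E koszul_half E' ddB dd_C.
  move: (dd chi') (dd chi) => X Y.
  by rewrite -!addrA; congr (_ + _); rewrite [RHS]addrC -addrA.
Qed.

End Koszul.

(** * Harmonic forms in degrees k and n, and the ideals *)

Section Top.
Variables (C : numClosedFieldType) (n k : nat) (O : 'M[C]_n -> Prop).
Local Notation N := ((n + 1) * k)%N.
Local Notation P := (mpoly N C).
Local Notation K := (polyform C N n).
Implicit Types (a b : 'I_n) (i j : 'I_k) (psi chi u y : K) (p q f h s : P) (l : nat).

Hypothesis O_orth : forall g, O g -> g^T *m g = 1%:M.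
Hypothesis lie_inv : forall psi, so_inv O psi -> forall a b, lie a b psi = 0.
Local Notation so_inv := (so_inv O).
Local Notation o_inv := (o_inv O).
Local Notation cyc := (cyc O).
Local Notation eta_word := (@eta_word C n k).
Local Notation iot_word := (@iot_word C n k).

Definition tfree f := forall j, mderiv (tvar n j) f = 0.

Definition cmpol j : P := \sum_i gram i j * tpol i.
Definition qmpol a : P := \sum_i xpol a i * tpol i.

Lemma cardT_k (J : {set 'I_k}) : (#|J| == k) = (J == setT).
Proof.
apply/idP/eqP => [/eqP Jk|->]; last by rewrite cardsT card_ord.
by apply/eqP; rewrite eqEcard subsetT cardsT card_ord Jk /=.
Qed.

Lemma cyc_eta f : o_inv f -> tfree f -> cyc k (f *: eta_word setT).
Proof.
move=> fO ft; split.
- by apply: inv_scale => // g gO _; rewrite (inv_eta_word _ O_orth).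
- apply: hdeg_fZ; have := @hdeg_eta_word C n k setT.
  by rewrite cardsT card_ord.
- by move=> j; rewrite dtM ft scale0r dt_eta_word scaler0 addr0.
- by move=> j; rewrite eta_opZ eta_eta_wordT scaler0.
Qed.

Lemma tfreeP f : (k <= n)%N -> (forall j, dt j (f *: eta_word setT) = 0) -> tfree f.
Proof.
move=> kn H j; apply: (eta_wordT_free kn); rewrite -(H j) dtM dt_eta_word.
by rewrite scaler0 addr0.
Qed.

Lemma cyc_top u : (k < n)%N -> cyc k u ->
  exists f, [/\ o_inv f, tfree f & u = f *: eta_word setT].
Proof.
move=> kn [uI uk ut ue]; have kn' := ltnW kn.
have [f [h [fO hO E]]] := in_words_deg uk (inv_in_words O_orth lie_inv kn' uI).
have fE : \sum_(J : {set 'I_k} | #|J| == k) f J *: eta_word J = f setT *: eta_word setT.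
  by rewrite (eq_bigl _ _ cardT_k) big_pred1_eq.
set y := \sum_(J : {set 'I_k} | _) h J *: _ in E.
have cofZ i p psi : cof_eta i (p *: psi) = p *: cof_eta i psi.
  rewrite /cof_eta scaler_sumr; apply: eq_bigr => j _.
  by rewrite eta_opZ !scalerA mulrC.
have ye j : eta_op j y = 0.
  by have := ue j; rewrite E eta_opD fE eta_opZ eta_eta_wordT scaler0 add0r.
(* All words in y have length n - k, so the operator of [cof_number] multiplies y by (n - k) det
   gram, which is nonzero; but eta_j y = 0 makes the result vanish. *)
have y0 : y = 0.
  have : \sum_i iot_op i (cof_eta i y) = 0.
    rewrite big1// => i _; rewrite /cof_eta big1 ?iot_op0// => j _.
    by rewrite ye scaler0.
  have -> : \sum_i iot_op i (cof_eta i y) = ((n - k)%:R * \det gram) *: y.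
    have yE i : cof_eta i y = \sum_(J : {set 'I_k} | (k + #|J|)%N == n)
        h J *: cof_eta i (iot_word J).
      rewrite /cof_eta; under [RHS]eq_bigr do rewrite scaler_sumr.
      rewrite exchange_big; apply: eq_bigr => j _ /=.
      rewrite /y [eta_op j _]linear_sum scaler_sumr; apply: eq_bigr => J _ /=.
      by rewrite eta_opZ !scalerA mulrC.
    under eq_bigr do rewrite yE [iot_op _ _]linear_sum.
    rewrite exchange_big /y scaler_sumr; apply: eq_bigr => J /eqP Jn /=.
    under eq_bigr do rewrite iot_opZ.
    have cJ : #|J| = (n - k)%N by apply/eqP; rewrite -(eqn_add2l k) Jn subnKC.
    by rewrite -scaler_sumr cof_number cJ !scalerA mulrC.
  move/polyform_scale_eq0 => [/eqP|//]; rewrite mulf_eq0.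
  rewrite (negPf (@det_gram_neq0 C n k kn')) orbF -mpolyC_nat mpolyC_eq0.
  by rewrite pnatr_eq0 subn_eq0 leqNgt kn.
have uE : u = f setT *: eta_word setT by rewrite E fE y0 addr0.
exists (f setT); split; [exact: fO| |exact: uE].
by apply: tfreeP => // j; rewrite -uE ut.
Qed.

Lemma iot_word1 j : iot_word [set j] = iot_op j (vol : K).
Proof.
have := @mul_word P K k (fun j => @iot_op C n k j : {linear K -> K}) (vol : K)
  finset.set0 j (@iot_anticommuting C n k).
rewrite in_set0 setU0 word0 /parity.
have -> : forall r, count (mem (finset.set0 : {set 'I_k})) r = 0%N.
  by move=> r; elim: r => //= i r ->; rewrite in_set0.
by rewrite expr0 scale1r => /esym.
Qed.

Lemma iot_word_set0 : iot_word finset.set0 = (vol : K).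
Proof. exact: word0. Qed.

Lemma top_form y : (k < n)%N -> so_inv y -> hdeg n y ->
  exists2 s, o_inv s & y = s *: (vol : K).
Proof.
move=> kn yI yn.
have [f [h [fO hO ->]]] := in_words_deg yn (inv_in_words O_orth lie_inv (ltnW kn) yI).
exists (h finset.set0); first exact: hO.
rewrite big1 ?add0r => [|J /eqP Jn]; last first.
  by have := max_card (mem J); rewrite Jn card_ord leqNgt kn.
rewrite -iot_word_set0 (eq_bigl (pred1 finset.set0)) ?big_pred1_eq// => J.
by rewrite /= -{2}[n]addn0 eqn_add2l cards_eq0.
Qed.

(** For k = n the word in all eta_j reaches the top degree as well, next to vol. *)
Lemma top_form_eq y : k = n -> so_inv y -> hdeg n y ->
  exists f s, [/\ o_inv f, o_inv s & y = f *: eta_word setT + s *: (vol : K)].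
Proof.
move=> kn yI yn; have kn' : (k <= n)%N by rewrite kn.
have [f [h [fO hO ->]]] := in_words_deg yn (inv_in_words O_orth lie_inv kn' yI).
exists (f setT), (h finset.set0); split; [exact: fO|exact: hO|congr (_ + _)].
  rewrite (eq_bigl (pred1 setT)) ?big_pred1_eq// => J.
  by rewrite /= -cardT_k; congr (_ == _).
rewrite -iot_word_set0 (eq_bigl (pred1 finset.set0)) ?big_pred1_eq// => J.
by rewrite /= -{2}[n]addn0 eqn_add2l cards_eq0.
Qed.

Lemma hdeg_top psi : hdeg n psi -> psi = psi setT *: (vol : K).
Proof.
move=> H; apply/ffunP => I; rewrite polyformZE volE ffunE.
have [->|IT] := eqVneq I setT; first by rewrite mulr1.
rewrite mulr0 H// => In; case/eqP: IT; apply/eqP.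
by rewrite eqEcard subsetT cardsT card_ord In /=.
Qed.

Lemma vol_free p : p *: (vol : K) = 0 -> p = 0.
Proof.
move=> /(congr1 (fun x : K => x setT)); rewrite polyformZE volE !ffunE eqxx.
by rewrite mulr1.
Qed.

Lemma vol_inj p q : p *: (vol : K) = q *: (vol : K) -> p = q.
Proof.
move=> /eqP; rewrite -subr_eq0 -scalerBl => /eqP/vol_free/eqP.
by rewrite subr_eq0 => /eqP.
Qed.

Lemma koszul_qpol psi : koszul psi = \sum_a qmpol a *: fmul a psi.
Proof.
rewrite /koszul; under eq_bigr do rewrite etaE scaler_sumr.
rewrite exchange_big; apply: eq_bigr => a _ /=.
rewrite scaler_suml; apply: eq_bigr => j _.
by rewrite scalerA mulrC.
Qed.

Lemma koszul_iot_vol j : koszul (iot_op j (vol : K)) = cmpol j *: (vol : K).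
Proof.
rewrite /koszul scaler_suml; apply: eq_bigr => i _.
by rewrite eta_iot eta_vol iot_op0 subr0 scalerA mulrC gramE [gram i j]gramE;
  congr (_ * _ *: _); apply: eq_bigr => a _; rewrite mulrC.
Qed.

(* The image of the Koszul map is orthogonal to the kernel of its adjoint. *)
Lemma koszul_coclosed chi : koszul_adj (koszul chi) = 0 -> koszul chi = 0.
Proof. by move=> H; apply: fischer_eq0; rewrite adj_koszul H fischer0r. Qed.

(** c_j vol is T applied to iota_j vol, so multiples of vol by such combinations lie in the image of
    T, which meets the kernel of its adjoint only in 0. *)
Lemma cideal_disj (g : 'I_k -> P) :
  koszul_adj ((\sum_j g j * cmpol j) *: (vol : K)) = 0 -> \sum_j g j * cmpol j = 0.
Proof.
have -> : (\sum_j g j * cmpol j) *: (vol : K) =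
    koszul (\sum_j g j *: iot_op j (vol : K)).
  rewrite koszul_sum scaler_suml; apply: eq_bigr => j _.
  by rewrite koszulZ koszul_iot_vol scalerA.
move/koszul_coclosed => E; apply: vol_free; rewrite -E koszul_sum scaler_suml.
by apply: eq_bigr => j _; rewrite koszulZ koszul_iot_vol scalerA.
Qed.

Lemma koszul_contract_vol a :
  koszul (fcontract a (vol : K)) = qmpol a *: (vol : K).
Proof.
have V b : fmul b (vol : K) = 0 by rewrite fmul.unlock; apply: ext_mul_vol.
have E b : fmul b (fcontract a (vol : K)) = (a == b)%:R *: (vol : K).
  have /eqP := fcontract_mul a b (vol : K).
  by rewrite V fcontract0 eq_sym subr_eq0 => /eqP.
rewrite koszul_qpol (bigD1 a)//= big1 ?addr0 => [|b ba]; rewrite E.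
  by rewrite eqxx scale1r.
by rewrite eq_sym (negPf ba) scale0r scaler0.
Qed.

Lemma qideal_disj (g : 'I_n -> P) :
  koszul_adj ((\sum_a g a * qmpol a) *: (vol : K)) = 0 -> \sum_a g a * qmpol a = 0.
Proof.
have -> : (\sum_a g a * qmpol a) *: (vol : K) =
    koszul (\sum_a g a *: fcontract a (vol : K)).
  rewrite koszul_sum scaler_suml; apply: eq_bigr => a _.
  by rewrite koszulZ koszul_contract_vol scalerA.
move/koszul_coclosed => E; apply: vol_free; rewrite -E koszul_sum scaler_suml.
by apply: eq_bigr => a _; rewrite koszulZ koszul_contract_vol scalerA.
Qed.

(** By [koszul_qpol] every T chi of degree n is a combination of the q_a times vol, so the
    decomposition along T is one along the ideal. *)
Lemma poly_split h : exists h' (g : 'I_n -> P),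
  koszul_adj (h' *: (vol : K)) = 0 /\ h = h' + \sum_a g a * qmpol a.
Proof.
have volH p : hdeg n (p *: (vol : K)) by apply/hdeg_fZ/hdeg_vol.
have [D hD] := dlt_ex (h *: (vol : K)).
have US : subsp (hdeg n : K -> Prop).
  by split=> [|x y xn yn|c x xn]; [exact: hdeg0|exact: hdegD|exact: hdeg_fZ].
have UT (x : K) : hdeg n x -> hdeg n (koszul (koszul_adj x)).
  by move=> xn; apply/hdegp_koszul/hdegp_koszul_adj.
have [w [u [[wn _] [un _] E u0]]] := koszul_decomposition US UT (volH h) hD.
exists (u setT), (fun a => fmul a (koszul_adj w) setT); split.
  by rewrite -(hdeg_top un).
apply: vol_inj; rewrite E scalerDl -(hdeg_top un) addrC; congr (_ + _).
rewrite koszul_qpol scaler_suml; apply: eq_bigr => a _.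
rewrite {1}(@hdeg_top (fmul a (koszul_adj w))) ?scalerA 1?mulrC//.
exact/hdegp_fmul/hdegp_koszul_adj.
Qed.

Hypothesis O_refl : exists2 g, O g & \det g = -1.
Hypothesis n_gt0 : (0 < n)%N.

Lemma o_inv_top p : (forall g, O g -> act g (p *: (vol : K)) =
  mpolyC N (\det g) *: (p *: (vol : K))) -> o_inv p.
Proof.
move=> H g gO; have /eqP := congr1 determinant (O_orth gO).
rewrite det_mulmx det_tr det1 => /eqP dg; have d0 : \det g != 0.
  by apply/eqP => d0; move/eqP: dg; rewrite d0 mulr0 eq_sym oner_eq0.
have := H g gO; rewrite actZ act_vol !scalerA mulrC => /vol_inj.
by apply: mulfI; rewrite mpolyC_eq0.
Qed.

(** The decomposition is carried out among the forms that transform by the determinant, as s vol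
    does, so that the form chi of degree n - 1 under T does so too. Writing chi as a combination of
    the iota_j vol then produces the c_j. *)
Lemma ideal_split s : (k <= n)%N -> o_inv s -> exists s' (g : 'I_k -> P),
  [/\ o_inv s', koszul_adj (s' *: (vol : K)) = 0, forall j, o_inv (g j)
    & s = s' + \sum_j g j * cmpol j].
Proof.
move=> kn sO; pose U (x : K) := hdeg n x /\
  forall g, O g -> act g x = mpolyC N (\det g) *: x.
have US : subsp U.
  split=> [|x y [xn xU] [yn yU]|c x [xn xU]].
  - by split=> [|g gO]; [exact: hdeg0|rewrite act0 scaler0].
  - by split=> [|g gO]; [exact: hdegD|rewrite actD xU// yU// scalerDr].
  - by split=> [|g gO]; [exact: hdeg_fZ|rewrite actC xU// !scalerA mulrC].
have UT x : U x -> U (koszul (koszul_adj x)).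
  move=> [xn xU]; split=> [|g gO]; first exact/hdegp_koszul/hdegp_koszul_adj.
  by rewrite act_koszul ?O_orth// act_koszul_adj ?O_orth// xU// koszul_adj_C koszulZ.
have Us : U (s *: (vol : K)).
  split=> [|g gO]; first exact/hdeg_fZ/hdeg_vol.
  by rewrite actZ act_vol sO// !scalerA mulrC.
have [D sD] := dlt_ex (s *: (vol : K)).
have [w [u [[[wn wU] _] [[un uU] _] E u0]]] := koszul_decomposition US UT Us sD.
pose chi : K := koszul_adj w.
have chiU g : O g -> act g chi = mpolyC N (\det g) *: chi.
  by move=> gO; rewrite act_koszul_adj ?O_orth// wU// koszul_adj_C.
have chiI : so_inv chi by move=> g gO g1; rewrite chiU// g1 mpolyC1 scale1r.
have chin : hdeg n.-1 chi.
  by apply/hdegpS; rewrite prednK//; apply: hdegp_koszul_adj.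
have [f [h [fO hO chiE]]] := in_words_deg chin (inv_in_words O_orth lie_inv kn chiI).
move: chiE; set A : K := \sum_(J | _) _; set B : K := \sum_(J | _) _ => chiE.
have [r rO r1] := O_refl.
(* A reflection fixes the words in eta, while it must reverse the sign of chi. *)
have A0 : A = 0.
  have rA : act r A = A.
    rewrite /A; elim/big_rec: _ => [|J x _ Hx]; first exact: act0.
    by rewrite actD Hx actZ fO// (inv_eta_word _ O_orth).
  have rB : act r B = - B.
    rewrite /B; elim/big_rec: _ => [|J x _ Hx]; first by rewrite act0 oppr0.
    rewrite actD Hx actZ hO// (act_iot_word _ O_orth)// r1 mpolyCN mpolyC1.
    by rewrite scaleN1r scalerN opprD.
  have := chiU r rO; rewrite chiE actD rA rB r1 mpolyCN mpolyC1 scaleN1r opprD.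
  move/addIr => /eqP; rewrite -addr_eq0 -mulr2n -scaler_nat => /eqP.
  move/polyform_scale_eq0 => [/eqP|//].
  by rewrite -mpolyC_nat mpolyC_eq0 pnatr_eq0.
(* Degree n - 1 leaves only the words of length one in iota. *)
have BE : B = \sum_j h [set j] *: iot_op j (vol : K).
  rewrite /B (reindex_omap set1 unset1) /=; last first.
    move=> J; rewrite -{2}(prednK n_gt0) -addn1 eqn_add2l => /cards1P[j ->].
    by rewrite set1K.
  apply: eq_big => [j|j _]; last by rewrite iot_word1.
  by rewrite cards1 addn1 prednK// eqxx set1K eqxx.
exists (u setT), (fun j => h [set j]); split.
- by apply: o_inv_top; rewrite -(hdeg_top un).
- by rewrite -(hdeg_top un).
- by move=> j; apply: hO.
- apply: vol_inj; rewrite E scalerDl -(hdeg_top un) addrC; congr (_ + _).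
  rewrite -/chi chiE A0 add0r BE koszul_sum scaler_suml; apply: eq_bigr => j _.
  by rewrite koszulZ koszul_iot_vol scalerA.
Qed.

(** A reflection fixes the first term and reverses the sign of the second. *)
Lemma eta_vol_disj f s : o_inv f -> o_inv s ->
  f *: eta_word setT + s *: (vol : K) = 0 -> f *: eta_word setT = 0.
Proof.
move=> fO sO E; have [r rO r1] := O_refl.
have rf : act r (f *: eta_word setT) = f *: eta_word setT.
  by rewrite actZ (fO r rO) (inv_eta_word _ O_orth rO).
have rs : act r (s *: (vol : K)) = - (s *: (vol : K)).
  by rewrite actZ act_vol r1 (sO r rO) mpolyCN mpolyC1 scaleN1r scalerN.
have := congr1 (act r) E; rewrite act0 actD rf rs; move: E.
move: (f *: _) (s *: _) => X Y + /eqP; rewrite subr_eq0 => + /eqP E'.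
rewrite E' -mulr2n -scaler_nat => /polyform_scale_eq0[/eqP|//].
by rewrite -mpolyC_nat mpolyC_eq0 pnatr_eq0.
Qed.

Lemma top_coclosed f s : k = n -> o_inv f -> o_inv s ->
  koszul_adj (f *: eta_word setT + s *: (vol : K)) = 0 ->
  tfree f /\ koszul_adj (s *: (vol : K)) = 0.
Proof.
move=> kn fO sO; rewrite koszul_adjD => E.
have kn' : (k <= n)%N by rewrite kn.
have [r rO r1] := O_refl.
have E' : koszul_adj (f *: eta_word setT) - koszul_adj (s *: (vol : K)) = 0.
  rewrite -[LHS]/(_ - koszul_adj (s *: _)).
  have := congr1 (act r) E; rewrite act0 actD !act_koszul_adj ?O_orth// !actZ.
  rewrite (inv_eta_word _ O_orth)// act_vol r1 fO// sO// scalerA mulrC -scalerA.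
  by rewrite koszul_adj_C mpolyCN mpolyC1 scaleN1r.
have f0 : koszul_adj (f *: eta_word setT) = 0.
  have : koszul_adj (f *: eta_word setT) *+ 2 = 0.
    move: E E'; move: (koszul_adj _) (koszul_adj _) => Y X.
    by move=> + /eqP; rewrite subr_eq0 => + /eqP E'; rewrite E' mulr2n.
  rewrite -scaler_nat => /polyform_scale_eq0[/eqP|//].
  by rewrite -mpolyC_nat mpolyC_eq0 pnatr_eq0.
split; last by move: E; rewrite f0 add0r.
(* The squared norm of d/dt_j of the form is the inner product of t_j d/dt_j of it with the form
   itself. The former lies in the image of T: remove eta_j from the word, and T restores it with the
   factor t_j, as every other eta_i already occurs. A coclosed form is orthogonal to that image. *)
apply: tfreeP => // j; apply: fischer_eq0; rewrite -adj_t.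
rewrite dtM dt_eta_word scaler0 addr0; move: (mderiv _ f) => g.
pose e := (-1) ^+ parity (index_enum 'I_k) j ([set: 'I_k] :\ j) : P.
have eE i : eta_op i (eta_word (setT :\ j)) = (i == j)%:R *: (e *: eta_word setT).
  have := @mul_word P K k (fun j => @eta_op C n k j : {linear K -> K}) (ext1 : K)
    (setT :\ j) i (@eta_anticommuting C n k).
  rewrite !inE andbT; have [-> /=|_ /=] := eqVneq i j; last by rewrite scale0r.
  by rewrite setD1K ?inE// scale1r.
have e2 : e * e = 1 by rewrite -expr2 sqrr_sign.
have -> : tpol j *: (g *: eta_word setT) = koszul ((e * g) *: eta_word (setT :\ j)).
  rewrite /koszul (bigD1 j)//= big1 ?addr0 => [|i /negPf ij].
    by rewrite eta_opZ eE eqxx scale1r !scalerA; congr (_ *: _); rewrite -[LHS]mulr1 -e2; ring.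
  by rewrite eta_opZ eE ij scale0r !scaler0.
by rewrite adj_koszul f0 fischer0r.
Qed.

End Top.

(** * Polynomials times the Gaussian *)

Import numFieldNormedType.Exports.

Section PartialDerivative.
Variables (R : realType) (m k : nat).
Local Notation V := 'M[R]_(m, k).
Local Notation C := R[i].
Local Notation F := (V -> C^o).
Implicit Types (v e : V) (f g : F) (c d : C).

(** Reduces a directional derivative to the derivative of a function of one real variable. *)
Lemma is_derive_line (f : V -> R) v e (d : R) :
  is_derive (0 : R) 1 (fun h : R => f (h *: e + v)) d -> is_derive v e f d.
Proof.
have E : (fun h : R => h^-1 *: (((fun h => f (h *: e + v)) \o shift (0:R)) (h *: 1) -
    (fun h => f (h *: e + v)) 0)) =
  (fun h : R => h^-1 *: ((f \o shift v) (h *: e) - f v)).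
  by apply/funext => h /=; rewrite addr0 scale0r add0r [_ *: 1]mulr1.
move=> [df dE]; split; first by move: df; rewrite /derivable E.
by move: dE; rewrite /derive E.
Qed.

Definition is_partial e f v d :=
  is_derive v e (fun w => complex.Re (f w)) (complex.Re d) /\
  is_derive v e (fun w => complex.Im (f w)) (complex.Im d).

Lemma is_partialE i j f v d :
  is_partial (delta_mx i j) f v d -> partial i j f v = d.
Proof.
move=> [[_ dr] [_ di]]; rewrite /partial dr di.
by case: d {dr di}.
Qed.

Lemma is_partial_cst e v c : is_partial e (fun=> c) v 0.
Proof. by split; apply: is_derive_cst. Qed.

Lemma is_partialD e f g v c d : is_partial e f v c -> is_partial e g v d ->
  is_partial e (fun w => f w + g w) v (c + d).
Proof.
move=> [fr fi] [gr gi]; split.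
- rewrite (_ : (fun w => _) = (fun w => complex.Re (f w)) + (fun w => complex.Re (g w))).
    by rewrite (raddfD (@complex.Re R)); apply: is_deriveD.
  by apply/funext => w; exact: (raddfD (@complex.Re R)).
- rewrite (_ : (fun w => _) = (fun w => complex.Im (f w)) + (fun w => complex.Im (g w))).
    by rewrite (raddfD (@complex.Im R)); apply: is_deriveD.
  by apply/funext => w; exact: (raddfD (@complex.Im R)).
Qed.

Lemma is_partialM e f g v c d : is_partial e f v c -> is_partial e g v d ->
  is_partial e (fun w => f w * g w) v (c * g v + f v * d).
Proof.
have Re_mul (x y : C) : complex.Re (x * y) =
  complex.Re x * complex.Re y - complex.Im x * complex.Im y by case: x y => [? ?] [].
have Im_mul (x y : C) : complex.Im (x * y) =
  complex.Re x * complex.Im y + complex.Im x * complex.Re y by case: x y => [? ?] [].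
move=> [fr fi] [gr gi]; split.
- rewrite (_ : (fun w => _) =
    (fun w => complex.Re (f w)) * (fun w => complex.Re (g w)) -
    (fun w => complex.Im (f w)) * (fun w => complex.Im (g w))); last first.
    by apply/funext => w; exact: Re_mul.
  apply: is_derive_eq (is_deriveB (is_deriveM fr gr) (is_deriveM fi gi)) _.
  rewrite (raddfD (@complex.Re R)) /= !Re_mul.
  by rewrite -![_ *: _]/(_ * _); ring.
- rewrite (_ : (fun w => _) =
    (fun w => complex.Re (f w)) * (fun w => complex.Im (g w)) +
    (fun w => complex.Im (f w)) * (fun w => complex.Re (g w))); last first.
    by apply/funext => w; exact: Im_mul.
  apply: is_derive_eq (is_deriveD (is_deriveM fr gi) (is_deriveM fi gr)) _.
  rewrite (raddfD (@complex.Im R)) /= !Im_mul.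
  by rewrite -![_ *: _]/(_ * _); ring.
Qed.

Lemma is_partial_real e (f : V -> R) v (d : R) :
  is_derive v e f d -> is_partial e (fun w => (f w)%:C%C) v d%:C%C.
Proof. by move=> df; split=> //=; apply: is_derive_cst. Qed.

Lemma is_derive_coord e v i j : is_derive v e (fun w : V => w i j) (e i j).
Proof.
apply: is_derive_line; rewrite (_ : (fun h : R => _) = (fun h => h * e i j + v i j)).
  apply: is_derive_eq (is_deriveD (is_deriveM (is_derive_id _ _)
    (is_derive_cst (e i j) _ _)) (is_derive_cst (v i j) _ _)) _.
  by rewrite -![_ *: _]/(_ * _) mulr0 add0r mulr1 addr0.
by apply/funext => h; rewrite !mxE.
Qed.

End PartialDerivative.

Section Gaussian.
Variables (R : realType) (n k : nat).
Local Notation Vk := 'M[R]_(n + 1, k).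
Local Notation C := R[i].
Local Notation N := ((n + 1) * k)%N.
Local Open Scope complex_scope.
Implicit Types (v : Vk) (p q : mpoly N C).

Definition mev v p : C := meval (fun s => (mxvec v 0 s)%:C) p.

Lemma mev_partial i j v p :
  is_partial (delta_mx i j) (fun w => mev w p) v (mev v (mderiv (mxvec_index i j) p)).
Proof.
move: p; apply: mpoly_gen_ind => [c|s|p q Hp Hq|p q Hp Hq].
- rewrite mderivC [mev v _]meval0 (_ : (fun w => _) = (fun=> c)).
    exact: is_partial_cst.
  by apply/funext => w; rewrite /mev mevalC.
- case/mxvec_indexP: s => i' j'.
  rewrite (_ : (fun w => _) = (fun w : Vk => (w i' j')%:C)); last first.
    by apply/funext => w; rewrite /mev mevalXU mxvecE.
  rewrite mderiv_var /mev -mpolyC_nat mevalC.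
  have -> : (mxvec_index i j == mxvec_index i' j')%:R = (delta_mx i j i' j' : R)%:C.
    rewrite mxE mxvec_index_eq rmorph_nat.
    by rewrite (eq_sym i) (eq_sym j).
  exact/is_partial_real/is_derive_coord.
- rewrite (_ : (fun w => _) = (fun w => mev w p + mev w q)); last first.
    by apply/funext => w; rewrite /mev mevalD.
  by rewrite /mev mderivD mevalD; exact: is_partialD Hp Hq.
- rewrite (_ : (fun w => _) = (fun w => mev w p * mev w q)); last first.
    by apply/funext => w; rewrite /mev mevalM.
  by rewrite /mev mderivM mevalD !mevalM; exact: is_partialM Hp Hq.
Qed.

Lemma gaussianE v : gaussian v = (expR (- (2^-1 * \sum_i \sum_j v i j ^+ 2)))%:C.
Proof.
rewrite /gaussian; congr (_%:C); rewrite -expR_sum; congr expR.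
rewrite sumrN; congr (- _); rewrite -mulr_sumr; congr (_ * _).
rewrite exchange_big; apply: eq_bigr => j _ /=.
rewrite big_split_ord /= big_ord1; congr (_ + _); last by rewrite mxE.
by apply: eq_bigr => a _; rewrite mxE.
Qed.

Lemma gaussian_neq0 v : gaussian v != 0.
Proof.
by rewrite gaussianE; apply/eqP => -[/eqP]; rewrite gt_eqF// expR_gt0.
Qed.

Lemma gaussian_partial i j v :
  is_partial (delta_mx i j) (@gaussian R n k) v (- ((v i j)%:C * gaussian v)).
Proof.
rewrite (_ : @gaussian R n k = fun w => (expR (- (2^-1 * \sum_i \sum_j w i j ^+ 2)))%:C);
  last by apply/funext => w; exact: gaussianE.
rewrite -rmorphM -rmorphN; apply: is_partial_real; apply: is_derive_line.
pose e : R := expR (- (2^-1 * \sum_i \sum_j v i j ^+ 2)).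
(* Along a line parallel to a coordinate axis the squared norm is a quadratic polynomial in h. *)
have sq (h : R) : \sum_i' \sum_j' (h *: delta_mx i j + v) i' j' ^+ 2 =
    \sum_i' \sum_j' v i' j' ^+ 2 + (2%:R * h * v i j + h ^+ 2).
  transitivity (\sum_i' \sum_j' (v i' j' ^+ 2 +
      ((i' == i) && (j' == j))%:R * (2%:R * h * v i j + h ^+ 2))).
    apply: eq_bigr => i' _; apply: eq_bigr => j' _; rewrite !mxE.
    by case: eqP => [->|_] /=; [case: eqP => [->|_] /=|]; ring.
  under eq_bigr do rewrite big_split /=.
  rewrite big_split /=; congr (_ + _).
  rewrite (bigD1 i)//= eqxx (bigD1 j)//= eqxx mul1r !big1 ?addr0// => i' /negPf.
    by move=> ->; rewrite big1// => j' _; rewrite mul0r.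
  by move=> ->; rewrite mul0r.
rewrite (_ : (fun h : R => _) = expR \o (fun h => - (2^-1 *
   (\sum_i' \sum_j' v i' j' ^+ 2 + (2%:R * h * v i j + h ^+ 2))))); last first.
  by apply/funext => h /=; rewrite sq.
pose g (h : R) := - (2^-1 * (\sum_i' \sum_j' v i' j' ^+ 2 + (2%:R * h * v i j + h ^+ 2))).
have gd : is_derive (0 : R) 1 g (- v i j).
  rewrite /g; apply: is_derive_eq; rewrite -?[_ *: _]/(_ * _) /=.
  by field.
apply: is_derive_eq (is_derive1_comp (is_derive_expR _) gd) _.
have -> : g 0 = - (2^-1 * \sum_i' \sum_j' v i' j' ^+ 2).
  by rewrite /g mulr0 mul0r expr0n /= !addr0.
by rewrite mulrC mulNr.
Qed.

End Gaussian.

Section ExtMorphism.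
Variables (P Q : comNzRingType) (n : nat) (f : {rmorphism P -> Q}) (g : 'M[P]_n).

(** Applied with f the evaluation at a point, it carries the action on polynomial forms over to
    forms with complex values. *)
Definition ext_coef (psi : ext P n) : ext Q n := [ffun I => f (psi I)].

Lemma ext_coef_word s I : ext_coef (word_on s (rot_mul g) ext1 I) =
  word_on s (rot_mul (map_mx f g)) ext1 I.
Proof.
elim: s => [|i s IH] /=.
  by apply/ffunP => J; rewrite !ffunE rmorph_nat.
case: ifP => _ //; rewrite -IH; move: (word_on _ _ _ _) => w.
apply/ffunP => J; rewrite ffunE /rot_mul /rot_op !sum_ffunE rmorph_sum.
apply: eq_bigr => j _; rewrite !ffunE !ext_mulE mxE.
rewrite -[_ *: _]/(_ * _) -[RHS]/(_ * _) rmorphM; case: ifP => _; last first.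
  by rewrite rmorph0.
by rewrite rmorphM rmorphXn rmorphN1 !ffunE.
Qed.

Lemma ext_coef_map psi :
  ext_coef (ext_map g psi) = ext_map (map_mx f g) (ext_coef psi).
Proof.
rewrite {1}[psi]ext_expand [in RHS](ext_expand (ext_coef psi)) !linear_sum /=.
apply/ffunP => J; rewrite ffunE !sum_ffunE rmorph_sum; apply: eq_bigr => I _ /=.
rewrite !linearZ /= !ext_map_word /word -ext_coef_word.
move: (word_on _ _ _ _) => w.
by rewrite !ffunE -[_ *: _]/(_ * _) rmorphM.
Qed.

End ExtMorphism.

(** * Transfer to the cochain complex *)

Section Bridge.
Variables (R : realType) (n k : nat).
Local Notation Vk := 'M[R]_(n + 1, k).
Local Notation C := R[i].
Local Notation N := ((n + 1) * k)%N.
Local Notation P := (mpoly N C).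
Local Notation K := (polyform C N n).
Local Notation rc := (real_complex R).
Local Open Scope complex_scope.
Implicit Types (v : Vk) (p q : P) (psi chi : K) (g : 'M[R]_n) (a : 'I_n) (j : 'I_k).

(** The set [O] of the algebraic part: real matrices, seen over the field of the polynomial
    coefficients. *)
Definition real_orthogonal (h : 'M[C]_n) :=
  exists2 g : 'M[R]_n, orthogonal_mx g & h = map_mx rc g.

Lemma real_orthogonal_tr h : real_orthogonal h -> h^T *m h = 1%:M.
Proof.
move=> [g gO ->]; rewrite matrix.map_trmx -map_mxM.
by rewrite (mulmx1C gO) map_mx1.
Qed.

Lemma real_orthogonal_refl : (0 < n)%N ->
  exists2 h, real_orthogonal h & \det h = -1.
Proof.
move=> n0; pose d : 'rV[R]_n := \row_a (if a == Ordinal n0 then -1 else 1).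
exists (map_mx rc (diag_mx d)).
  exists (diag_mx d) => //; rewrite /orthogonal_mx tr_diag_mx mulmx_diag.
  apply/matrixP => a b; rewrite !mxE; case: (a == b) => //=.
  by case: ifP; rewrite ?mulrNN mulr1.
rewrite det_map_mx det_diag (bigD1 (Ordinal n0))//= big1 => [|a /negPf a0].
  by rewrite mxE eqxx mulr1 rmorphN1.
by rewrite mxE a0.
Qed.

Lemma so_invP psi : so_inv real_orthogonal psi <->
  forall g, special_orthogonal_mx g -> act (map_mx rc g) psi = psi.
Proof.
split=> [H g [gO g1]|H h [g gO ->] g1].
  by apply: H; [exists g|rewrite det_map_mx g1].
apply: H; split=> //; apply: (@complexI R).
by move: g1; rewrite det_map_mx.
Qed.

Lemma so_inv_lie psi : so_inv real_orthogonal psi -> forall a b, lie a b psi = 0.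
Proof. by move=> /so_invP; exact: lie_invariant. Qed.

Lemma mevD v p q : mev v (p + q) = mev v p + mev v q.
Proof. exact: mevalD. Qed.

Lemma mevB v p q : mev v (p - q) = mev v p - mev v q.
Proof. exact: mevalB. Qed.

Lemma mevM v p q : mev v (p * q) = mev v p * mev v q.
Proof. exact: mevalM. Qed.

Lemma mevC v c : mev v (mpolyC N c) = c.
Proof. exact: mevalC. Qed.

Lemma mev_sum v (I : finType) (F : I -> P) :
  mev v (\sum_i F i) = \sum_i mev v (F i).
Proof. by rewrite /mev raddf_sum. Qed.

Lemma mev_x v a j : mev v (xpol a j) = xcoord a j v.
Proof. by rewrite /mev mevalXU xvar.unlock mxvecE /xcoord mxE. Qed.

Lemma mev_t v j : mev v (tpol j) = tcoord j v.
Proof. by rewrite /mev mevalXU tvar.unlock mxvecE /tcoord mxE. Qed.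

Lemma mev_inj p q : (forall v, mev v p = mev v q) -> p = q.
Proof.
move=> H; apply/eqP; rewrite -subr_eq0; apply/eqP/meval_eq0 => x.
have := H (vec_mx (\row_s x s)); rewrite /mev mevalB.
have E p' : meval (fun s => (mxvec (vec_mx (\row_s0 x s0) : Vk) 0 s)%:C) p' =
    meval (fun s => (x s)%:C) p'.
  by apply: meval_eq => s; rewrite vec_mxK mxE.
by rewrite !E => ->; rewrite subrr.
Qed.

Lemma mev_subst g v p : orthogonal_mx g ->
  mev v (subst (map_mx rc g) p) = mev (invmx (embed g) *m v) p.
Proof.
move=> gO; have gI : invmx g = g^T.
  by rewrite -[LHS]mulmx1 -gO mulKmx// orthogonal_unitmx.
pose Q p := mev v (subst (map_mx rc g) p) = mev (invmx (embed g) *m v) p.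
move: p; refine (@coord_ind C n k Q _ _ _ _ _) => [c|a j|j|p q Hp Hq|p q Hp Hq];
  rewrite /Q.
- by rewrite substC !mevC.
- rewrite subst_x mev_x /xcoord invmx_embed// usubmx_embed gI mxE rmorph_sum.
  rewrite mev_sum; apply: eq_bigr => b _.
  by rewrite mevM mevC mev_x /xcoord !mxE rmorphM.
- by rewrite subst_t !mev_t /tcoord invmx_embed// dsubmx_embed.
- by rewrite substD !mevD; exact: (congr2 +%R Hp Hq).
- by rewrite substM !mevM; exact: (congr2 *%R Hp Hq).
Qed.

Lemma gaussian_invariant g v : orthogonal_mx g ->
  gaussian (invmx (embed g) *m v) = gaussian v.
Proof.
move=> gO; have gI : invmx g = g^T.
  by rewrite -[LHS]mulmx1 -gO mulKmx// orthogonal_unitmx.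
have E (w : 'M[R]_(n, k)) j : \sum_a w a j ^+ 2 = (w^T *m w) j j.
  by rewrite mxE; apply: eq_bigr => a _; rewrite mxE expr2.
have S j : \sum_a (g^T *m usubmx v) a j ^+ 2 = \sum_a usubmx v a j ^+ 2.
  by rewrite !E trmx_mul trmxK -mulmxA [g *m _]mulmxA gO mul1mx.
rewrite /gaussian invmx_embed// usubmx_embed dsubmx_embed gI.
by under eq_bigr do rewrite S.
Qed.

(** The identification of polynomial forms with cochains; it is injective because the Gaussian has
    no zeros, and it turns [dd] into [dform]. *)
Definition toform psi : Defs.form R n k := fun v => [ffun I => mev v (psi I) * gaussian v].

Lemma coef_toform I psi : coef I (toform psi) = (fun v => mev v (psi I)) * @gaussian R n k.
Proof. by apply/funext => v; rewrite /coef ffunE. Qed.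

Lemma toformP c psi chi :
  toform (mpolyC N c *: psi + chi) = c *: toform psi + toform chi.
Proof.
have E (x y : K) I : (x + y) I = x I + y I by rewrite !ffunE.
apply/funext => v; apply/ffunP => I; rewrite [LHS]ffunE E polyformZE mevD mevM mevC.
rewrite mulrDl -mulrA !fctE ffunE [toform chi v I]ffunE; congr (_ + _).
by rewrite ffunE [toform psi v I]ffunE.
Qed.

Lemma toformD psi chi : toform (psi + chi) = toform psi + toform chi.
Proof. by rewrite -[psi in LHS]scale1r -mpolyC1 toformP scale1r. Qed.

Lemma toform0 : toform 0 = 0.
Proof.
apply/funext => v; apply/ffunP => I; rewrite !ffunE [mev v 0]meval0 mul0r.
by [].
Qed.

Lemma toform_inj psi chi : toform psi = toform chi -> psi = chi.
Proof.
move=> E; apply/ffunP => I; apply: mev_inj => v.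
have := congr1 (fun f : Defs.form R n k => f v I) E; rewrite !ffunE.
by apply: mulIf; apply: gaussian_neq0.
Qed.

Lemma form_act_toform g psi : orthogonal_mx g ->
  form_act g (toform psi) = toform (act (map_mx rc g) psi).
Proof.
move=> gO; apply/funext => v; apply/ffunP => I.
rewrite /form_act /left_translate [RHS]ffunE actE.
pose m : {rmorphism P -> C} := meval (fun s => (mxvec v 0 s)%:C).
have -> : mev v (ext_map (cmx k (map_mx rc g))
     (subst_form (map_mx rc g) psi : ext P n) I) =
   ext_coef m (ext_map (cmx k (map_mx rc g))
     (subst_form (map_mx rc g) psi : ext P n)) I.
  by rewrite ffunE.
rewrite ext_coef_map.
have -> : map_mx m (cmx k (map_mx rc g)) = map_mx rc g.
  by apply/matrixP => a b; rewrite !mxE; exact: mevalC.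
have -> : toform psi (invmx (embed g) *m v) =
   gaussian v *: ext_coef m (subst_form (map_mx rc g) psi).
  apply/ffunP => J; rewrite !ffunE gaussian_invariant// mulrC.
  by rewrite -mev_subst.
by rewrite linearZ ffunE mulrC.
Qed.

Lemma coef_partial I i (j : 'I_k) psi v :
  partial i j (coef I (toform psi)) v =
  mev v (mderiv (mxvec_index i j) (psi I)) * gaussian v -
  (v i j)%:C * (mev v (psi I) * gaussian v).
Proof.
rewrite coef_toform; apply: is_partialE.
have := is_partialM (mev_partial i j v (psi I)) (gaussian_partial i j v).
by rewrite mulrN mulrCA.
Qed.

Lemma form_term (phi : Defs.form R n k) v a j (I : {set 'I_n}) :
  (form_mul (xcoord a j) (form_map (@partial_t R n k j) phi) v +
   form_mul (tcoord j) (form_map (@partial_x R n k a j) phi) v) I =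
  xcoord a j v * partial_t j (coef I phi) v + tcoord j v * partial_x a j (coef I phi) v.
Proof.
have E (x y : ext C n) : (x + y) I = x I + y I by rewrite ffunE.
rewrite E; apply: congr2; apply: etrans (ffunE _ _) _.
  exact: (congr1 (fun z => _ * z) (ffunE _ _)).
exact: (congr1 (fun z => _ * z) (ffunE _ _)).
Qed.

Lemma form_term_ring (A : comPzRingType) (x t d e m g : A) :
  x * (d * g - t * (m * g)) + t * (e * g - x * (m * g)) =
  (x * d + t * e - 2%:R * x * t * m) * g.
Proof. by ring. Qed.

Lemma dd_coef psi (I : {set 'I_n}) :
  dd psi I = \sum_j \sum_a (if a \in I then (-1) ^+ below I a else 0) *
    (xpol a j * mderiv (tvar n j) (psi (I :\ a)) +
     tpol j * mderiv (xvar a j) (psi (I :\ a)) -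
     2%:R * xpol a j * tpol j * psi (I :\ a)).
Proof.
pose s a : P := if a \in I then (-1) ^+ below I a else 0.
have sE a (phi : K) : fmul a phi I = s a * phi (I :\ a).
  by rewrite fmulE /s; case: ifP => // _; rewrite mul0r.
have etaI j (phi : K) : eta_op j phi I = \sum_a s a * (xpol a j * phi (I :\ a)).
  rewrite etaE sum_ffunE; apply: eq_bigr => a _.
  by rewrite polyformZE sE mulrCA.
have epsI j (phi : K) : eps_op j phi I = \sum_a s a * mderiv (xvar a j) (phi (I :\ a)).
  rewrite /eps_op sum_ffunE; apply: eq_bigr => a _.
  by rewrite sE [dx a j phi _]pderivE.
have EK (x y : K) : (x + y) I = x I + y I by rewrite !ffunE.
have EN (x y : K) : (x - y) I = x I - y I by rewrite !ffunE.
rewrite /dd EN polyformZE /ddt /koszul !sum_ffunE mulr_sumr -sumrB.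
apply: eq_bigr => j _; rewrite EK !polyformZE !etaI epsI !mulr_sumr.
rewrite -big_split -sumrB; apply: eq_bigr => a _ /=.
rewrite [dt j psi _]pderivE -/(s a); ring.
Qed.

Lemma dform_toform psi : dform (toform psi) = toform (dd psi).
Proof.
apply/funext => v; apply/ffunP => I.
pose m : {rmorphism P -> C} := meval (fun s => (mxvec v 0 s)%:C).
have mE (p : P) : m p = mev v p by [].
have Ed (x y : ext C n) J : (x + y) J = x J + y J by rewrite !ffunE.
have EK (x y : K) J : (x + y) J = x J + y J by rewrite !ffunE.
transitivity (\sum_j \sum_a ((if a \in I then (-1) ^+ below I a else 0) *
   ((xcoord a j v * mev v (mderiv (tvar n j) (psi (I :\ a))) +
     tcoord j v * mev v (mderiv (xvar a j) (psi (I :\ a))) -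
     2%:R * xcoord a j v * tcoord j v * mev v (psi (I :\ a))) * gaussian v))).
  rewrite /dform fct_sumE sum_ffunE; apply: eq_bigr => j _.
  rewrite fct_sumE sum_ffunE; apply: eq_bigr => a _.
  rewrite -ext_mul_wedge ext_mulE; case: ifP => _; last by rewrite mul0r.
  apply: (congr1 (fun z => (-1) ^+ below I a * z)).
  apply: etrans (form_term _ _ _ _ _) _.
  rewrite /partial_t /partial_x.
  rewrite (coef_partial _ (rshift n 0)) (coef_partial _ (lshift 1 a)).
  rewrite tvar.unlock xvar.unlock /xcoord /tcoord.
  have -> : usubmx v a j = v (lshift 1 a) j by rewrite mxE.
  have -> : dsubmx v 0 j = v (rshift n 0) j by rewrite mxE.
  exact: form_term_ring.
rewrite [RHS]ffunE dd_coef mev_sum mulr_suml; apply: eq_bigr => j _.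
rewrite mev_sum mulr_suml; apply: eq_bigr => a _.
rewrite mevM mevB mevD !mevM mev_x mev_t mulrA; congr (_ * _ * _).
  case: ifP => _; last by rewrite [mev v 0]meval0.
  by rewrite /mev rmorphXn rmorphN1.
by rewrite -(mpolyC_nat N C 2) mevC.
Qed.

End Bridge.

Section Cochains.
Variables (R : realType) (n k : nat).
Local Notation Vk := 'M[R]_(n + 1, k).
Local Notation C := R[i].
Local Notation N := ((n + 1) * k)%N.
Local Notation P := (mpoly N C).
Local Notation K := (polyform C N n).
Local Notation rc := (real_complex R).
Local Notation so_inv := (so_inv (@real_orthogonal R n)).
Local Notation o_inv := (o_inv (@real_orthogonal R n)).
Local Notation toform := (@toform R n k).
Local Open Scope complex_scope.
Implicit Types (v : Vk) (p q s : P) (psi chi : K) (g : 'M[R]_n) (a : 'I_n) (j : 'I_k) (l : nat).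

Definition pfun p : Vk -> C^o := fun v => mev v p.

Lemma pfunP f : f \in @Ppoly R n k <-> exists p, f = pfun p.
Proof.
split=> [/asboolP[p fp]|[p ->]]; last by apply/asboolP; exists p.
by exists p; apply/funext => v; rewrite fp.
Qed.

Lemma pfun_inj : injective pfun.
Proof. by move=> p q E; apply: mev_inj => v; exact: (congr1 (@^~ v) E). Qed.

Lemma pfunZD c p q : pfun (mpolyC N c * p + q) = c *: pfun p + pfun q.
Proof. by apply/funext => v; rewrite /pfun mevD mevM mevC. Qed.

Lemma pfunB p q : pfun (p - q) = pfun p - pfun q.
Proof. by apply/funext => v; rewrite /pfun mevB. Qed.

Lemma pfun0 : pfun 0 = 0.
Proof. by apply/funext => v; exact: meval0. Qed.

Lemma pfun_sumM (I : finType) (F G : I -> P) :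
  pfun (\sum_i F i * G i) = \sum_i pfun (F i) * pfun (G i).
Proof.
apply/funext => v; rewrite fct_sumE /pfun mev_sum.
by apply: eq_bigr => i _; rewrite mevM.
Qed.

Lemma translate_pfun g p : orthogonal_mx g ->
  translate g (pfun p) = pfun (subst (map_mx rc g) p).
Proof. by move=> gO; apply/funext => v; rewrite /pfun mev_subst. Qed.

Lemma cochainP l phi : phi \in @cochain R n k l <->
  exists psi, [/\ so_inv psi, hdeg l psi & phi = toform psi].
Proof.
split=> [/asboolP[phiS phil phiI]|[psi [psiI psil ->]]]; last first.
  apply/asboolP; split=> [I|I /eqP Il|g gSO].
  - rewrite coef_toform; apply/asboolP; exists (pfun (psi I)) => //.
    by apply/pfunP; exists (psi I).
  - rewrite coef_toform psil//; apply/funext => v.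
    by rewrite -[LHS]/(mev v 0 * gaussian v) [mev v 0]meval0 mul0r.
  - by have [gO _] := gSO; rewrite form_act_toform//; move/so_invP: psiI => ->.
have H I : exists p, coef I phi = pfun p * @gaussian R n k.
  by have /asboolP[p /pfunP[q ->] E] := phiS I; exists q.
have [p pE] := choice H.
(* The chosen polynomials are replaced by zero outside degree l, where the coefficients of [phi]
   vanish; invariance then passes back through the injective [toform]. *)
pose psi : K := [ffun I : {set 'I_n} => if #|I| == l then p I else 0].
have E : phi = toform psi.
  apply/funext => v; apply/ffunP => I; rewrite [RHS]ffunE [psi I]ffunE.
  case: ifP => [_|/negbT Il]; first exact: (congr1 (@^~ v) (pE I)).
  by rewrite [mev v 0]meval0 mul0r; exact: (congr1 (@^~ v) (phil I Il)).
exists psi; split=> //; last by move=> I /eqP/negPf Il; rewrite ffunE Il.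
apply/so_invP => g gSO; have [gO _] := gSO; apply: toform_inj.
by rewrite -form_act_toform// -E phiI.
Qed.

Lemma cocycleP l phi : phi \in @cocycle R n k l <->
  exists psi, [/\ so_inv psi, hdeg l psi, dd psi = 0 & phi = toform psi].
Proof.
split=> [/asboolP[/cochainP[psi [psiI psil ->]]]|[psi [psiI psil dpsi ->]]].
  rewrite dform_toform -(toform0 R n k) => /toform_inj dpsi.
  by exists psi.
apply/asboolP; split; first by apply/cochainP; exists psi.
by rewrite dform_toform dpsi toform0.
Qed.

(** [hdegp] lets degree 0 fit the same description: nothing has degree -1, so chi is zero there. *)
Lemma coboundaryP l phi : phi \in @coboundary R n k l <->
  exists chi, [/\ so_inv chi, hdegp l chi & phi = toform (dd chi)].
Proof.
case: l => [|l]; split=> [].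
- move=> /eqP ->; exists 0; split; [exact: so_inv0|exact: hdegp0|].
  by rewrite dd0 toform0.
- move=> [chi [_ chi0 ->]]; have -> : chi = 0.
    by apply/ffunP => I; rewrite ffunE chi0.
  by rewrite dd0 toform0; exact: eqxx.
- move=> /asboolP[_ /cochainP[chi [chiI /hdegpS chil ->]] ->].
  by exists chi; split; rewrite ?dform_toform.
- move=> [chi [chiI /hdegpS chil ->]]; apply/asboolP.
  by exists (toform chi); rewrite ?dform_toform//; apply/cochainP; exists chi.
Qed.

Lemma SpolyP f : f \in @Spoly R n k <-> exists2 s, o_inv s & f = pfun s.
Proof.
split=> [/asboolP[/pfunP[p ->] fI]|[s sO ->]].
  exists p => // h [g gO ->]; apply: pfun_inj.
  by apply: etrans (esym (translate_pfun p gO)) _; apply: fI.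
apply/asboolP; split; first by apply/pfunP; exists s.
by move=> g gO; rewrite translate_pfun// sO//; exists g.
Qed.

Lemma rpolyE i j : @rpoly R n k i j = pfun (gram i j).
Proof.
rewrite gramE pfun_sumM; apply: eq_bigr => a _.
by apply/funext => v; rewrite -[RHS]/(mev v _ * mev v _) !mev_x.
Qed.

Lemma pfun_t j : pfun (tpol j) = @tcoord R n k j.
Proof. by apply/funext => v; exact: mev_t. Qed.

Lemma pfun_x a j : pfun (xpol a j) = @xcoord R n k a j.
Proof. by apply/funext => v; exact: mev_x. Qed.

Lemma cpolyE j : @cpoly R n k j = pfun (cmpol C n j).
Proof.
rewrite /cpoly /cmpol pfun_sumM; apply: eq_bigr => i _.
by rewrite rpolyE pfun_t.
Qed.

Lemma qpolyE a : @Defs.qpoly R n k a = pfun (qmpol C k a).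
Proof.
rewrite /Defs.qpoly /qmpol pfun_sumM; apply: eq_bigr => i _.
by rewrite pfun_x pfun_t.
Qed.

Lemma cidealP f : f \in @cideal R n k <-> exists2 s : 'I_k -> P,
  (forall j, o_inv (s j)) & f = pfun (\sum_j s j * cmpol C n j).
Proof.
split=> [/asboolP[F FS ->]|[s sO ->]].
  have H j : exists s, o_inv s /\ F j = pfun s.
    by have /SpolyP[s sO E] := FS j; exists s.
  have [s sE] := choice H; exists s => [j|]; first by have [] := sE j.
  rewrite pfun_sumM; apply: eq_bigr => j _.
  by have [_ ->] := sE j; rewrite cpolyE.
apply/asboolP; exists (fun j => pfun (s j)) => [j|].
  by apply/SpolyP; exists (s j).
by rewrite pfun_sumM; apply: eq_bigr => j _; rewrite cpolyE.
Qed.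

Lemma qidealP f : f \in @qideal R n k <-> exists s : 'I_n -> P,
  f = pfun (\sum_a s a * qmpol C k a).
Proof.
split=> [/asboolP[F FS ->]|[s ->]].
  have H a : exists s, F a = pfun s.
    by have /pfunP[s E] := FS a; exists s.
  have [s sE] := choice H; exists s.
  by rewrite pfun_sumM; apply: eq_bigr => a _; rewrite qpolyE sE.
apply/asboolP; exists (fun a => pfun (s a)) => [a|].
  by apply/pfunP; exists (s a).
by rewrite pfun_sumM; apply: eq_bigr => a _; rewrite qpolyE.
Qed.

Lemma volume_formE p : volume_form (pfun p) = toform (p *: (vol : K)).
Proof.
apply/funext => v; apply/ffunP => I.
rewrite [RHS]ffunE polyformZE mevM /volume_form /form_mul ffunE !volE !ffunE.
by rewrite -[_ *: _]/(_ * _) -(mpolyC_nat N C) mevC mulrAC.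
Qed.

Lemma phi_KM_word p (f : Vk -> C^o) : f = pfun p ->
  form_mul f (@phi_KM R n k) = toform (p *: eta_word C n setT).
Proof.
move=> ->; apply/funext => v; apply/ffunP => I.
suff W : \big[@wedge C n/ext1]_(j < k) eta j v = [ffun J => mev v (eta_word C n setT J)].
  rewrite [RHS]ffunE polyformZE mevM.
  transitivity (mev v p * (gaussian v * mev v (eta_word C n setT I))); last first.
    by rewrite [gaussian v * _]mulrC mulrA.
  by rewrite /form_mul /phi_KM /form_mul W !ffunE.
transitivity (\big[@wedge C n/ext1]_(j < k | j \in setT) eta j v).
  by apply: eq_bigl => j; rewrite inE.
rewrite big_wedgeE /eta_word /word; elim: index_enum => [|j r IH] /=.
  apply/ffunP => J; rewrite !ffunE -(mpolyC_nat N C); exact: (esym (mevC _ _)).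
rewrite in_setT IH; move: (word_on _ _ _ _) => w.
rewrite /eta wedge_sum etaE; apply/ffunP => J; rewrite [RHS]ffunE !sum_ffunE mev_sum.
apply: eq_bigr => a _; rewrite polyformZE mevM mev_x ffunE -ext_mul_wedge.
rewrite -[_ *: _]/(_ * _); congr (_ * _); rewrite ext_mulE fmulE.
case: ifP => _; last by rewrite [mev v 0]meval0.
by rewrite mevM ffunE /mev rmorphXn rmorphN1.
Qed.

End Cochains.

(** * Cohomology classes *)

Section Restriction.
Variables (R : realType) (n k : nat).
Local Notation Vk := 'M[R]_(n + 1, k).
Local Notation C := R[i].
Local Notation N := ((n + 1) * k)%N.
Local Notation P := (mpoly N C).
Local Notation rc := (real_complex R).
Local Notation o_inv := (o_inv (@real_orthogonal R n)).
Local Open Scope complex_scope.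
Implicit Types (v : Vk) (p q s : P) (g : 'M[R]_n) (a : 'I_n) (j : 'I_k).
Implicit Types (f : 'M[R]_(n, k) -> C^o) (u : 'M[R]_(n, k)).

Lemma pullback_inj : injective (@pullback R n k).
Proof.
move=> f f' E; apply/funext => u.
by have := congr1 (@^~ (col_mx u 0)) E; rewrite /pullback !col_mxKu.
Qed.

Let xtuple := [tuple mxvec (xmat : 'M[P]_(n, k)) 0 i | i < n * k].

Let mev_comp v (p : mpoly (n * k) C) : mev v (comp_mpoly xtuple p) =
  meval (fun i => (mxvec (usubmx v) 0 i)%:C) p.
Proof.
rewrite /mev comp_mpoly_meval; apply: meval_eq; case/mxvec_indexP => a j.
rewrite tnth_mktuple !mxvecE !mxE; apply: etrans (mev_x v a j) _.
by rewrite /xcoord mxE.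
Qed.

Let tfree_comp (p : mpoly (n * k) C) : tfree (comp_mpoly xtuple p).
Proof.
move=> j; move: p; apply: mpoly_gen_ind => [c|i|p q Hp Hq|p q Hp Hq].
- by rewrite comp_mpolyC mderivC.
- rewrite comp_mpolyXU -tnth_nth tnth_mktuple; case/mxvec_indexP: i => a i.
  by rewrite mxvecE mxE mderiv_var eq_sym xvar_tvar.
- have -> : comp_mpoly xtuple (p + q) = comp_mpoly xtuple p + comp_mpoly xtuple q.
    exact: rmorphD.
  move: (comp_mpoly _ p) (comp_mpoly _ q) Hp Hq => x y Hp Hq.
  by rewrite mderivD Hp Hq addr0.
- have -> : comp_mpoly xtuple (p * q) = comp_mpoly xtuple p * comp_mpoly xtuple q.
    exact: rmorphM.
  move: (comp_mpoly _ p) (comp_mpoly _ q) Hp Hq => x y Hp Hq.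
  by rewrite mderivM Hp Hq mul0r mulr0 addr0.
Qed.

Lemma Rpoly_pullback f : f \in @Rpoly R n k ->
  exists s, [/\ o_inv s, tfree s & pullback f = pfun s].
Proof.
move=> /asboolP[/asboolP[p fp] fI].
have E v : mev v (comp_mpoly xtuple p) = f (usubmx v) by rewrite mev_comp fp.
exists (comp_mpoly xtuple p); split.
- move=> h [g gO ->]; apply: mev_inj => v.
  apply: etrans (mev_subst v _ gO) _; rewrite !E.
  by rewrite invmx_embed// usubmx_embed -[in RHS](fI g gO).
- exact: tfree_comp.
- by apply/funext => v; rewrite /pullback /pfun E.
Qed.

(** In characteristic 0 a monomial containing t_j would survive in the derivative with respect to
    t_j, so the value does not depend on the t-part of the point. *)
Lemma tfree_mev s v : tfree s -> mev v s = mev (col_mx (usubmx v) 0) s.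
Proof.
move=> st; rewrite /mev !mevalE; apply: eq_big_seq => m ms; congr (_ * _).
apply: eq_bigr => i _; elim/(@var_ind n k): i => [a j|j].
  by rewrite xvar.unlock !mxvecE col_mxEu mxE.
have -> : fun_of_multinom m (tvar n j) = 0%N; last by rewrite !expr0.
apply/eqP; rewrite -leqn0 leqNgt; apply/negP => m0.
have := congr1 (mcoeff (mnm_sub m (mnm1 (tvar n j)))) (st j).
rewrite mcoeff_deriv sub_mnm1K// mcoeff0 => /eqP; rewrite mulrn_eq0 /=.
by rewrite mcoeff_eq0 ms.
Qed.

Lemma tfree_Rpoly s : o_inv s -> tfree s ->
  exists2 f, f \in @Rpoly R n k & pullback f = pfun s.
Proof.
move=> sO st; pose f : 'M[R]_(n, k) -> C^o := fun u => mev (col_mx u 0) s.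
exists f; last by apply/funext => v; rewrite /pullback /f /pfun -tfree_mev.
apply/asboolP; split.
  pose Q (p : P) := (fun u => mev (col_mx u 0) p : C^o) \in polyfun R n k.
  move: @f; rewrite -/(Q s); move: s {sO st}.
  refine (@coord_ind C n k Q _ _ _ _ _) => [c|a j|j|p q Hp Hq|p q Hp Hq]; rewrite /Q.
  - rewrite (_ : (fun _ => _) = fun=> c); first exact: polyfun_cst.
    by apply/funext => u; rewrite mevC.
  - rewrite (_ : (fun _ => _) = fun u => (u a j)%:C); first exact: polyfun_coord.
    by apply/funext => u; rewrite mev_x /xcoord col_mxKu.
  - rewrite (_ : (fun _ => _) = fun=> 0); first exact: polyfun_cst.
    by apply/funext => u; rewrite mev_t /tcoord col_mxKd mxE.
  - rewrite (_ : (fun _ => _) = (fun u => mev (col_mx u 0) p : C^o) +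
      (fun u => mev (col_mx u 0) q : C^o)); first exact: polyfunD.
    by apply/funext => u; rewrite mevD.
  - rewrite (_ : (fun _ => _) = (fun u => mev (col_mx u 0) p : C^o) *
      (fun u => mev (col_mx u 0) q : C^o)); first exact: polyfunM.
    by apply/funext => u; rewrite mevM.
move=> g gO; apply/funext => u; rewrite /left_translate /f.
have E : invmx (embed g) *m col_mx u 0 = col_mx (invmx g *m u) 0.
  by rewrite invmx_embed// /embed mul_block_col !mul0mx !mulmx0 addr0 add0r.
rewrite -E; apply: etrans (esym (mev_subst _ _ gO)) _.
by apply: (congr1 (mev _)); apply: sO; exists g.
Qed.

End Restriction.

Section Classes.
Variables (K : pzRingType) (U : lmodType K) (S B : submodClosed U).
Implicit Types (h : subquotient S B) (x y : U).

Lemma val_subspaceB (z z' : Defs.subspace S) : val (z - z') = val z - val z'.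
Proof. exact: (raddfB (\val : Defs.subspace S -> U)). Qed.

Lemma val_subspace0 : val (0 : Defs.subspace S) = 0.
Proof. exact: (raddf0 (\val : Defs.subspace S -> U)). Qed.

Lemma is_class_ex x : x \in S -> exists h, is_class h x.
Proof. by move=> xS; exists (qproj (relative S B) (Subspace xS)); exists (Subspace xS). Qed.

Lemma is_class_repr h : exists2 x, x \in S & is_class h x.
Proof.
exists (val (qrepr h)); first exact: (valP (qrepr h)).
by exists (qrepr h); rewrite ?qreprK.
Qed.

Lemma is_classP c h h' x y : is_class h x -> is_class h' y ->
  is_class (c *: h + h') (c *: x + y).
Proof.
move=> [z <- ->] [z' <- ->]; exists (c *: z + z').
  exact: subspace_val_linear.
by rewrite qproj_is_linear.
Qed.

Lemma is_class_eq h x y : y \in S -> x - y \in B -> is_class h x -> is_class h y.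
Proof.
move=> yS xyB [z zx ->]; exists (Subspace yS) => //.
apply/qprojE; rewrite relativeE.
by rewrite val_subspaceB zx.
Qed.

Lemma is_class_inj h h' x y : is_class h x -> is_class h' y -> x - y \in B -> h = h'.
Proof.
move=> [z <- ->] [z' <- ->] E; apply/qprojE; rewrite relativeE.
by rewrite val_subspaceB.
Qed.

Lemma is_class_diff h x y : is_class h x -> is_class h y -> x - y \in B.
Proof.
move=> [z <- ->] [z' <- /qprojE]; rewrite relativeE.
by rewrite val_subspaceB.
Qed.

Lemma is_class0 : is_class (0 : subquotient S B) 0.
Proof.
by exists 0; [exact: val_subspace0|exact: (esym (raddf0 (qproj (relative S B))))].
Qed.

Lemma is_class_0P x : is_class (0 : subquotient S B) x -> x \in B.
Proof. by move/is_class_diff/(_ is_class0); rewrite subr0. Qed.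

Lemma is_class_eq0 h x : is_class h x -> x \in B -> h = 0.
Proof. by move=> hx xB; apply: is_class_inj hx is_class0 _; rewrite subr0. Qed.

End Classes.

(** Representatives may be chosen arbitrarily for each element: the trivial kernels make the
    relation a bijection, and its linearity makes the chosen map linear. *)
Lemma linear_relation (K : pzRingType) (A B : lmodType K) (r : A -> B -> Prop) :
  (forall a, exists b, r a b) -> (forall b, exists a, r a b) ->
  (forall c a a' b b', r a b -> r a' b' -> r (c *: a + a') (c *: b + b')) ->
  (forall b, r 0 b -> b = 0) -> (forall a, r a 0 -> a = 0) ->
  exists F : {linear A -> B}, bijective F /\ forall a, r a (F a).
Proof.
move=> rA rB rL r0b ra0.
have rD a a' b b' : r a b -> r a' b' -> r (a - a') (b - b').
  move=> H H'; have := rL (-1) _ _ _ _ H' H.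
  by rewrite !scaleN1r ![- _ + _]addrC.
have ru a b b' : r a b -> r a b' -> b = b'.
  move=> H H'; apply/eqP; rewrite -subr_eq0; apply/eqP/r0b.
  by rewrite -(subrr a); apply: rD.
have ru' a a' b : r a b -> r a' b -> a = a'.
  move=> H H'; apply/eqP; rewrite -subr_eq0; apply/eqP/ra0.
  by rewrite -(subrr b); apply: rD.
have [F rF] := choice rA; have [G rG] := choice rB.
have Fl : linear F by move=> c a a'; apply: ru (rF _) _; apply: rL.
pose FL := GRing.isLinear.Build K A B *:%R F Fl.
exists (HB.pack_for {linear A -> B} F FL); split=> //.
exists G => [a|b]; first exact: ru' (rG _) (rF _).
exact: ru (rF _) (rG _).
Qed.

(** * The isomorphisms of the theorem *)

Section Cohomology.
Variables (R : realType) (n k : nat).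
Local Notation Vk := 'M[R]_(n + 1, k).
Local Notation C := R[i].
Local Notation N := ((n + 1) * k)%N.
Local Notation P := (mpoly N C).
Local Notation K := (polyform C N n).
Local Notation rc := (real_complex R).
Local Notation so_inv := (so_inv (@real_orthogonal R n)).
Local Notation o_inv := (o_inv (@real_orthogonal R n)).
Local Notation toform := (@toform R n k).
Local Notation cochain := (@cochain R n k).
Local Notation cocycle := (@cocycle R n k).
Local Notation coboundary := (@coboundary R n k).
Local Notation cohomology := (@cohomology R n k).
Local Notation Oo := (@real_orthogonal_tr R n).
Local Notation Ol := (@so_inv_lie R n k).
Local Notation etaT := (eta_word C n ([set: 'I_k])).
Implicit Types (v : Vk) (p q s h : P) (psi chi : K) (g : 'M[R]_n) (l : nat).
Implicit Types (f : Defs.subspace (@Rpoly R n k)).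

Lemma hdeg_gt l psi : (n < l)%N -> hdeg l psi -> psi = 0.
Proof.
move=> nl H; apply/ffunP => I; rewrite [RHS]ffunE H// => Il.
by have := max_card (mem I); rewrite card_ord Il leqNgt nl.
Qed.

Lemma top_cocycle psi : so_inv psi -> hdeg n psi -> toform psi \in cocycle n.
Proof.
move=> psiI psin; apply/cocycleP; exists psi; split=> //.
by apply: (@hdeg_gt n.+1) => //; apply/hdegp_dd/hdegpS.
Qed.

Lemma coboundary_coclosed l psi : (l <= n)%N -> toform psi \in coboundary l ->
  koszul_adj psi = 0 -> psi = 0.
Proof.
move=> ln /coboundaryP[chi [chiI chil /toform_inj ->]]; case: l ln chil => [_ chi0 _|l ln].
  by rewrite (_ : chi = 0) ?dd0//; apply/ffunP => I; rewrite ffunE chi0.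
by move=> /hdegpS chil; exact: (exact_coclosed Oo Ol ln chiI chil).
Qed.

Lemma exact_coboundary l chi : so_inv chi -> hdegp l chi ->
  toform (dd chi) \in coboundary l.
Proof. by move=> chiI chil; apply/coboundaryP; exists chi. Qed.

(** Below degree n the harmonic representative is zero unless l = k, and above n there are no
    forms. *)
Lemma cohomology_vanish l : l != k -> l != n -> forall h : cohomology l, h = 0.
Proof.
move=> lk ln h; have [x /cocycleP[psi [psiI psil dpsi ->]] hx] := is_class_repr h.
apply: (is_class_eq0 hx); move: ln; rewrite neq_ltn => /orP[ln|nl].
  have [u [chi [uZ chiI chil ->]]] := closed_split Oo Ol ln psiI psil dpsi.
  by rewrite (cyc_eq0 Ol ln lk uZ) add0r; apply: exact_coboundary.
by rewrite (hdeg_gt nl psil) toform0 rpred0.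
Qed.

Definition KM_form (f : Defs.subspace (@Rpoly R n k)) : Defs.form R n k :=
  form_mul (pullback (val f)) (@phi_KM R n k).

Lemma KM_formP c f f' : KM_form (c *: f + f') = c *: KM_form f + KM_form f'.
Proof.
have E : val (c *: f + f') = c *: val f + val f' by exact: subspace_val_linear.
apply/funext => v; rewrite /KM_form E /form_mul /pullback.
rewrite !fctE; exact: etrans (scalerDl _ _ _) (congr1 (+%R^~ _) (esym (scalerA _ _ _))).
Qed.

Lemma KM_formE f : exists s, [/\ o_inv s, tfree s, pullback (val f) = pfun s
  & KM_form f = toform (s *: etaT)].
Proof.
have [s [sO st E]] := Rpoly_pullback (valP f).
by exists s; split=> //; apply: phi_KM_word.
Qed.

Lemma KM_form_ex s : o_inv s -> tfree s -> exists f : Defs.subspace (@Rpoly R n k),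
  pullback (val f) = pfun s /\ KM_form f = toform (s *: etaT).
Proof.
move=> sO st; have [f fR E] := tfree_Rpoly sO st.
exists (Subspace fR); split; [exact: E|exact: phi_KM_word].
Qed.

Lemma KM_form0 : KM_form 0 = 0.
Proof.
by have := KM_formP (-1) 0 0; rewrite scaleN1r addNr => ->; rewrite scaleN1r addNr.
Qed.

Lemma KM_form_eq0 f s : pullback (val f) = pfun s -> s = 0 -> f = 0.
Proof.
move=> E s0; apply: val_inj; apply: pullback_inj; rewrite E s0 pfun0.
exact: (esym (congr1 (@pullback R n k) (val_subspace0 _))).
Qed.

Lemma tfree_coclosed s : tfree s -> koszul_adj (s *: etaT) = 0.
Proof.
move=> st; rewrite /koszul_adj big1// => j _.
by rewrite dtM st scale0r dt_eta_word scaler0 addr0 del_op0.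
Qed.

Lemma KM_cohomology (k_gt0 : (0 < k)%N) : (k < n)%N ->
  exists F : {linear Defs.subspace (@Rpoly R n k) -> cohomology k},
    bijective F /\ forall f, is_class (F f) (KM_form f).
Proof.
move=> kn; have kn' := ltnW kn.
have cyc_cocycle s : o_inv s -> tfree s -> toform (s *: etaT) \in cocycle k.
  move=> sO st; have uZ := cyc_eta Oo sO st; have [uI uk _ _] := uZ.
  by apply/cocycleP; exists (s *: etaT); split=> //; apply: (cyc_closed Ol kn).
pose r f (b : cohomology k) := is_class b (KM_form f).
have [|||||F [Fb Fr]] := linear_relation (r := r); last by exists F.
- move=> f; have [s [sO st _ fE]] := KM_formE f; rewrite /r fE.
  exact/is_class_ex/cyc_cocycle.
- move=> b; have [x /cocycleP[psi [psiI psik dpsi ->]] bx] := is_class_repr b.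
  (* Surjectivity: the harmonic representative is a t-free invariant polynomial times the product of
     all eta_j, hence some f times [phi_KM]. *)
  have [u [chi [uZ chiI chil E]]] := closed_split Oo Ol kn psiI psik dpsi.
  have [s [sO st uE]] := cyc_top Oo Ol kn uZ.
  have [f [_ fE]] := KM_form_ex sO st; exists f; rewrite /r fE.
  apply: is_class_eq bx; first exact: cyc_cocycle.
  rewrite E toformD uE addrAC subrr add0r; exact: exact_coboundary.
- by move=> c f f' b b' H H'; rewrite /r KM_formP; apply: is_classP.
- by move=> b H; apply: (is_class_eq0 H); rewrite KM_form0 rpred0.
- move=> f; have [s [sO st sE fE]] := KM_formE f; rewrite /r fE.
  (* Injectivity: with s free of t the form is coclosed, so it is zero once it is a coboundary. *)
  move=> /is_class_0P H; apply: (KM_form_eq0 sE); apply: (eta_wordT_free kn').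
  exact: coboundary_coclosed H (tfree_coclosed st).
Qed.

Definition Squotient := subquotient (@Spoly R n k) (@cideal R n k).
HB.instance Definition _ := GRing.Lmodule.on Squotient.

(** Orthogonality to the ideal (q), expressed through s vol. Each class of P_k modulo (q), and for k
    <= n each class of S_k modulo (c), contains exactly one such polynomial. *)
Definition harmonic s := koszul_adj (s *: (vol : K)) = 0.

Lemma harmonicP c s s' : harmonic s -> harmonic s' -> harmonic (mpolyC N c * s + s').
Proof.
by move=> H H'; rewrite /harmonic scalerDl -scalerA koszul_adjD koszul_adj_C H H' scaler0 addr0.
Qed.

Lemma volume_formZD c s s' : volume_form (pfun (mpolyC N c * s + s')) =
  c *: volume_form (pfun s) + volume_form (pfun s').
Proof. by rewrite !volume_formE scalerDl -scalerA toformP. Qed.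

Lemma Spoly_pfun s : o_inv s -> pfun s \in @Spoly R n k.
Proof. by move=> sO; apply/SpolyP; exists s. Qed.

Lemma o_inv_so s psi : o_inv s -> hdeg n psi -> psi = s *: (vol : K) ->
  so_inv psi.
Proof.
move=> sO _ -> h hO h1; rewrite actZ act_vol h1 mpolyC1 scale1r.
by rewrite sO.
Qed.

Lemma vol_cocycle s : o_inv s -> volume_form (pfun s) \in cocycle n.
Proof.
move=> sO; rewrite volume_formE; have H : hdeg n (s *: (vol : K)).
  exact/hdeg_fZ/hdeg_vol.
by apply: top_cocycle => //; apply: (o_inv_so sO H).
Qed.

Lemma Squotient_harmonic (n_gt0 : (0 < n)%N) (a : Squotient) : (k <= n)%N ->
  exists s, [/\ o_inv s, harmonic s & is_class a (pfun s)].
Proof.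
move=> kn; have [f /SpolyP[s0 s0O ->] aC] := is_class_repr a.
have [s [c [sO sH cO E]]] :=
  ideal_split Oo Ol (real_orthogonal_refl R n_gt0) n_gt0 kn s0O.
exists s; split=> //; apply: is_class_eq aC; first exact: Spoly_pfun.
rewrite -pfunB; apply/cidealP; exists c => //.
by rewrite E addrAC subrr add0r.
Qed.

Lemma Squotient_eq0 s : harmonic s -> is_class (0 : Squotient) (pfun s) -> s = 0.
Proof.
move=> sH /is_class_0P/cidealP[c _ /pfun_inj E].
by move: sH; rewrite /harmonic E => /cideal_disj.
Qed.

Lemma volume_coclosed s : harmonic s -> volume_form (pfun s) \in coboundary n -> s = 0.
Proof.
move=> sH; rewrite volume_formE => H; apply: vol_free.
exact: coboundary_coclosed (leqnn n) H sH.
Qed.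

Lemma top_cohomology (n_gt0 : (0 < n)%N) : (k < n)%N ->
  exists F : {linear Squotient -> cohomology n}, bijective F /\
    forall a, exists2 f : Vk -> C^o, f \in @Spoly R n k & is_class (F a) (volume_form f).
Proof.
move=> kn; have kn' := ltnW kn.
(* Two classes are related when one harmonic polynomial represents both; it exists for a by
   [Squotient_harmonic] and for b by [top_split]. *)
pose r (a : Squotient) (b : cohomology n) := exists s, [/\ o_inv s, harmonic s,
  is_class a (pfun s) & is_class b (volume_form (pfun s))].
have [|||||F [Fb Fr]] := linear_relation (r := r).
- move=> a; have [s [sO sH sa]] := Squotient_harmonic n_gt0 a kn'.
  have [b bs] := is_class_ex (coboundary n) (vol_cocycle sO).
  by exists b, s.
- move=> b; have [x /cocycleP[psi [psiI psin dpsi ->]] bx] := is_class_repr b.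
  have [y [chi [[yI yn] y0 chiI chin E]]] := top_split Oo psiI psin.
  have [s sO yE] := top_form Oo Ol kn yI yn.
  have [a sa] := is_class_ex (@cideal R n k) (Spoly_pfun sO).
  exists a, s; split=> //; first by rewrite /harmonic -yE.
  apply: is_class_eq bx; first exact: vol_cocycle.
  rewrite volume_formE -yE E toformD addrAC subrr add0r; exact: exact_coboundary.
- move=> c a a' b b' [s [sO sH sa sb]] [s' [sO' sH' sa' sb']].
  exists (mpolyC N c * s + s'); split.
  + by apply: o_invD => //; apply: o_invM => //; apply: o_invC.
  + exact: harmonicP.
  + by rewrite pfunZD; apply: is_classP.
  + by rewrite volume_formZD; apply: is_classP.
- move=> b [s [sO sH sa sb]]; apply: (is_class_eq0 sb).
  by rewrite (Squotient_eq0 sH sa) volume_formE scale0r toform0 rpred0.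
- move=> a [s [sO sH sa /is_class_0P sb]]; apply: (is_class_eq0 sa).
  by rewrite (volume_coclosed sH sb) pfun0 rpred0.
refine (ex_intro _ F (conj Fb _)) => a; have [s [sO _ _ sb]] := Fr a.
by exists (pfun s); [exact: Spoly_pfun|exact: sb].
Qed.

Lemma middle_cohomology (n_gt0 : (0 < n)%N) : k = n ->
  exists F : {linear (Defs.subspace (@Rpoly R n k) * Squotient)%type -> cohomology n},
  [/\ bijective F, forall f, is_class (F (f, 0)) (KM_form f) &
    forall a, exists2 f : Vk -> C^o, f \in @Spoly R n k &
      is_class (F (0, a)) (volume_form f)].
Proof.
move=> kn; have kn' : (k <= n)%N by rewrite kn.
have etaT_cocycle s : o_inv s -> tfree s -> toform (s *: etaT) \in cocycle n.
  move=> sO st; have [uI uk _ _] := cyc_eta Oo sO st.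
  exact: top_cocycle uI (eq_ind k (fun l => hdeg l (s *: etaT)) uk n kn).
(* The first coordinate determines its form by itself, so a harmonic representative is chosen for
   the second only. *)
pose r (fa : Defs.subspace (@Rpoly R n k) * Squotient) (b : cohomology n) :=
  exists s, [/\ o_inv s, harmonic s,
  is_class fa.2 (pfun s) & is_class b (KM_form fa.1 + volume_form (pfun s))].
have [|||||F [Fb Fr]] := linear_relation (r := r).
- move=> [f a]; have [s [sO sH sa]] := Squotient_harmonic n_gt0 a kn'.
  have [s' [sO' st' _ fE]] := KM_formE f.
  have [|b bs] := @is_class_ex _ _ (cocycle n) (coboundary n) (KM_form f + volume_form (pfun s)).
    by rewrite rpredD ?vol_cocycle// fE etaT_cocycle.
  by exists b, s.
- move=> b; have [x /cocycleP[psi [psiI psin dpsi ->]] bx] := is_class_repr b.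
  have [y [chi [[yI yn] y0 chiI chin E]]] := top_split Oo psiI psin.
  have [p [s [pO sO yE]]] := top_form_eq Oo Ol kn yI yn.
  (* A reflection separates the two parts of the coclosed form; the coefficient of the first is then
     free of t. *)
  have [pt sH] : tfree p /\ harmonic s.
    apply: (top_coclosed Oo (real_orthogonal_refl R n_gt0) kn pO sO).
    by rewrite -yE.
  have [f [_ fE]] := KM_form_ex pO pt.
  have [a sa] := is_class_ex (@cideal R n k) (Spoly_pfun sO).
  exists (f, a), s; split=> //=.
  apply: is_class_eq bx.
    by rewrite rpredD ?vol_cocycle// fE etaT_cocycle.
  rewrite fE volume_formE -toformD -yE E toformD addrAC subrr add0r.
  exact: exact_coboundary.
- move=> c [f a] [f' a'] b b' [s [sO sH /= sa sb]] [s' [sO' sH' /= sa' sb']].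
  exists (mpolyC N c * s + s'); split=> /=.
  + by apply: o_invD => //; apply: o_invM => //; apply: o_invC.
  + exact: harmonicP.
  + by rewrite pfunZD; apply: is_classP.
  + have E : KM_form (c *: f + f') + volume_form (pfun (mpolyC N c * s + s')) =
        c *: (KM_form f + volume_form (pfun s)) +
        (KM_form f' + volume_form (pfun s')).
      rewrite KM_formP volume_formZD.
      move: (KM_form f) (KM_form f') (volume_form _) (volume_form _) => A A' B B'.
      by rewrite scalerDr addrACA.
    exact: (eq_ind_r (fun z => is_class (c *: b + b') z) (is_classP c sb sb') E).
- move=> b [s [sO sH /= sa sb]]; apply: (is_class_eq0 sb).
  by rewrite (Squotient_eq0 sH sa) volume_formE scale0r toform0 KM_form0 addr0 rpred0.
- move=> [f a] [s [sO sH /= sa /is_class_0P sb]].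
  have [p [pO pt pE fE]] := KM_formE f.
  have E : p *: etaT + s *: (vol : K) = 0.
    apply: (coboundary_coclosed (leqnn n)); first by rewrite toformD -fE -volume_formE.
    by rewrite koszul_adjD tfree_coclosed// sH addr0.
  have p0 : p = 0.
    apply: (eta_wordT_free kn').
    exact: (eta_vol_disj Oo (real_orthogonal_refl R n_gt0) pO sO E).
  have s0 : s = 0 by apply: vol_free; move: E; rewrite p0 scale0r add0r.
  rewrite (KM_form_eq0 pE p0); congr (_, _); apply: (is_class_eq0 sa).
  by rewrite s0 pfun0 rpred0.
refine (ex_intro _ F (And3 Fb _ _)) => [f|a].
- have [s [_ sH sa sb]] := Fr (f, 0).
  have E : KM_form f + volume_form (pfun s) = KM_form f.
    by rewrite (Squotient_eq0 sH sa) volume_formE scale0r toform0 addr0.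
  exact: (eq_ind _ (fun z => is_class (F (f, 0)) z) sb _ E).
- have [s [sO _ _ sb]] := Fr (0, a).
  have E : KM_form 0 + volume_form (pfun s) = volume_form (pfun s).
    by rewrite KM_form0 add0r.
  exists (pfun s); first exact: Spoly_pfun.
  exact: (eq_ind _ (fun z => is_class (F (0, a)) z) sb _ E).
Qed.

Definition Pquotient := subquotient (@Ppoly R n k) (@qideal R n k).

Lemma Ppoly_pfun p : pfun p \in @Ppoly R n k.
Proof. by apply/pfunP; exists p. Qed.

Definition so_fixed p :=
  forall g, special_orthogonal_mx g -> subst (map_mx rc g) p = p.

Lemma so_fixed_inv p : so_fixed p <-> so_inv (p *: (vol : K)).
Proof.
split=> [pI|/so_invP pI g gSO].
  apply/so_invP => g gSO; rewrite actZ act_vol det_map_mx.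
  by have [_ ->] := gSO; rewrite rmorph1 ?mpolyC1 scale1r pI.
have := pI g gSO; rewrite actZ act_vol det_map_mx.
by have [_ ->] := gSO; rewrite rmorph1 ?mpolyC1 scale1r => /vol_inj.
Qed.

Lemma quotient_act_pfun g p (x : poly_quotient R n k) : orthogonal_mx g ->
  is_class (x : Pquotient) (pfun p) ->
  is_class (quotient_act g x : Pquotient) (pfun (subst (map_mx rc g) p)).
Proof.
move=> gO [z zE ->]; rewrite quotient_actE//; exists (poly_act g z) => //.
by apply: etrans (translate_pfun p gO); rewrite -zE.
Qed.

Definition so_submod : submodClosed (poly_quotient R n k) := @SO_invariant R n k.

Definition so_class (x : Defs.subspace so_submod) : Pquotient :=
  subspace_val x.

Lemma so_class0 : so_class 0 = 0.
Proof. exact: (@val_subspace0 _ (poly_quotient R n k) so_submod). Qed.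

Lemma so_classP c x y : so_class (c *: x + y) = c *: so_class x + so_class y.
Proof. exact: (@subspace_val_linear _ (poly_quotient R n k) so_submod). Qed.

Lemma so_class_eq0 x : so_class x = 0 -> x = 0.
Proof. by move=> x0; apply: val_inj; apply: etrans x0 (esym so_class0). Qed.

(** The harmonic representative p of an invariant class is itself invariant: g p - p lies in (q),
    and it is harmonic because the adjoint of T commutes with g, so it is zero. *)
Lemma SO_invariant_ex (x : Defs.subspace so_submod) :
  exists p, [/\ so_fixed p, harmonic p & is_class (so_class x) (pfun p)].
Proof.
have [f /pfunP[p0 ->] xC] := is_class_repr (so_class x).
have [p [c [pH E]]] := poly_split p0.
have {}xC : is_class (so_class x) (pfun p).
  apply: is_class_eq xC; first exact: Ppoly_pfun.
  rewrite -pfunB; apply/qidealP; exists c.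
  by rewrite E addrAC subrr add0r.
exists p; split=> // g gSO; have [gO g1] := gSO.
have /asboolP/(_ g gSO) xg := valP x.
have := quotient_act_pfun gO xC; rewrite [quotient_act g _]xg => xC'.
have /qidealP[c' /pfun_inj E'] : pfun (subst (map_mx rc g) p - p) \in @qideal R n k.
  by rewrite pfunB; apply: is_class_diff xC' xC.
apply/eqP; rewrite -subr_eq0; apply/eqP; rewrite E'; apply: qideal_disj.
rewrite -E' scalerBl koszul_adjB [X in _ - X]pH subr0.
have -> : subst (map_mx rc g) p *: (vol : K) = act (map_mx rc g) (p *: (vol : K)).
  by rewrite actZ act_vol det_map_mx g1 rmorph1 ?mpolyC1 scale1r.
rewrite -act_koszul_adj ?pH ?act0//.
by apply: Oo; exists g.
Qed.

Lemma invariant_cohomology :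
  exists F : {linear Defs.subspace so_submod -> cohomology n},
  bijective F /\
    forall x, exists2 f : Vk -> C^o, f \in @Ppoly R n k & is_class (F x) (volume_form f).
Proof.
have vol_so p : so_fixed p -> volume_form (pfun p) \in cocycle n.
  move=> /so_fixed_inv pI; rewrite volume_formE; apply: top_cocycle => //.
  exact/hdeg_fZ/hdeg_vol.
pose r (x : Defs.subspace so_submod) (b : cohomology n) :=
  exists p, [/\ so_fixed p, harmonic p, is_class (so_class x) (pfun p)
    & is_class b (volume_form (pfun p))].
have harmonic_eq0 p : harmonic p -> pfun p \in @qideal R n k -> p = 0.
  move=> pH /qidealP[c /pfun_inj E]; rewrite E; apply: qideal_disj.
  by rewrite -E.
have [|||||F [Fb Fr]] := linear_relation (r := r).
- move=> x; have [p [pI pH xp]] := SO_invariant_ex x.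
  have [b bp] := is_class_ex (coboundary n) (vol_so _ pI).
  by exists b, p.
- move=> b; have [y0 /cocycleP[psi [psiI psin dpsi ->]] bx] := is_class_repr b.
  have [y [chi [[yI yn] yH chiI chin E]]] := top_split Oo psiI psin.
  have yE := hdeg_top yn; set p := y setT in yE.
  have pI : so_fixed p by apply/so_fixed_inv; rewrite -yE.
  have [x xp] := is_class_ex (@qideal R n k) (Ppoly_pfun p).
  have xI : x \in @SO_invariant R n k.
    apply/asboolP => g gSO; have [gO _] := gSO.
    have := quotient_act_pfun gO xp; rewrite pI// => xp'.
    by apply: is_class_inj xp' xp _; rewrite subrr rpred0.
  exists (Subspace xI), p; split=> //; first by rewrite /harmonic -yE.
  apply: is_class_eq bx; first exact: vol_so.
  rewrite volume_formE -yE E toformD addrAC subrr add0r; exact: exact_coboundary.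
- move=> c x x' b b' [p [pI pH xp bp]] [p' [pI' pH' xp' bp']].
  exists (mpolyC N c * p + p'); split.
  + by move=> g gSO; rewrite substD substM substC pI// pI'.
  + exact: harmonicP.
  + by rewrite pfunZD so_classP; apply: is_classP.
  + by rewrite volume_formZD; apply: is_classP.
- move=> b [p [pI pH xp bp]]; apply: (is_class_eq0 bp).
  rewrite (harmonic_eq0 p pH) ?volume_formE ?scale0r ?toform0 ?rpred0//.
  have {}xp : is_class (0 : Pquotient) (pfun p) by rewrite -so_class0.
  exact: is_class_0P xp.
- move=> x [p [pI pH xp /is_class_0P bp]].
  apply: so_class_eq0; apply: (is_class_eq0 xp).
  by rewrite (volume_coclosed pH bp) pfun0 rpred0.
refine (ex_intro _ F (conj Fb _)) => x; have [p [_ _ _ bp]] := Fr x.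
by exists (pfun p); [exact: Ppoly_pfun|exact: bp].
Qed.

End Cohomology.

Import Defs.

Theorem theorem1p1 (R : realType) (n k : nat)
    (hn : (1 <= n)%N) (hk : (1 <= k)%N) :
  [/\ (k < n)%N ->
        [/\ exists2 F : {linear subspace (@Rpoly R n k) -> cohomology R n k k},
              bijective F &
              forall f, is_class (F f)
                (form_mul (pullback (val f)) (@phi_KM R n k)),
            exists2 F : {linear subquotient (@Spoly R n k) (@cideal R n k) ->
                           cohomology R n k n},
              bijective F &
              forall s, exists2 f, f \in @Spoly R n k &
                is_class (F s) (volume_form f)
          & forall l, l != k -> l != n -> forall h : cohomology R n k l, h = 0],
      k = n ->
        (exists F : {linear (subspace (@Rpoly R n k) *
                             subquotient (@Spoly R n k) (@cideal R n k))%type ->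
                       cohomology R n k n},
           [/\ bijective F,
               forall f, is_class (F (f, 0))
                 (form_mul (pullback (val f)) (@phi_KM R n k))
             & forall s, exists2 f, f \in @Spoly R n k &
                 is_class (F (0, s)) (volume_form f)]) /\
        (forall l, l != n -> forall h : cohomology R n k l, h = 0)
    & (n < k)%N ->
        (exists2 F : {linear subspace (@SO_invariant R n k) ->
                        cohomology R n k n},
           bijective F &
           forall x, exists2 f, f \in @Ppoly R n k &
             is_class (F x) (volume_form f)) /\
        (forall l, l != n -> forall h : cohomology R n k l, h = 0)].
Proof.
have nh : (0 < n)%N := hn; split=> [kn|kn|nk].
- split; last exact: cohomology_vanish.
    by have [F [Fb Fr]] := @KM_cohomology R n k hk kn; exists F.
  by have [F [Fb Fr]] := @top_cohomology R n k nh kn; exists F.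
- split; first exact: middle_cohomology.
  by move=> l ln; apply: cohomology_vanish => //; rewrite kn.
- split; first by have [F [Fb Fr]] := @invariant_cohomology R n k; exists F.
  (* [cohomology_vanish] leaves out l = k, but here k > n and there are no forms of degree k. *)
  move=> l ln h; have [lk|lk] := eqVneq l k; last exact: cohomology_vanish.
  have [x /cocycleP[psi [_ psil _ xE]] hx] := is_class_repr h.
  apply: (is_class_eq0 hx); rewrite xE (hdeg_gt _ psil) ?toform0 ?rpred0//.
  by rewrite lk.
Qed.
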